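(* Let $d\ge1$ and $m\ge1$ be integers and let $X$ be any random vector in $\mathbb{R}^d$. Let $Y\sim\mathrm{MVN}_d(\mu,\Sigma)$ be a multivariate normal random vector with mean vector $\mu\in\mathbb{R}^d$ and covariance matrix $\Sigma$. Suppose that $(\Sigma)_{jj}>0$ for all $1\le j\le d$, and let $\sigma=\min_{1\le j\le d}\sqrt{(\Sigma)_{jj}}$. Let $M_m'=2^{m-2}(m-1)!$ for $1\le m\le4$ and $M_m'=2^{\frac{3m}2-2}(m-1)!$ for $m\ge5$, and let $N_m'=2^mM_m'$. Then $$d_{\mathrm K}(X,Y)\le2\bigg(\frac{\sqrt{2\log d}+2}{\sigma}\bigg)^{\frac m{m+1}}\big(N_m'\,d_m(X,Y)\big)^{\frac1{m+1}}+M_m'\,d_m(X,Y).$$ Moreover, if $d_m(X,Y)\le\frac{2+\sqrt{2\log d}}{\sigma N_m'}$ (if $m\ge2$ this can be weakened to $d_m(X,Y)\le\frac{4+2\sqrt{2\log d}}{\sigma M_m'}$), then $$d_{\mathrm K}(X,Y)\le2\bigg(\frac{\sqrt{2\log d}+2}{\sigma}\bigg)^{\frac m{m+1}}\big(N_m'\,d_m(X,Y)\big)^{\frac1{m+1}}.$$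
   Context: For $x,z\in\mathbb{R}^d$, $x\le z$ means $x_j\le z_j$ for all $j$. The Kolmogorov distance is $d_{\mathrm K}(X,Y)=\sup_{z\in\mathbb{R}^d}|\mathbb{P}(X\le z)-\mathbb{P}(Y\le z)|$. For $h:\mathbb{R}^d\to\mathbb{R}$, $|h|_0=\|h\|$ (supremum norm) and $|h|_k=\max_{i_1,\ldots,i_k}\big\|\frac{\partial^kh(w)}{\partial w_{i_1}\cdots\partial w_{i_k}}\big\|$ for $k\ge1$; if the $(m-1)$-th order partial derivatives of $h$ are Lipschitz, $|h|_m$ denotes the largest Lipschitz constant (with respect to the Euclidean norm) of the functions $\frac{\partial^{m-1}h}{\partial w_{i_1}\cdots\partial w_{i_{m-1}}}$, $1\le i_1,\ldots,i_{m-1}\le d$. $\mathcal{H}_m$ is the class of $h:\mathbb{R}^d\to\mathbb{R}$ whose $(m-1)$-th order partial derivatives are Lipschitz and with $|h|_j\le1$ for $0\le j\le m$, and $d_m(X,Y)=\sup_{h\in\mathcal{H}_m}|\mathbb{E}[h(X)]-\mathbb{E}[h(Y)]|$. *)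

(* Defs.v *)
From HB Require Import structures.
From mathcomp Require Import all_boot all_order all_algebra.
From mathcomp Require Import all_classical all_reals all_analysis.

Set Implicit Arguments.
Unset Strict Implicit.
Unset Printing Implicit Defensive.

Import Order.TTheory GRing.Theory Num.Theory.
Import numFieldNormedType.Exports.

Local Open Scope classical_set_scope.
Local Open Scope ring_scope.

(* A random vector in R^d is a family 'I_d -> {RV P >-> R} of real random
   variables on a common probability space. *)
Definition rvec {disp : measure_display} {T : measurableType disp}
    {R : realType} {P : probability T R} {d : nat}
    (X : 'I_d -> {RV P >-> R}) (w : T) : 'rV[R]_d :=
  \row_j X j w.

(* The norm that MathComp-Analysis puts on 'rV[R]_d is the max norm. *)
Definition enorm {R : realType} {d : nat} (x : 'rV[R]_d) : R :=
  Num.sqrt (\sum_(j < d) x 0 j ^+ 2).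

Definition supnorm {R : realType} {d : nat} (g : 'rV[R]_d -> R) : \bar R :=
  ereal_sup [set `|g x|%:E | x in [set: 'rV[R]_d]].

Definition lipschitz_enorm {R : realType} {d : nat} (g : 'rV[R]_d -> R) :=
  exists L : R, forall x y, `|g x - g y| <= L * enorm (x - y).

(* The smallest L such that |g x - g y| <= L * enorm (x - y) for all x, y. *)
Definition lipconst {R : realType} {d : nat} (g : 'rV[R]_d -> R) : \bar R :=
  ereal_sup [set (`|g xy.1 - g xy.2| / enorm (xy.1 - xy.2))%:E
            | xy in [set xy : 'rV[R]_d * 'rV[R]_d | xy.1 != xy.2]].

(* partial h [:: i_1; ...; i_k] is d^k h / (dw_{i_1} ... dw_{i_k}). *)
Definition partial {R : realType} {d : nat} (h : 'rV[R]_d -> R)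
    (s : seq 'I_d) : 'rV[R]_d -> R :=
  foldr (fun i (g : 'rV[R]_d -> R) x => 'D_(delta_mx 0 i) g x) h s.

(* 'D_v g is a total function, so existence has to be required separately. *)
Definition has_partials {R : realType} {d : nat} (k : nat)
    (h : 'rV[R]_d -> R) :=
  forall (s : seq 'I_d) (i : 'I_d) (x : 'rV[R]_d),
    (size s < k)%N -> derivable (partial h s) x (delta_mx 0 i).

(* |h|_k as a maximum of supremum norms of k-th order partial derivatives *)
Definition snorm {R : realType} {d : nat} (k : nat)
    (h : 'rV[R]_d -> R) : \bar R :=
  \big[maxe/0%E]_(s : k.-tuple 'I_d) supnorm (partial h s).

(* |h|_m as a maximum of Lipschitz constants of (m-1)-th order partial
   derivatives *)
Definition lnorm {R : realType} {d : nat} (m : nat)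
    (h : 'rV[R]_d -> R) : \bar R :=
  \big[maxe/0%E]_(s : m.-1.-tuple 'I_d) lipconst (partial h s).

(* Only (m-1)-th order partial derivatives need exist, so |h|_j is read as snorm
   for j < m and as lnorm for j = m. *)
Definition Hclass {R : realType} {d : nat} (m : nat)
    : set ('rV[R]_d -> R) :=
  [set h | [/\ has_partials m.-1 h,
               forall s : m.-1.-tuple 'I_d, lipschitz_enorm (partial h s),
               forall j, (j < m)%N -> (snorm j h <= 1)%E
             & (lnorm m h <= 1)%E]].

(* Supremum of a nonempty set bounded by 2, so the real-valued sup and fine are
   harmless; likewise below, with bound 1. *)
Definition dist_m {R : realType} {d : nat} (m : nat)
    {disp : measure_display} {T : measurableType disp} {P : probability T R}
    {disp' : measure_display} {T' : measurableType disp'}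
    {Q : probability T' R}
    (X : 'I_d -> {RV P >-> R}) (Y : 'I_d -> {RV Q >-> R}) : R :=
  sup [set `|fine ('E_P[fun w => h (rvec X w)])
             - fine ('E_Q[fun w => h (rvec Y w)])| | h in Hclass m].

Definition dist_K {R : realType} {d : nat}
    {disp : measure_display} {T : measurableType disp} {P : probability T R}
    {disp' : measure_display} {T' : measurableType disp'}
    {Q : probability T' R}
    (X : 'I_d -> {RV P >-> R}) (Y : 'I_d -> {RV Q >-> R}) : R :=
  sup [set `|fine (P [set w | forall j, rvec X w 0 j <= z 0 j])
             - fine (Q [set w | forall j, rvec Y w 0 j <= z 0 j])|
      | z in [set: 'rV[R]_d]].

(* normal_prob m 0 is the uniform distribution on [0, 1] by convention of the
   library, whereas N(m, 0) is the Dirac mass at m. *)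
Definition normal_law {R : realType} (m s : R) (A : set R) : \bar R :=
  if s == 0 then (\d_m A)%E else normal_prob m s A.

(* Y ~ MVN_d(mu, Sigma): every linear combination of the coordinates is
   univariate normal; Sigma is allowed to be singular. *)
Definition is_MVN {R : realType} {d : nat}
    {disp : measure_display} {T : measurableType disp} {P : probability T R}
    (Y : 'I_d -> {RV P >-> R}) (mu : 'rV[R]_d) (Sigma : 'M[R]_d) :=
  [/\ Sigma^T = Sigma,
      forall a : 'rV[R]_d, 0 <= (a *m Sigma *m a^T) 0 0
    & forall (a : 'rV[R]_d) (A : set R), measurable A ->
        P [set w | A ((rvec Y w *m a^T) 0 0)] =
        normal_law ((mu *m a^T) 0 0)
                   (Num.sqrt ((a *m Sigma *m a^T) 0 0)) A].

(* The infimum of a finite set, nonempty when 0 < d, i.e. its minimum. *)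
Definition min_sd {R : realType} {d : nat} (Sigma : 'M[R]_d) : R :=
  inf [set Num.sqrt (Sigma j j) | j in [set: 'I_d]].

Definition Mprime (R : realType) (m : nat) : R :=
  if (m <= 4)%N then 2 `^ (m%:R - 2) * (m.-1)`!%:R
  else 2 `^ (3 * m%:R / 2 - 2) * (m.-1)`!%:R.

Definition Nprime (R : realType) (m : nat) : R := 2 ^+ m * Mprime R m.

(* Main.v *)
Require Import Defs.
From HB Require Import structures.
From mathcomp Require Import all_boot all_order all_algebra.
From mathcomp Require Import all_classical all_reals all_analysis.
From mathcomp Require Import measurable_realfun ring lra zify.

Set Implicit Arguments.
Unset Strict Implicit.
Unset Printing Implicit Defensive.

Import Order.TTheory GRing.Theory Num.Theory.
Import numFieldNormedType.Exports.

Local Open Scope classical_set_scope.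
Local Open Scope ring_scope.

(* The indicator of the orthant [x <= z] is replaced by a test function h which
   is the ramp [c (1/2 - min(a, max_l (x_l - z_l)^+) / a)] averaged [m - 1]
   times, over a short interval, in each coordinate direction. A partial
   derivative of h is an average of iterated difference quotients of the ramp.
   As the ramp is monotone with oscillation c, its difference quotients with
   step b have oscillation at most c / b, and each further quotient costs a
   factor 2 / b. If the ramp and the averages have total width [2 / q], this
   gives [|h|_j <= c M' q^j] for [j <= m], so that h lies in [Hclass m] for
   [c = 1 / (M' max(1, q^m))]. The cases m = 3 and m = 4 need specific widths and
   finer bounds that exploit that along a coordinate axis the ramp is a
   difference of two truncated linear functions.

   Sandwiching h between step functions along the diagonal turns E h(Y) into an
   average of orthant probabilities of Y, which are within [A t] of each other
   when the orthants are translates by t, with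
   [A = (sqrt (2 log d) + 2) / sigma]. This anti-concentration bound for Gaussian
   vectors (Nazarov's inequality) is proved by splitting according to the
   coordinate Z_j that realizes the maximum: given the part of Y independent of
   Z_j this event is monotone in Z_j, and comparison of the normal density with
   its tail gives the bound. As Y is given by the laws of its linear
   combinations only, independence is derived from product formulas for cosines,
   which generate all the half-space indicators involved.

   With [alpha = 2 / q] this yields
   [d_K <= A alpha + M' max(1, (2 / alpha)^m) d_m] for every [alpha > 0], and
   [alpha^(m+1) = N' d_m / A] makes the two terms with alpha equal. *)

(** * The normal distribution *)

(** Origin of the constant in A: with K = sqrt (2 log d), a face of the orthant more than K standard
    deviations above its mean meets a density of at most 1/(2d), so all such faces together
    contribute at most 1/2. A face at height at most K is weighed against the tail beyond it, where
    density over tail is at most K + 1; the tails are cut down to disjoint events, so these faces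
    contribute K + 1 in total and not each. The sum K + 3/2 leaves 1/2 for the error of finite
    increments. Origin of the widths: the budget 2/q counts an average with its full width but the
    ramp with half of its width, because only the mean over the levels of the ramp enters E h(Y).
    Splitting the budget into m equal shares gives bounds c m^j q^j / 4 for j >= 2, which suffices
    when m^m <= 4 M'; this inequality fails only for m = 3 (27 > 16) and m = 4 (256 > 96). *)

Lemma normal_pdf1E (R : realType) (m x : R) :
  normal_pdf m 1 x = normal_peak 1 * expR (- (x - m) ^+ 2 / 2).
Proof. by rewrite normal_pdfE ?oner_neq0// /normal_fun expr1n. Qed.

Lemma normal_pdf1_gt0 (R : realType) (m x : R) : 0 < normal_pdf m 1 x.
Proof.
by rewrite normal_pdf1E mulr_gt0 ?expR_gt0// normal_peak_gt0// oner_neq0.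
Qed.

Lemma normal_peak1_le (R : realType) : normal_peak 1 <= 2^-1 :> R.
Proof.
have pi2 : (2 : R) ^+ 2 <= pi *+ 2 by have := pi_ge2 R; lra.
rewrite /normal_peak expr1n mul1r lef_pV2 ?posrE ?sqrtr_gt0//; last first.
  exact: lt_le_trans pi2.
by rewrite -[leLHS]ger0_norm// -sqrtr_sqr ler_sqrt// (le_trans _ pi2).
Qed.

Lemma is_derive_normal_pdf1 (R : realType) (m x : R) :
  is_derive x 1 (normal_pdf m 1 : R -> R) (- (x - m) * normal_pdf m 1 x).
Proof.
have -> : normal_pdf m 1 =
    (fun x : R => normal_peak 1 * expR (- (x - m) ^+ 2 / 2)).
  by apply/funext => y; rewrite normal_pdf1E.
by apply: is_derive_eq; rewrite /GRing.scale /=; lra.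
Qed.

Lemma normal_pdf1_le_inv (R : realType) (m x : R) : m < x ->
  normal_pdf m 1 x <= (x - m)^-1.
Proof.
move=> mx; have x0 : 0 < x - m by rewrite subr_gt0.
rewrite normal_pdf1E mulNr expRN ler_pdivrMr ?expR_gt0// mulrC ler_pdivlMr//.
apply: (le_trans _ (expR_ge1Dx _)).
move: (x - m) x0 (normal_peak1_le R) => t t0 c1.
by have := ler_wpM2l (ltW t0) c1; have := sqr_ge0 (t - 1); nra.
Qed.

Lemma cvg_inv_shift (R : realType) (m : R) : (x - m)^-1 @[x --> +oo] --> 0.
Proof.
have xm : \forall x \near +oo, 0 < x - m.
  by near=> x; rewrite subr_gt0; near: x; apply: nbhs_pinfty_gt; exact: num_real.
by apply/(gtr0_cvgV0 xm); exact: cvg_addrr.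
Unshelve. all: by end_near. Qed.

Lemma normal_pdf1_cvg0 (R : realType) (m : R) :
  normal_pdf m 1 x @[x --> +oo] --> 0.
Proof.
apply: (@squeeze_cvgr _ _ _ _ (cst 0) (fun x => (x - m)^-1)).
- near=> x; rewrite ltW ?normal_pdf1_gt0//= normal_pdf1_le_inv//.
  by near: x; apply: nbhs_pinfty_gt; exact: num_real.
- exact: cvg_cst.
- exact: cvg_inv_shift.
Unshelve. all: by end_near. Qed.

(* The lower bound on the upper tail integrates
   [(- pdf x / (x - m + 1))' <= pdf x]. *)
Lemma normal_prob_tail_ge (R : realType) (m y : R) : m <= y ->
  ((normal_pdf m 1 y / (y - m + 1))%:E <= normal_prob m 1 `]y, +oo[)%E.
Proof.
move=> my.
pose f (x : R) :=
  normal_pdf m 1 x * ((x - m) / (x - m + 1) + (x - m + 1) ^- 2).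
pose F (x : R) := - (normal_pdf m 1 x / (x - m + 1)).
have den_gt0 (x : R) : m <= x -> 0 < x - m + 1.
  by move=> mx; rewrite ltr_wpDl// subr_ge0.
have f0 (x : R) : y <= x -> 0 <= f x.
  move=> yx; have xm : 0 <= x - m by rewrite subr_ge0 (le_trans my).
  rewrite /f mulr_ge0 ?(ltW (normal_pdf1_gt0 _ _))//.
  by rewrite addr_ge0 ?divr_ge0 ?invr_ge0 ?exprn_ge0// addr_ge0.
have dF (x : R) : m <= x -> is_derive x 1 F (f x).
  move=> mx; have x1 : x - m + 1 != 0 by rewrite gt_eqF// den_gt0.
  have := is_derive_normal_pdf1 m x => H.
  by apply: is_derive_eq; rewrite /GRing.scale /= /f; field.
have cf (x : R) : m <= x -> {for x, continuous f}.
  move=> mx; have x1 : x - m + 1 != 0 by rewrite gt_eqF// den_gt0.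
  apply/differentiable_continuous/derivable1_diffP.
  have := is_derive_normal_pdf1 m x => H.
  have x2 : (x - m + 1) ^+ 2 != 0 by rewrite sqrf_eq0.
  exact: ex_derive.
have cfy : {within `[y, +oo[, continuous f}.
  apply: continuous_in_subspaceT => x; rewrite inE/= in_itv/= andbT => yx.
  by apply: cf; exact: le_trans yx.
have -> : ((normal_pdf m 1 y / (y - m + 1))%:E =
    \int[lebesgue_measure]_(x in `[y, +oo[) (f x)%:E)%E.
  rewrite (@ge0_continuous_FTC2y _ f F y 0)//.
  - by rewrite sub0e EFinN oppeK.
  - rewrite -oppr0; apply: cvgN.
    apply: (@squeeze_cvgr _ _ _ _ (cst 0) (normal_pdf m 1)); last 2 first.
    + exact: cvg_cst.
    + exact: normal_pdf1_cvg0.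
    near=> x; have mx : m <= x by near: x; apply: nbhs_pinfty_ge; exact: num_real.
    have := den_gt0 x mx => x1.
    rewrite divr_ge0 ?(ltW (normal_pdf1_gt0 _ _)) ?(ltW x1)//=.
    rewrite ler_pdivrMr// ler_peMr ?(ltW (normal_pdf1_gt0 _ _))//.
    by rewrite lerDr subr_ge0.
  - by move=> x xy; case: (dF x (le_trans my (ltW xy))).
  - apply: cvg_at_right_filter.
    by apply/differentiable_continuous/derivable1_diffP; case: (dF y my).
  - move=> x; rewrite in_itv/= andbT => xy; rewrite derive1E.
    by have /@derive_val := dF x (le_trans my (ltW xy)).
have mf : measurable_fun `[y, +oo[ f.
  exact: subspace_continuous_measurable_fun.
have mpdf : measurable_fun `[y, +oo[ (normal_pdf m 1 : R -> R).
  by apply: measurable_funS (measurable_normal_pdf _ _).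
rewrite /normal_prob integral_itv_obnd_cbnd; last first.
  apply/measurable_EFinP; apply: measurable_funS mpdf => // x /=.
  by rewrite !in_itv/= !andbT => /ltW.
apply: ge0_le_integral => //.
- by move=> x /=; rewrite in_itv/= andbT => yx; rewrite lee_fin f0.
- exact/measurable_EFinP.
- exact/measurable_EFinP.
- move=> x /=; rewrite in_itv/= andbT => yx.
  have x0 := le_trans my yx; have x1 := den_gt0 x x0.
  rewrite lee_fin /f ler_piMr ?(ltW (normal_pdf1_gt0 _ _))//.
  rewrite -subr_ge0 (_ : 1 - _ = (x - m) / (x - m + 1) ^+ 2).
    by rewrite divr_ge0 ?exprn_ge0 ?(ltW x1)// subr_ge0.
  by field; rewrite gt_eqF.
Unshelve. all: by end_near. Qed.

Lemma normal_prob_itv_le (R : realType) (m y y' c : R) : y <= y' ->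
  (forall x, y < x <= y' -> normal_pdf m 1 x <= c) ->
  (normal_prob m 1 `]y, y'] <= (c * (y' - y))%:E)%E.
Proof.
move=> yy' yc; rewrite /normal_prob.
apply: (@le_trans _ _ (\int[lebesgue_measure]_(x in `]y, y']) (cst c%:E x))%E).
  apply: ge0_le_integral => //.
  - by move=> x _; rewrite lee_fin normal_pdf_ge0.
  - apply/measurable_EFinP.
    by apply: measurable_funS (measurable_normal_pdf _ _).
rewrite integral_cst//= lebesgue_measure_itv/= lte_fin.
case: ltP => [_|y'y]; first by rewrite EFinM EFinB.
rewrite mule0 lee_fin (_ : y' = y) ?subrr ?mulr0//.
by apply/le_anti; rewrite yy' y'y.
Qed.

(** Change of variables holds with the Radon-Nikodym derivative, which agrees almost everywhere with
    [normal_pdf] because both have the same integral over every measurable set. *)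
Lemma integral_normal_prob (R : realType) (m s : R) (f : R -> \bar R) :
  s != 0 -> (forall x, 0 <= f x)%E -> measurable_fun setT f ->
  (\int[normal_prob m s]_x f x =
   \int[lebesgue_measure]_x (f x * (normal_pdf m s x)%:E))%E.
Proof.
move=> s0 f0 mf.
pose nu : {finite_measure set _ -> \bar R} := normal_prob m s.
have numu : nu `<< lebesgue_measure := normal_prob_dominates m s.
rewrite -(@Radon_Nikodym_SigmaFinite.change_of_variables
  _ _ _ nu lebesgue_measure numu)//.
have mp : measurable_fun setT (EFin \o (normal_pdf m s : R -> R)).
  by apply/measurable_EFinP; exact: measurable_normal_pdf.
have iRN := Radon_Nikodym_SigmaFinite.f_integrable numu.
apply: ae_eq_integral => //.
- by apply: emeasurable_funM => //; exact: measurable_int iRN.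
- exact: emeasurable_funM.
- apply: ae_eqe_mul2l => //; apply: integral_ae_eq => // E _ mE.
  by rewrite -(Radon_Nikodym_SigmaFinite.f_integral numu).
Qed.

(** Half of the Gaussian exponent absorbs the factor [|x - m|], leaving a multiple of the density
    with standard deviation [sqrt 2]. This is the dominating function for differentiating the cosine
    integral below. *)
Lemma integrable_linear_normal_pdf (R : realType) (m : R) :
  lebesgue_measure.-integrable [set: R]
    (EFin \o (fun x => `|x - m| * normal_pdf m 1 x)).
Proof.
pose s : R := Num.sqrt 2.
have s0 : s != 0 by rewrite sqrtr_eq0 -ltNge.
apply: (le_integrable measurableT _ _
  (integrableZl measurableT (normal_peak s)^-1 (integrable_normal_pdf m s))).
  apply/measurable_EFinP; apply: measurable_funM; last first.
    exact: measurable_normal_pdf.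
  by apply: measurableT_comp => //; exact: measurable_funB.
move=> x _; rewrite /= lee_fin normrM normr_id normal_pdf1E normal_pdfE//.
rewrite mulKf; last by rewrite gt_eqF// normal_peak_gt0.
rewrite [X in _ <= X]ger0_norm ?normal_fun_ge0//.
rewrite [X in _ * X]ger0_norm; last by rewrite mulr_ge0 ?expR_ge0 ?normal_peak_ge0.
rewrite /normal_fun sqr_sqrtr//.
set u := x - m.
have -> : - u ^+ 2 / 2 = - u ^+ 2 / (2 *+ 2) + - (u ^+ 2 / (2 *+ 2)) by field.
rewrite expRD expRN.
set e := expR (- u ^+ 2 / (2 *+ 2)).
have e0 : 0 <= e by exact: expR_ge0.
rewrite (_ : `|u| * _ = e * (`|u| * normal_peak 1 / expR (u ^+ 2 / (2 *+ 2)))); last by ring.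
rewrite ler_piMr// ler_pdivrMr ?expR_gt0// mul1r.
apply: (le_trans _ (expR_ge1Dx _)).
have := ler_wpM2l (normr_ge0 u) (normal_peak1_le R).
rewrite -(real_normK (num_real u)).
by have := sqr_ge0 (`|u| - 1); nra.
Qed.

(** The fundamental theorem of calculus on the intervals [[- n.+1, n.+1]], passed to the limit by
    dominated convergence. *)
Lemma integral_derivative_eq0 (R : realType) (h dh : R -> R) :
  (forall x, is_derive x (1 : R) h (dh x)) -> continuous dh ->
  lebesgue_measure.-integrable [set: R] (EFin \o dh) ->
  h x @[x --> +oo] --> (0 : R) -> h x @[x --> -oo] --> (0 : R) ->
  \int[lebesgue_measure]_x dh x = 0.
Proof.
move=> hd cdh idh hy hNy.
pose I (n : nat) := `[- n.+1%:R, (n.+1%:R : R)]%classic.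
pose f_ n := (EFin \o dh) \_ (I n).
have mdh : measurable_fun setT (EFin \o dh) := measurable_int _ idh.
have [|||||_ _ c] := @dominated_convergence _ _ R lebesgue_measure setT
  measurableT f_ (EFin \o dh) (abse \o (EFin \o dh)).
- move=> n; apply/(measurable_restrictT _ _).1; first exact: measurable_itv.
  exact: (measurable_funS measurableT).
- by [].
- apply: aeW => x _; apply: cvg_near_cst.
  near=> n; have xn : `|x| <= n%:R by near: n; exact: nbhs_infty_ger.
  rewrite /f_ patchE ifT// inE /I/= in_itv/= -ler_norml (le_trans xn)//.
  by rewrite ler_nat.
- exact: integrable_abse.
- by apply: aeW => x n _; rewrite /f_ patchE; case: ifPn => //= _; rewrite normr0 lee_fin.
have hI n : (\int[lebesgue_measure]_x f_ n x = (h n.+1%:R - h (- n.+1%:R))%:E)%E.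
  rewrite EFinB -(@continuous_FTC2 _ dh h); last 3 first.
  - exact: continuous_subspaceT.
  - split.
    + by move=> x _; case: (hd x).
    + apply: cvg_at_right_filter.
      by apply/differentiable_continuous/derivable1_diffP; case: (hd (- n.+1%:R)).
    + apply: cvg_at_left_filter.
      by apply/differentiable_continuous/derivable1_diffP; case: (hd n.+1%:R).
  - by move=> x _; rewrite derive1E; have /@derive_val := hd x.
  - by rewrite [RHS]integral_mkcond.
  - by rewrite gtrN.
rewrite /Rintegral; have -> : (\int[lebesgue_measure]_x (dh x)%:E = 0)%E => //.
apply: (cvg_unique _ c) => //.
rewrite (_ : [sequence _]_n = (fun n => (h n.+1%:R - h (- n.+1%:R))%:E)); last first.
  by apply/funext => n /=; rewrite hI.
apply: cvg_EFin; first by apply: nearW.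
rewrite -[0](subrr 0).
apply: cvgB.
  apply: (cvg_comp _ _ _ hy); apply/cvgryPge => A; near=> n.
  by rewrite (@le_trans _ _ n%:R) ?ler_nat//; near: n; exact: nbhs_infty_ger.
apply: (cvg_comp _ _ _ hNy); apply/cvgrNyPle => A; near=> n.
rewrite lerNl (@le_trans _ _ n%:R) ?ler_nat//.
by near: n; exact: nbhs_infty_ger.
Unshelve. all: by end_near. Qed.

(** As a function C of t the integral solves C' = - t C: the derivative under the integral sign plus
    t times the integrand is the x-derivative of [sin (t (x - m) + c)] times the density, which
    integrates to 0. Hence C(t) exp(t^2/2) is constant, and t = 0 gives its value. The phase [c]
    makes one formula serve for cosine and sine. *)
Lemma Rintegral_cos_normal_pdf (R : realType) (m t c : R) :
  \int[lebesgue_measure]_x (cos (t * (x - m) + c) * normal_pdf m 1 x) =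
  cos c * expR (- t ^+ 2 / 2).
Proof.
set p := normal_pdf m 1.
have dp x : is_derive x (1 : R) p (- (x - m) * p x) := is_derive_normal_pdf1 m x.
have cp : continuous p by apply: continuous_normal_pdf; exact: oner_neq0.
have p0 x : 0 <= p x by exact: normal_pdf_ge0.
have iG := integrable_linear_normal_pdf m.
have ip := integrable_normal_pdf m 1.
have cder (f : R -> R) : (forall x : R, derivable f x 1) -> continuous f.
  by move=> df x; apply/differentiable_continuous/derivable1_diffP.
have mcts (f : R -> R) : continuous f -> measurable_fun setT (EFin \o f).
  by move=> cf; apply/measurable_EFinP; exact: continuous_measurable_fun.
pose f (t x : R) := cos (t * (x - m) + c) * p x.
pose g (t x : R) := - (x - m) * sin (t * (x - m) + c) * p x.
have dp' x : derivable p x 1 by case: (dp x).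
have cg s : continuous (g s).
  by apply: cder => x; have := dp x => H; exact: ex_derive.
have cf s : continuous (f s).
  by apply: cder => x; have := dp x => H; exact: ex_derive.
have if_ s : lebesgue_measure.-integrable setT (EFin \o f s).
  apply: (le_integrable measurableT _ _ ip); first exact: mcts.
  move=> x _; rewrite /= lee_fin normrM [`|p x|]ger0_norm// ler_piMl//.
  by rewrite ler_norml cos_geN1 cos_le1.
have gle s x : `|g s x| <= `|x - m| * p x.
  rewrite /g !normrM normrN [`|p x|]ger0_norm// ler_wpM2r//.
  by rewrite ler_piMr// ler_norml sin_geN1 sin_le1.
have ig s : lebesgue_measure.-integrable setT (EFin \o g s).
  apply: (le_integrable measurableT _ _ iG); first exact: mcts.
  by move=> x _; rewrite /= lee_fin (le_trans (gle s x))// ler_norm.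
have isf s : lebesgue_measure.-integrable setT (EFin \o (fun x => s * f s x)).
  by apply: eq_integrable (integrableZl measurableT s (if_ s)).
pose C t := \int[lebesgue_measure]_x f t x.
have Cg s : is_derive s (1 : R) C (\int[lebesgue_measure]_x g s x).
  have fd (x y : R) : is_derive x (1 : R) (f^~ y) (g x y).
    by apply: is_derive_eq; rewrite /GRing.scale /=/g; ring.
  have fg x y : partial1of2 f x y = g x y.
    by rewrite partial1of2E; have /@derive_val := fd x y.
  have H1 : `]s - 1, s + 1[%classic s by rewrite /= in_itv/=; apply/andP; split; lra.
  have H2 x y : `]s - 1, s + 1[%classic x -> setT y -> derivable (f^~ y) x 1.
    by move=> _ _; case: (fd x y).
  have H3 x y : `]s - 1, s + 1[%classic x -> setT y ->
     `|partial1of2 f x y| <= `|y - m| * p y by move=> _ _; rewrite fg.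
  have H4 y : 0 <= `|y - m| * p y by rewrite mulr_ge0.
  have D := derivable_under_integral measurableT H1 (fun x _ => if_ x) H2 H4 iG H3.
  apply: DeriveDef => //.
  rewrite -derive1E (differentiation_under_integral measurableT H1 (fun x _ => if_ x) H2 H4 iG H3).
  by apply: eq_Rintegral => y _; rewrite fg.
have sin_p_cvg0 s (F : set_system R) : Filter F -> p x @[x --> F] --> (0 : R) ->
    sin (s * (x - m) + c) * p x @[x --> F] --> (0 : R).
  move=> FF pF; apply/cvgr0Pnorm_le => e e0.
  near=> x; rewrite normrM (@le_trans _ _ `|p x|)//.
    by rewrite ler_piMl// ler_norml sin_geN1 sin_le1.
  by near: x; exact: cvgr0_norm_le.
have gC s : \int[lebesgue_measure]_x g s x = - s * C s.
  have : \int[lebesgue_measure]_x (g s x + s * f s x) = 0.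
    apply: (@integral_derivative_eq0 _ (fun x => sin (s * (x - m) + c) * p x)).
    - move=> x; have := dp x => H.
      by apply: is_derive_eq; rewrite /GRing.scale/= /g /f; ring.
    - by move=> x; apply: cvgD; [exact: cg|apply: cvgM; [exact: cvg_cst|exact: cf]].
    - by apply: eq_integrable (integrableD measurableT (ig s) (isf s)).
    - exact: sin_p_cvg0 (@normal_pdf1_cvg0 _ m).
    - apply: sin_p_cvg0; apply/cvgNy_compNP.
      rewrite (_ : p \o _ = normal_pdf (- m) 1); first exact: normal_pdf1_cvg0.
      apply/funext => x /=; rewrite /p !normal_pdf1E.
      by congr (_ * expR (- _ / 2)); ring.
  rewrite (RintegralD measurableT (ig s) (isf s)).
  rewrite (RintegralZl s measurableT (if_ s)) -/(C s) => /eqP; rewrite addr_eq0 mulNr => /eqP ->.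
  by [].
pose D s := C s * expR (s ^+ 2 / 2).
have : D t = D 0.
  apply: is_derive_0_is_cst => s; have := Cg s => H.
  by apply: is_derive_eq; rewrite gC /GRing.scale/=; field.
rewrite /D expr0n mul0r expR0 mulr1 {2}/C => Dt.
have -> : cos c = \int[lebesgue_measure]_x f 0 x.
  under eq_Rintegral => x _ do rewrite /f mul0r add0r.
  rewrite RintegralZl// [X in _ * X](_ : _ = 1) ?mulr1//.
  by rewrite /Rintegral integral_normal_pdf.
by rewrite -Dt mulNr expRN mulfK// gt_eqF// expR_gt0.
Unshelve. all: by end_near. Qed.

Lemma Rintegral_cos_normal_rv (R : realType) (disp : measure_display)
    (T : measurableType disp) (P : probability T R) (Z : T -> R) (m t c : R) :
  measurable_fun setT Z ->
  (forall A, measurable A -> P [set w | A (Z w)] = normal_prob m 1 A) ->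
  \int[P]_w cos (t * (Z w - m) + c) = cos c * expR (- t ^+ 2 / 2).
Proof.
move=> mZ PZ.
pose g (x : R) := cos (t * (x - m) + c).
have mg : measurable_fun setT g.
  apply: continuous_measurable_fun => x.
  by apply/differentiable_continuous/derivable1_diffP; exact: ex_derive.
have g1 x : `|g x| <= 1 by rewrite ler_norml cos_geN1 cos_le1.
have igP : P.-integrable setT (EFin \o (g \o Z)).
  apply: (le_integrable measurableT (g := cst 1%:E)).
  - by apply/measurable_EFinP; exact: measurableT_comp.
  - by move=> w _; rewrite /= lee_fin normr1.
  - exact: finite_measure_integrable_cst.
have ip := integrable_normal_pdf m 1.
have igp : lebesgue_measure.-integrable setT
    (EFin \o (fun x => g x * normal_pdf m 1 x)).
  apply: (le_integrable measurableT _ _ ip).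
    apply/measurable_EFinP; apply: measurable_funM => //.
    exact: measurable_normal_pdf.
  by move=> x _; rewrite /= lee_fin normrM ler_piMl.
have i1 : P.-integrable setT (cst 1%:E) by exact: finite_measure_integrable_cst.
(* Adding 1 makes the integrand nonnegative, as the change of variables requires. *)
apply: (addrI 1); rewrite -(Rintegral_cos_normal_pdf m t c).
transitivity (\int[P]_w (1 + g (Z w))).
  rewrite (RintegralD measurableT i1 igP); congr (_ + _).
  by rewrite Rintegral_cst// mul1r [X in fine X]probability_setT.
transitivity (\int[lebesgue_measure]_x (normal_pdf m 1 x + g x * normal_pdf m 1 x)); last first.
  rewrite (RintegralD measurableT ip igp); congr (_ + _).
  by rewrite /Rintegral integral_normal_pdf.
congr fine.
have g0 x : (0 <= (1 + g x)%:E)%E.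
  by rewrite lee_fin; have := g1 x; rewrite ler_norml; lra.
have m1g : measurable_fun setT (fun x => (1 + g x)%:E).
  by apply/measurable_EFinP; exact: measurable_funD.
pose S := g_sigma_algebraType (R.-ocitv.-measurable).
have mZ' : @measurable_fun _ _ T S setT Z by [].
have m1g' : @measurable_fun _ _ S (\bar R) setT (fun x => (1 + g x)%:E) by [].
rewrite -(@ge0_integral_distribution _ _ T S R P (@mfun_Sub _ _ T S Z (mem_set mZ')) _ m1g' g0).
transitivity (\int[normal_prob m 1]_x (1 + g x)%:E)%E.
  apply: (@eq_measure_integral _ S R setT (normal_prob m 1)) => A mA _; exact: PZ.
rewrite integral_normal_prob ?oner_neq0//.
by apply: eq_integral => x _; rewrite -EFinM mulrDl mul1r.
Qed.

Lemma measurable_rvec_mulmx (R : realType) (d : nat) (disp : measure_display)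
    (T : measurableType disp) (P : probability T R) (Y : 'I_d -> {RV P >-> R})
    (a : 'rV[R]_d) :
  measurable_fun setT (fun w => (rvec Y w *m a^T) 0 0).
Proof.
rewrite (_ : (fun _ => _) = (fun w => \sum_j Y j w * a 0 j)); last first.
  by apply/funext => w; rewrite mxE; apply: eq_bigr => j _; rewrite !mxE.
apply: measurable_sum => j; exact: measurable_funM.
Qed.

(** The characteristic function in real form. The vector [a] is rescaled to unit variance, unless
    its variance is 0; then the law is a Dirac mass and the linear combination is almost surely
    constant. *)
Lemma Rintegral_cos_MVN (R : realType) (d : nat) (disp : measure_display)
    (T : measurableType disp) (P : probability T R) (Y : 'I_d -> {RV P >-> R})
    (mu : 'rV[R]_d) (Sigma : 'M[R]_d) (a : 'rV[R]_d) (c : R) :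
  is_MVN Y mu Sigma ->
  \int[P]_w cos ((rvec Y w *m a^T) 0 0 + c) =
  cos ((mu *m a^T) 0 0 + c) * expR (- (a *m Sigma *m a^T) 0 0 / 2).
Proof.
move=> [_ /(_ a) q0 law].
set q := (a *m Sigma *m a^T) 0 0 in q0 *.
set l := (mu *m a^T) 0 0.
have [q_eq0|qn0] := eqVneq q 0.
  rewrite q_eq0 oppr0 mul0r expR0 mulr1.
  have PY : P [set w | (rvec Y w *m a^T) 0 0 = l] = 1%E.
    rewrite (law a [set l])// /normal_law -/q q_eq0 sqrtr0 eqxx diracE.
    by rewrite mem_set.
  have mY := measurable_rvec_mulmx Y a.
  rewrite (_ : cos (l + c) = \int[P]_w cos (l + c)); last first.
    by rewrite Rintegral_cst// [X in fine X]probability_setT mulr1.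
  congr fine; apply: ae_eq_integral => //.
  - apply/measurable_EFinP.
    apply: (measurableT_comp (continuous_measurable_fun (@continuous_cos R))).
    exact: measurable_funD.
  - exists (~` [set w | (rvec Y w *m a^T) 0 0 = l]).
    have mA : measurable [set w | (rvec Y w *m a^T) 0 0 = l].
      rewrite -[X in measurable X]setTI.
      by apply: (mY measurableT [set l]); exact: measurable_set1.
    split.
    + exact: measurableC.
    + by apply: etrans (probability_setC P mA) _; rewrite PY subee.
    + by move=> w /= H wl; apply: H => _; rewrite wl.
have q_gt0 : 0 < q by rewrite lt_neqAle eq_sym qn0.
pose s := Num.sqrt q; have s0 : 0 < s by rewrite sqrtr_gt0.
have sn0 : s != 0 by rewrite gt_eqF.
have law1 A : measurable A ->
    P [set w | A ((rvec Y w *m (s^-1 *: a)^T) 0 0)] = normal_prob (l / s) 1 A.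
  move=> mA; rewrite law// /normal_law.
  rewrite (_ : (mu *m _) 0 0 = l / s); last first.
    by rewrite linearZ/= -scalemxAr mxE mulrC.
  rewrite (_ : (_ *m _) 0 0 = s ^- 2 * q); last first.
    by rewrite [(_ *: a)^T]linearZ/= -scalemxAr -!scalemxAl scalerA mxE; congr (_ * _); rewrite -invfM.
  by rewrite sqr_sqrtr// mulVf// sqrtr1 (negbTE (oner_neq0 _)).
transitivity (\int[P]_w cos (s * ((rvec Y w *m (s^-1 *: a)^T) 0 0 - l / s) + (l + c))).
  apply: eq_Rintegral => w _; congr cos.
  have -> : (rvec Y w *m (s^-1 *: a)^T) 0 0 = s^-1 * (rvec Y w *m a^T) 0 0.
    by rewrite linearZ/= -scalemxAr mxE.
  by field.
rewrite (Rintegral_cos_normal_rv _ _ _ law1); last exact: measurable_rvec_mulmx.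
by rewrite sqr_sqrtr.
Qed.

(** * Anti-concentration of the maximum of a Gaussian vector *)

Section dot_product.
Context {R : realType} {d : nat}.
Implicit Types x a b : 'rV[R]_d.

Lemma dot_trD x a b :
  (x *m (a + b)^T) 0 0 = (x *m a^T) 0 0 + (x *m b^T) 0 0.
Proof. by rewrite linearD/= mulmxDr mxE. Qed.

Lemma dot_trN x a : (x *m (- a)^T) 0 0 = - (x *m a^T) 0 0.
Proof. by rewrite linearN/= mulmxN mxE. Qed.

Lemma dot_trB x a b :
  (x *m (a - b)^T) 0 0 = (x *m a^T) 0 0 - (x *m b^T) 0 0.
Proof. by rewrite dot_trD dot_trN. Qed.

Lemma dot_trZ x k a : (x *m (k *: a)^T) 0 0 = k * (x *m a^T) 0 0.
Proof. by rewrite linearZ/= -scalemxAr mxE. Qed.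

End dot_product.

(** * Half-space indicators as limits of trigonometric polynomials *)

Lemma cos_mul_cos (R : realType) (u v : R) :
  cos u * cos v = 2^-1 * (cos (u + v) + cos (u - v)).
Proof. by rewrite cosD cosB; field. Qed.

Lemma bernoulli_inequality (R : realType) (h : R) n :
  -1 <= h -> 1 + n%:R * h <= (1 + h) ^+ n.
Proof.
move=> h1; elim: n => [|n IH]; first by rewrite mul0r addr0 expr0.
rewrite exprSr -natr1; have h0 : 0 <= 1 + h by lra.
apply: le_trans (ler_wpM2r h0 IH).
by have := mulr_ge0 (ler0n R n) (sqr_ge0 h); nra.
Qed.

(** With w = sqrt z, the product n w^n stays bounded by 1/(1 - w), so n z^n is at most a multiple of
    w^n. *)
Lemma cvg_natr_exp0 (R : realType) (z : R) :
  0 <= z < 1 -> n%:R * z ^+ n @[n --> \oo] --> 0.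
Proof.
move=> /andP[z0 z1]; pose w := Num.sqrt z.
have w0 : 0 <= w by exact: sqrtr_ge0.
have w1 : w < 1 by rewrite -sqrtr1 ltr_sqrt.
have nw n : n%:R * (1 - w) * w ^+ n <= 1 - w ^+ n.
  elim: n => [|n IH]; first by rewrite !mul0r expr0 subrr.
  have wn0 : 0 <= w ^+ n.+1 by exact: exprn_ge0.
  have wn1 : w ^+ n.+1 <= 1 by rewrite exprn_ile1// ltW.
  have := ler_wpM2l w0 IH; rewrite exprS in wn0 wn1 *; rewrite -natr1.
  by have : 0 <= (1 - w) * (1 - w * w ^+ n) by [rewrite mulr_ge0// subr_ge0// ltW]; lra.
apply: (@squeeze_cvgr _ _ _ _ (cst 0) (fun n => (1 - w)^-1 * w ^+ n)).
- apply: nearW => n; rewrite mulr_ge0 ?exprn_ge0//=.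
  rewrite -(sqr_sqrtr z0) -/w -exprM mul2n -addnn exprD mulrA ler_wpM2r ?exprn_ge0//.
  rewrite -[leRHS]mul1r ler_pdivlMr ?subr_gt0// mulrAC (le_trans (nw n))//.
  by rewrite gerBl exprn_ge0.
- exact: cvg_cst.
- rewrite -(mulr0 (1 - w)^-1); apply: cvgM; first exact: cvg_cst.
  by apply: cvg_expr; rewrite ger0_norm.
Qed.

(** The decisive quantity is n 2^n u^n = n (2u)^n: it tends to 0 for u < 1/2 and is at least n
    otherwise, the extra factor n settling u = 1/2. These are polynomials in [u], so an algebra
    closed under bounded limits contains the thresholds of its members. *)
Lemma cvg_threshold (R : realType) (u : R) : 0 <= u <= 1 ->
  (1 - u ^+ n) ^+ (n * 2 ^ n)%N @[n --> \oo] --> ((u < 2^-1)%R%:R : R).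
Proof.
move=> /andP[u0 u1].
have un0 n : 0 <= u ^+ n by exact: exprn_ge0.
have un1 n : 0 <= 1 - u ^+ n by rewrite subr_ge0 exprn_ile1.
case: ltP => u2.
  apply: (@squeeze_cvgr _ _ _ _ (fun n => 1 - n%:R * (2 * u) ^+ n) (cst 1)).
  - apply: nearW => n; rewrite exprn_ile1 ?gerBl// andbT.
    have := @bernoulli_inequality R (- u ^+ n) (n * 2 ^ n).
    rewrite natrM natrX exprMn mulrN mulrA; apply.
    by rewrite lerNl opprK exprn_ile1.
  - rewrite -[X in _ --> X]subr0; apply: cvgB; first exact: cvg_cst.
    by apply: cvg_natr_exp0; apply/andP; split; lra.
  - exact: cvg_cst.
apply: (@squeeze_cvgr _ _ _ _ (cst 0) (fun n => (expR (-1) : R) ^+ n)).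
- apply: nearW => n; rewrite exprn_ge0//=.
  rewrite -expRM_natl mulrN1.
  have -> : - n%:R = (n * 2 ^ n)%:R * (- (2^-1) ^+ n) :> R.
    by rewrite natrM natrX exprVn mulrN mulfK.
  rewrite expRM_natl; apply: lerXn2r; rewrite ?nnegrE ?expR_ge0//.
  apply: le_trans (expR_ge1Dx _); rewrite lerD2l lerN2.
  by apply: lerXn2r; rewrite ?nnegrE.
- exact: cvg_cst.
- by apply: cvg_expr; rewrite ger0_norm ?expR_ge0// expR_lt1; lra.
Qed.

(* Contains the indicators of open and closed half-spaces with normals in [A],
   and is a multiplicative class. *)
Inductive trig_closure (R : realType) (d : nat) (A : set 'rV[R]_d) :
    ('rV[R]_d -> R) -> Prop :=
| trig_cos (a : 'rV[R]_d) (c : R) : A a ->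
    trig_closure A (fun x => cos ((x *m a^T) 0 0 + c))
| trig_add (f g : 'rV[R]_d -> R) : trig_closure A f -> trig_closure A g ->
    trig_closure A (fun x => f x + g x)
| trig_scale (k : R) (f : 'rV[R]_d -> R) : trig_closure A f ->
    trig_closure A (fun x => k * f x)
| trig_lim (f_ : nat -> 'rV[R]_d -> R) (f : 'rV[R]_d -> R) (C : R) :
    (forall n, trig_closure A (f_ n)) -> (forall n x, `|f_ n x| <= C) ->
    (forall x, f_ n x @[n --> \oo] --> f x) -> trig_closure A f.

Section trig_closure_theory.
Context {R : realType} {d : nat} (A : set 'rV[R]_d).
Hypothesis A0 : A 0.
Hypothesis Alin : forall k a b, A a -> A b -> A (k *: a + b).

Let AZ k a : A a -> A (k *: a).
Proof. by move=> Aa; rewrite -[_ *: _]addr0; exact: Alin. Qed.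

Let AD a b : A a -> A b -> A (a + b).
Proof. by move=> Aa; rewrite -[X in X + _]scale1r; exact: Alin. Qed.

Let AN a : A a -> A (- a).
Proof. by rewrite -scaleN1r; exact: AZ. Qed.

Lemma trig_closure_bounded (f : 'rV[R]_d -> R) :
  trig_closure A f -> exists C, forall x, `|f x| <= C.
Proof.
elim=> [a c _|{}f g _ [C fC] _ [D gD]|k {}f _ [C fC]|f_ {}f C _ _ fC ff].
- by exists 1 => x; rewrite ler_norml cos_geN1 cos_le1.
- by exists (C + D) => x; rewrite (le_trans (ler_normD _ _))// lerD.
- by exists (`|k| * C) => x; rewrite normrM ler_wpM2l.
- exists C => x; rewrite -(cvg_lim _ (cvg_norm (ff x)))//.
  apply: limr_le; first by apply/cvg_ex; exists `|f x|; exact: cvg_norm.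
  by apply: nearW => n; exact: fC.
Qed.

Lemma trig_closure_cst (k : R) : trig_closure A (fun=> k).
Proof.
have := trig_scale k (trig_cos 0 A0).
by under eq_fun do rewrite trmx0 mulmx0 mxE addr0 cos0 mulr1.
Qed.

(** Induction on both derivations. A product of two cosines is half the sum of the cosines with
    normals a + b and a - b, and bounded limits survive multiplication by a bounded function. *)
Lemma trig_closureM (f g : 'rV[R]_d -> R) :
  trig_closure A f -> trig_closure A g -> trig_closure A (fun x => f x * g x).
Proof.
move=> Af; elim: Af g => {f} [a c Aa|f1 f2 _ IH1 _ IH2|k f _ IH|f_ f C _ IH fC ff] g Ag.
- elim: Ag => {g} [b e Ab|g1 g2 _ IH1 _ IH2|k g _ IH|g_ g C _ IH gC gg].
  + have := trig_scale 2^-1 (trig_add (trig_cos (c + e) (AD Aa Ab))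
      (trig_cos (c - e) (AD Aa (AN Ab)))).
    congr trig_closure; apply/funext => x.
    by rewrite cos_mul_cos dot_trD dot_trB !addrA; congr (_ * (cos _ + cos _)); ring.
  + by have := trig_add IH1 IH2; under eq_fun do rewrite -mulrDr.
  + by have := trig_scale k IH; under eq_fun do rewrite mulrCA.
  + apply: (trig_lim (C := C) IH) => [n x|x].
      rewrite normrM -[leRHS]mul1r ler_pM//.
      by rewrite ler_norml cos_geN1 cos_le1.
    by apply: cvgM; [exact: cvg_cst|exact: gg].
- by have := trig_add (IH1 _ Ag) (IH2 _ Ag); under eq_fun do rewrite -mulrDl.
- by have := trig_scale k (IH _ Ag); under eq_fun do rewrite mulrA.
- have [D gD] := trig_closure_bounded Ag.
  apply: (trig_lim (C := C * D) (fun n => IH n _ Ag)) => [n x|x].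
    by rewrite normrM ler_pM.
  by apply: cvgM; [exact: ff|exact: cvg_cst].
Qed.

Lemma trig_closureX (f : 'rV[R]_d -> R) n :
  trig_closure A f -> trig_closure A (fun x => f x ^+ n).
Proof.
move=> Af; elim: n => [|n IH]; first by under eq_fun do rewrite expr0; exact: trig_closure_cst.
by under eq_fun do rewrite exprS; exact: trig_closureM.
Qed.

Lemma trig_closure_sin (a : 'rV[R]_d) (c : R) :
  A a -> trig_closure A (fun x => sin ((x *m a^T) 0 0 + c)).
Proof.
move=> Aa; have := trig_cos (c - pi / 2) Aa.
by under eq_fun do
  rewrite addrA cosB cos_pihalf sin_pihalf mulr0 add0r mulr1.
Qed.

(** Thresholding [(1 + sin (y / L)) / 2] at 1/2 gives the indicator of [sin (y / L) < 0]. As L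
    grows, [y / L] enters (-2, 2), where the sine has the sign of its argument. *)
Lemma trig_closure_lt (a : 'rV[R]_d) (c : R) : A a ->
  trig_closure A (fun x => ((x *m a^T) 0 0 < c)%R%:R).
Proof.
move=> Aa.
pose y (x : 'rV[R]_d) := (x *m a^T) 0 0 - c.
pose u L x : R := (1 + sin (L^-1 * y x)) / 2.
have Au L : trig_closure A (u L).
  have := trig_scale 2^-1 (trig_add (trig_closure_cst 1) (trig_closure_sin (- L^-1 * c) (AZ L^-1 Aa))).
  congr trig_closure; apply/funext => x.
  by rewrite /u dot_trZ mulrC /y mulNr mulrBr.
have u01 L x : 0 <= u L x <= 1.
  have := sin_le1 (L^-1 * y x); have := sin_geN1 (L^-1 * y x).
  by rewrite /u => s1 s2; apply/andP; split; lra.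
have As L : trig_closure A (fun x => (sin (L^-1 * y x) < 0)%R%:R).
  apply: (trig_lim (f_ := fun n x => (1 - u L x ^+ n) ^+ (n * 2 ^ n)%N) (C := 1)).
  - move=> n; apply: trig_closureX.
    have := trig_add (trig_closure_cst 1) (trig_scale (-1) (trig_closureX n (Au L))).
    by under eq_fun do rewrite mulN1r.
  - move=> n x; have /andP[u0 u1] := u01 L x.
    by rewrite ger0_norm ?exprn_ge0 ?exprn_ile1 ?gerBl ?subr_ge0 ?exprn_ge0 ?exprn_ile1.
  - move=> x; rewrite (_ : (sin _ < 0) = (u L x < 2^-1)); first exact/cvg_threshold/u01.
    by rewrite /u; apply/idP/idP; lra.
apply: (trig_lim (f_ := fun n x => (sin (n.+1%:R^-1 * y x) < 0)%R%:R) (C := 1)).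
- by move=> n; exact: As.
- by move=> n x; case: ltP; rewrite ?normr1 ?normr0.
- move=> x; apply: cvg_near_cst; rewrite -subr_lt0 -/(y x); near=> n.
  have n0 : 0 < n.+1%:R^-1 :> R by rewrite invr_gt0.
  have yn : n.+1%:R^-1 * `|y x| < 2.
    rewrite mulrC ltr_pdivrMr// (@le_lt_trans _ _ n%:R)//.
      by near: n; exact: nbhs_infty_ger.
    by rewrite -natrM ltr_nat mul2n -addnn ltn_addl.
  congr (nat_of_bool _)%:R; have [y0|y0|->] := ltgtP (y x) 0.
  - rewrite -oppr_gt0 -sinN sin2_gt0//.
    by rewrite -mulrN mulr_gt0 ?oppr_gt0//=; rewrite ltr0_norm in yn.
  - apply/negbTE; rewrite -leNgt ltW// sin2_gt0// mulr_gt0//=.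
    by rewrite gtr0_norm in yn.
  - by rewrite mulr0 sin0 ltxx.
Unshelve. all: by end_near. Qed.

Lemma trig_closure_le (a : 'rV[R]_d) (c : R) : A a ->
  trig_closure A (fun x => ((x *m a^T) 0 0 <= c)%R%:R).
Proof.
move=> Aa.
have := trig_add (trig_closure_cst 1) (trig_scale (-1) (trig_closure_lt (- c) (AN Aa))).
congr trig_closure; apply/funext => x; rewrite dot_trN ltrN2 ltNge.
by case: leP => _; rewrite mulN1r ?subr0 ?subrr.
Qed.

End trig_closure_theory.

(** * Independence of uncorrelated parts of a Gaussian vector *)

Lemma bounded_integrable (R : realType) (disp : measure_display)
    (T : measurableType disp) (P : probability T R) (f : T -> R) (C : R) :
  measurable_fun setT f -> (forall w, `|f w| <= C) ->
  P.-integrable setT (EFin \o f).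
Proof.
move=> mf fC; apply: (le_integrable measurableT (g := cst C%:E)).
- exact/measurable_EFinP.
- by move=> w _; rewrite /= lee_fin (le_trans (fC w))// ler_norm.
- exact: finite_measure_integrable_cst.
Qed.

Lemma cvg_Rintegral_bounded (R : realType) (disp : measure_display)
    (T : measurableType disp) (P : probability T R) (f_ : nat -> T -> R)
    (f : T -> R) (C : R) :
  (forall n, measurable_fun setT (f_ n)) -> (forall n w, `|f_ n w| <= C) ->
  (forall w, f_ n w @[n --> \oo] --> f w) ->
  \int[P]_w f_ n w @[n --> \oo] --> \int[P]_w f w.
Proof.
move=> mf_ fC ff.
have mf : measurable_fun setT f.
  by apply: (measurable_fun_cvg (h := f_)) => // w _; exact: ff.
have [|||||_ _ c] := @dominated_convergence _ T R P setT measurableT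
    (fun n => EFin \o f_ n) (EFin \o f) (cst C%:E).
- by move=> n; apply/measurable_EFinP.
- exact/measurable_EFinP.
- by apply: aeW => w _ ; apply: cvg_EFin; [exact: nearW|exact: ff].
- exact: finite_measure_integrable_cst.
- by apply: aeW => w n _; rewrite /= lee_fin.
apply: fine_cvg; rewrite fineK//; apply: integrable_fin_num => //.
apply: (@bounded_integrable _ _ _ _ _ C) => // w.
rewrite -(cvg_lim _ (cvg_norm (ff w)))//.
apply: limr_le; first by apply/cvg_ex; exists `|f w|; exact: cvg_norm.
by apply: nearW => n; exact: fC.
Qed.

Lemma quad_sym (R : realType) (d : nat) (Sigma : 'M[R]_d) (a b : 'rV[R]_d) :
  Sigma^T = Sigma -> (b *m Sigma *m a^T) 0 0 = (a *m Sigma *m b^T) 0 0.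
Proof.
move=> Ssym; have -> : b *m Sigma *m a^T = (a *m Sigma *m b^T)^T.
  by rewrite !trmx_mul trmxK Ssym mulmxA.
by rewrite mxE.
Qed.

Lemma quad_addZ (R : realType) (d : nat) (Sigma : 'M[R]_d) (k : R)
    (a b : 'rV[R]_d) :
  Sigma^T = Sigma -> (a *m Sigma *m b^T) 0 0 = 0 ->
  ((a + k *: b) *m Sigma *m (a + k *: b)^T) 0 0 =
  (a *m Sigma *m a^T) 0 0 + k ^+ 2 * (b *m Sigma *m b^T) 0 0.
Proof.
move=> Ssym ab; have := quad_sym a b Ssym; rewrite ab => ba.
have addE (u v : 'M[R]_1) : (u + v) 0 0 = u 0 0 + v 0 0 by rewrite mxE.
have scaleE (u : 'M[R]_1) : (k *: u) 0 0 = k * u 0 0 by rewrite mxE.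
rewrite dot_trD dot_trZ !mulmxDl -!scalemxAl !addE !scaleE ab ba.
by rewrite mulr0 addr0 add0r mulrA.
Qed.

Lemma trig_closureW (R : realType) (d : nat) (A B : set 'rV[R]_d) f :
  A `<=` B -> trig_closure A f -> trig_closure B f.
Proof.
move=> AB; elim=> [a c Aa|{}f g _ IHf _ IHg|k {}f _ IH|f_ {}f C _ IH fC ff].
- by apply: trig_cos; exact: AB.
- exact: trig_add.
- exact: trig_scale.
- exact: (trig_lim IH fC).
Qed.

Section trig_closure_MVN.
Context {R : realType} {d : nat} {disp : measure_display}
  {T : measurableType disp} {P : probability T R} (Y : 'I_d -> {RV P >-> R}).

Lemma trig_closure_measurable (A : set 'rV[R]_d) (f : 'rV[R]_d -> R) :
  trig_closure A f -> measurable_fun setT (fun w => f (rvec Y w)).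
Proof.
elim=> [a c _|{}f g _ mf _ mg|k {}f _ mf|f_ {}f C _ mf fC ff].
- apply: (measurableT_comp (continuous_measurable_fun (@continuous_cos R))).
  by apply: measurable_funD => //; exact: measurable_rvec_mulmx.
- exact: measurable_funD.
- exact: measurable_funM.
- by apply: (measurable_fun_cvg mf) => w _; exact: ff.
Qed.

Lemma trig_closure_integrable (A : set 'rV[R]_d) (f : 'rV[R]_d -> R) :
  trig_closure A f -> P.-integrable setT (EFin \o (fun w => f (rvec Y w))).
Proof.
move=> Af; have [C fC] := trig_closure_bounded Af.
by apply: (@bounded_integrable _ _ _ _ _ C); first exact: trig_closure_measurable Af.
Qed.

(** For two cosines with uncorrelated normals a and b, both a + b and a - b have the sum of the
    variances as variance, so the formula for E cos factorizes. Sums, multiples and bounded limits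
    pass through the integral on either side. *)
Lemma Rintegral_trig_closureM (mu : 'rV[R]_d) (Sigma : 'M[R]_d)
    (A B : set 'rV[R]_d) (f g : 'rV[R]_d -> R) :
  is_MVN Y mu Sigma ->
  (forall a b, A a -> B b -> (a *m Sigma *m b^T) 0 0 = 0) ->
  trig_closure A f -> trig_closure B g ->
  \int[P]_w (f (rvec Y w) * g (rvec Y w)) =
  \int[P]_w f (rvec Y w) * \int[P]_w g (rvec Y w).
Proof.
move=> hY AB Af Bg; have [Ssym _ _] := hY.
pose I h := \int[P]_w h (rvec Y w).
have Icl h := @trig_closure_integrable setT h.
have ID h1 h2 : trig_closure setT h1 -> trig_closure setT h2 ->
    I (fun x => h1 x + h2 x) = I h1 + I h2.
  by move=> H1 H2; rewrite /I RintegralD//; exact: Icl.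
have IZ k h : trig_closure setT h -> I (fun x => k * h x) = k * I h.
  by move=> H; rewrite /I RintegralZl//; exact: Icl.
have Ilim h_ h C : (forall n, trig_closure setT (h_ n)) ->
    (forall n x, `|h_ n x| <= C) -> (forall x, h_ n x @[n --> \oo] --> h x) ->
    I (h_ n) @[n --> \oo] --> I h.
  move=> H hC hh; apply: (@cvg_Rintegral_bounded _ _ _ _ _ _ C) => //.
  by move=> n; exact: trig_closure_measurable (H n).
have TM h1 h2 : trig_closure setT h1 -> trig_closure setT h2 ->
    trig_closure setT (fun x => h1 x * h2 x) by exact: trig_closureM.
have Tc (b : 'rV[R]_d) e : trig_closure setT (fun x : 'rV[R]_d => cos ((x *m b^T) 0 0 + e)).
  by apply: trig_cos.
suff : I (fun x => f x * g x) = I f * I g by [].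
have {Bg} [B' Bg] := (trig_closureW (subsetT B) Bg, Bg).
elim: Af => {f} [a c Aa|f1 f2 Af1 IH1 Af2 IH2|k f Af IH|f_ f C Af IH fC ff].
- move: {B'} Bg; elim => {g} [b e Bb|g1 g2 Bg1 IH1 Bg2 IH2|k g Bg IH|g_ g C Bg IH gC gg].
  + have ab := AB _ _ Aa Bb.
    have q1 := quad_addZ 1 Ssym ab; rewrite scale1r expr1n mul1r in q1.
    have q2 := quad_addZ (-1) Ssym ab; rewrite scaleN1r sqrrN expr1n mul1r in q2.
    transitivity (2^-1 * (I (fun x => cos ((x *m (a + b)^T) 0 0 + (c + e))) +
       I (fun x => cos ((x *m (a - b)^T) 0 0 + (c - e))))).
      rewrite -ID// -IZ; last exact: trig_add.
      apply: eq_Rintegral => w _; rewrite cos_mul_cos dot_trD dot_trB.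
      by congr (_ * (cos _ + cos _)); ring.
    rewrite /I !(Rintegral_cos_MVN _ _ hY) q1 q2 -mulrDl mulrA.
    rewrite [RHS]mulrACA -expRD cos_mul_cos dot_trD dot_trB.
    by congr (_ * (cos _ + cos _) * expR _); ring.
  + rewrite ID ?mulrDr -?IH1 -?IH2 -?ID//; last 4 first.
    * by apply: TM => //; exact: trig_closureW Bg1.
    * by apply: TM => //; exact: trig_closureW Bg2.
    * exact: trig_closureW Bg1.
    * exact: trig_closureW Bg2.
    by apply: eq_Rintegral => w _; rewrite mulrDr.
  + have Tg := trig_closureW (subsetT B) Bg.
    rewrite IZ// mulrCA -IH -IZ; last exact: TM.
    by apply: eq_Rintegral => w _; rewrite mulrCA.
  + have Tg n := trig_closureW (subsetT B) (Bg n).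
    set cs := fun x : 'rV_d => cos ((x *m a^T) 0 0 + c).
    have H1 : I (fun x => cs x * g_ n x) @[n --> \oo] --> I (fun x => cs x * g x).
      apply: (Ilim (fun n x => cs x * g_ n x) _ C) => [n|n x|x].
      - by apply: TM => //; exact: Tc.
      - rewrite normrM -[leRHS]mul1r ler_pM//.
        by rewrite ler_norml cos_geN1 cos_le1.
      - by apply: cvgM; [exact: cvg_cst|exact: gg].
    apply: (cvg_unique _ H1) => //.
    rewrite (_ : (fun n => I _) = (fun n => I cs * I (g_ n))); last exact/funext.
    by apply: cvgM; [exact: cvg_cst|exact: (Ilim _ _ C)].
- have [T1 T2] := (trig_closureW (subsetT A) Af1, trig_closureW (subsetT A) Af2).
  rewrite ID// mulrDl -IH1 -IH2 -ID//; try exact: TM.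
  by apply: eq_Rintegral => w _; rewrite mulrDl.
- have Tf := trig_closureW (subsetT A) Af.
  rewrite IZ// -mulrA -IH -IZ; last exact: TM.
  by apply: eq_Rintegral => w _; rewrite mulrA.
- have Tf n := trig_closureW (subsetT A) (Af n).
  have [D gD] := trig_closure_bounded Bg.
  have H1 : I (fun x => f_ n x * g x) @[n --> \oo] --> I (fun x => f x * g x).
    apply: (Ilim (fun n x => f_ n x * g x) _ (C * D)) => [n|n x|x].
    - exact: TM.
    - by rewrite normrM ler_pM.
    - by apply: cvgM; [exact: ff|exact: cvg_cst].
  apply: (cvg_unique _ H1) => //.
  rewrite (_ : (fun n => I _) = (fun n => I (f_ n) * I g)); last exact/funext.
  by apply: cvgM; [exact: (Ilim _ _ C)|exact: cvg_cst].
Qed.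

Lemma Rintegral_trig_closure_pred (A : set 'rV[R]_d) (p : pred 'rV[R]_d) :
  trig_closure A (fun x => (p x)%:R) ->
  \int[P]_w (p (rvec Y w))%:R = fine (P [set w | p (rvec Y w)]).
Proof.
move=> Ap; congr fine.
have mp : measurable [set w | p (rvec Y w)].
  have := trig_closure_measurable Ap measurableT (measurable_set1 (1 : R)).
  rewrite setTI; congr measurable; apply/seteqP; split => w /=.
    by case: (p _) => // /esym/eqP; rewrite oner_eq0.
  by move=> ->.
transitivity (\int[P]_w (\1_[set w | p (rvec Y w)] w)%:E)%E.
  by apply: eq_integral => w _; rewrite indicE mem_setE.
by rewrite integral_indic// setIT.
Qed.

Lemma probability_trig_closureI (mu : 'rV[R]_d) (Sigma : 'M[R]_d)
    (A B : set 'rV[R]_d) (p q : pred 'rV[R]_d) :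
  is_MVN Y mu Sigma ->
  (forall a b, A a -> B b -> (a *m Sigma *m b^T) 0 0 = 0) ->
  trig_closure A (fun x => (p x)%:R) -> trig_closure B (fun x => (q x)%:R) ->
  fine (P [set w | p (rvec Y w) && q (rvec Y w)]) =
  fine (P [set w | p (rvec Y w)]) * fine (P [set w | q (rvec Y w)]).
Proof.
move=> hY AB Ap Bq.
rewrite -(Rintegral_trig_closure_pred Ap) -(Rintegral_trig_closure_pred Bq).
rewrite -(Rintegral_trig_closureM hY AB Ap Bq).
rewrite -(@Rintegral_trig_closure_pred setT (fun x => p x && q x)).
  by apply: eq_Rintegral => w _; rewrite -natrM mulnb.
under eq_fun do rewrite -mulnb natrM.
by apply: trig_closureM => //; [exact: trig_closureW Ap|exact: trig_closureW Bq].
Qed.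

Lemma sum_Rintegral_trig_closure (A : set 'rV[R]_d) (n : nat)
    (f : 'I_n -> 'rV[R]_d -> R) :
  A 0 -> (forall j, trig_closure A (f j)) ->
  \int[P]_w (\sum_j f j (rvec Y w)) = \sum_j \int[P]_w f j (rvec Y w) /\
  trig_closure A (fun x => \sum_j f j x).
Proof.
move=> A0 Af; elim: (index_enum _) => [|j s [IH As]].
  rewrite big_nil; split; last first.
    by under eq_fun do rewrite big_nil; exact: trig_closure_cst.
  by under eq_Rintegral do rewrite big_nil; rewrite Rintegral_cst// mul0r.
split; last by under eq_fun do rewrite big_cons; exact: trig_add.
under eq_Rintegral do rewrite big_cons.
rewrite (RintegralD measurableT (trig_closure_integrable (Af j))
  (trig_closure_integrable As)).
by rewrite big_cons IH.
Qed.

Lemma le_Rintegral_trig_closure (A B : set 'rV[R]_d) (f g : 'rV[R]_d -> R) :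
  trig_closure A f -> trig_closure B g -> (forall x, f x <= g x) ->
  \int[P]_w f (rvec Y w) <= \int[P]_w g (rvec Y w).
Proof.
move=> Af Bg fg; apply: le_Rintegral => //.
- exact: trig_closure_integrable Af.
- exact: trig_closure_integrable Bg.
Qed.

End trig_closure_MVN.

(** * Increments of box probabilities *)

Lemma natr_forallb (R : realType) (n : nat) (p : pred 'I_n) :
  [forall j, p j]%:R = \prod_j (p j)%:R :> R.
Proof.
case: forallP => [pj|/forallP/forallPn[j pj]].
  by rewrite big1// => j _; rewrite pj.
by rewrite (bigD1 j)//= (negbTE pj) mul0r.
Qed.

Lemma trig_closure_forall (R : realType) (d n : nat) (A : set 'rV[R]_d)
    (p : 'I_n -> pred 'rV[R]_d) :
  A 0 -> (forall k a b, A a -> A b -> A (k *: a + b)) ->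
  (forall j, trig_closure A (fun x => (p j x)%:R)) ->
  trig_closure A (fun x => [forall j, p j x]%:R).
Proof.
move=> A0 Alin Ap; under eq_fun do rewrite natr_forallb.
elim: (index_enum _) => [|j s IH]; first by under eq_fun do rewrite big_nil; exact: trig_closure_cst.
by under eq_fun do rewrite big_cons; exact: trig_closureM.
Qed.

(** Up to height [K], the mass of a slab of thickness [e] is compared with the tail beyond it, the
    exponential factor paying for the drop of the density across the slab. Above [K] the density is
    bounded by its value at [K]. *)
Lemma normal_prob_ratio (R : realType) (m y K e : R) : 0 <= K -> 0 < e ->
  (y - m <= K ->
   fine (normal_prob m 1 `]y, y + e]) <=
     e * ((K + 1 + e) * expR (K * e + e ^+ 2 / 2)) *
     fine (normal_prob m 1 `]y + e, +oo[)) /\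
  (K < y - m ->
   fine (normal_prob m 1 `]y, y + e]) <= e * (normal_peak 1 * expR (- K ^+ 2 / 2))).
Proof.
move=> K0 e0.
have Nfin A : measurable A -> normal_prob m 1 A \is a fin_num by exact: fin_num_measure.
have pk0 : 0 < normal_peak 1 :> R by rewrite normal_peak_gt0 ?oner_neq0.
have Nle c : (forall x, y < x <= y + e -> normal_pdf m 1 x <= c) ->
    fine (normal_prob m 1 `]y, y + e]) <= e * c.
  move=> yc; rewrite -lee_fin fineK; last exact: Nfin.
  have ye : y <= y + e by rewrite lerDl ltW.
  apply: (le_trans (normal_prob_itv_le ye yc)).
  by rewrite lee_fin addrAC subrr add0r mulrC.
split=> yK.
(* On the slab the density is at most its value at [m + w], also when the slab starts below the
   mean; the tail is bounded below from [m + w + e] on, a point not below [y + e]. *)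
- pose w := Num.max (y - m) 0.
  have w0 : 0 <= w by rewrite le_max lexx orbT.
  have wy : y - m <= w by rewrite le_max lexx.
  have wK : w <= K by rewrite ge_max yK K0.
  apply: (le_trans (Nle (normal_peak 1 * expR (- w ^+ 2 / 2)) _)).
    move=> x /andP[yx _]; rewrite normal_pdf1E ler_wpM2l ?(ltW pk0)// ler_expR.
    rewrite ler_wpM2r// lerN2 /w; have [?|?] := leP (y - m) 0; first by rewrite expr0n/= sqr_ge0.
    by rewrite lerXn2r ?nnegrE//; lra.
  have tail : normal_peak 1 * expR (- (w + e) ^+ 2 / 2) / (w + e + 1) <=
      fine (normal_prob m 1 `]y + e, +oo[).
    have my : m <= m + w + e by rewrite -addrA lerDl; lra.
    have := normal_prob_tail_ge my.
    rewrite normal_pdf1E (_ : m + w + e - m = w + e); last by ring.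
    move=> H; rewrite -lee_fin fineK; last exact: Nfin.
    apply: (le_trans H); apply: le_measure; rewrite ?inE//.
    by move=> x /=; rewrite !in_itv/= !andbT; lra.
  rewrite -mulrA ler_wpM2l ?(ltW e0)//.
  apply: le_trans (ler_wpM2l _ tail); last by rewrite mulr_ge0 ?expR_ge0//; lra.
  have -> : - w ^+ 2 / 2 = - (w + e) ^+ 2 / 2 + (w * e + e ^+ 2 / 2) by field.
  rewrite expRD mulrA.
  rewrite [leRHS](_ : _ = normal_peak 1 * expR (- (w + e) ^+ 2 / 2) *
    (expR (K * e + e ^+ 2 / 2) * ((K + 1 + e) / (w + e + 1)))); last by ring.
  rewrite ler_wpM2l ?mulr_ge0 ?expR_ge0 ?(ltW pk0)//.
  rewrite -[leLHS]mulr1 ler_pM ?expR_ge0//.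
    by rewrite ler_expR lerD2r ler_wpM2r// ltW.
  by rewrite ler_pdivlMr; lra.
- apply: Nle => x /andP[yx _]; rewrite normal_pdf1E ler_wpM2l ?(ltW pk0)//.
  by rewrite ler_expR ler_wpM2r// lerN2 lerXn2r ?nnegrE; lra.
Qed.

Section nazarov.
Context {R : realType} {d : nat} {disp : measure_display}
  {T : measurableType disp} {P : probability T R} (Y : 'I_d -> {RV P >-> R})
  (mu : 'rV[R]_d) (Sigma : 'M[R]_d).
Hypothesis hY : is_MVN Y mu Sigma.
Context {n : nat} (v : 'I_n -> 'rV[R]_d).
Hypothesis v1 : forall j, (v j *m Sigma *m (v j)^T) 0 0 = 1.

Let Z j (x : 'rV[R]_d) : R := (x *m (v j)^T) 0 0.
Let m j : R := (mu *m (v j)^T) 0 0.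
Let rho i j : R := (v i *m Sigma *m (v j)^T) 0 0.

(** The variance of [Z i - Z j] is nonnegative. The sign of [1 - rho i j] is what makes [argmax]
    monotone in [Z j]. *)
Let rho_le1 i j : rho i j <= 1.
Proof.
have [Ssym psd _] := hY.
have := psd (v i - v j); rewrite dot_trB !mulmxBl.
have addE (u w : 'M[R]_1) : (u - w) 0 0 = u 0 0 - w 0 0 by rewrite !mxE.
by rewrite !addE !v1 (quad_sym (v i) (v j))// -/(rho i j); lra.
Qed.

Let Z_law j (A : set R) : measurable A ->
  P [set w | A (Z j (rvec Y w))] = normal_prob (m j) 1 A.
Proof.
move=> mA; have [_ _ ->//] := hY.
by rewrite v1 sqrtr1 /normal_law (negbTE (oner_neq0 _)).
Qed.

(* [argmax b j x]: [j] is the first index maximizing [Z j x - b j]. *)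
Let argmax (b : 'I_n -> R) (j : 'I_n) (x : 'rV[R]_d) :=
  [forall i : 'I_n, if (i < j)%N then Z i x - Z j x < b i - b j
             else Z i x - Z j x <= b i - b j].

(* The event [argmax b j] increases with [Z j] once the part of [Z] that is
   independent of [Z j] is fixed; [frozen b j e] is its section at [Z j = e]. *)
Let frozen (b : 'I_n -> R) (j : 'I_n) (e : R) (x : 'rV[R]_d) :=
  [forall i : 'I_n, if (i < j)%N
     then (x *m (v i - rho i j *: v j)^T) 0 0 < b i - b j + (1 - rho i j) * e
     else (x *m (v i - rho i j *: v j)^T) 0 0 <= b i - b j + (1 - rho i j) * e].

Let pr (p : pred 'rV[R]_d) := fine (P [set w | p (rvec Y w)]).

(** [Z i - Z j] is the residual [Z i - rho i j * Z j] minus the term [(1 - rho i j) * Z j], which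
    increases with [Z j]. *)
Let argmax_frozen b j e x : Z j x <= e -> argmax b j x -> frozen b j e x.
Proof.
move=> Ze /forallP Jx; apply/forallP => i; have := Jx i.
have := ler_wpM2l (_ : 0 <= 1 - rho i j) Ze; rewrite subr_ge0 => /(_ (rho_le1 i j)).
by rewrite dot_trB dot_trZ -/(Z i x) -/(Z j x); case: ifP => _; lra.
Qed.

Let frozen_argmax b j e x : e <= Z j x -> frozen b j e x -> argmax b j x.
Proof.
move=> Ze /forallP Jx; apply/forallP => i; have := Jx i.
have := ler_wpM2l (_ : 0 <= 1 - rho i j) Ze; rewrite subr_ge0 => /(_ (rho_le1 i j)).
by rewrite dot_trB dot_trZ -/(Z i x) -/(Z j x); case: ifP => _; lra.
Qed.

Let exists_argmax b (x : 'rV[R]_d) (i : 'I_n) :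
  exists2 j, argmax b j x & Z i x - b i <= Z j x - b j.
Proof.
pose M j := Z j x - b j.
have [j0 _ j0max] := @arg_maxP _ _ _ i xpredT M isT.
have Pj0 : [forall k, M k <= M j0] by apply/forallP => k; exact: j0max.
have [j /forallP jmax jmin] := @arg_minnP _ j0 (fun j => [forall k, M k <= M j]) (fun j => val j)
  Pj0.
exists j; last exact: jmax.
apply/forallP => k; have := jmax k; rewrite /M => Mk.
case: ifP => kj; last by lra.
rewrite ltNge; apply/negP => Mjk.
have : (j <= k)%N by apply: jmin; apply/forallP => l; have := jmax l; rewrite /M; lra.
by rewrite leqNgt kj.
Qed.

Let argmax_uniq b (x : 'rV[R]_d) i j : argmax b i x -> argmax b j x -> i = j.
Proof.
move=> /forallP Ji /forallP Jj; apply/val_inj/eqP; rewrite eqn_leq.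
by apply/andP; split; rewrite leqNgt; apply/negP => ij;
  have := Ji j; have := Jj i; rewrite ?ij ltnNge (ltnW ij)/=; lra.
Qed.

Let argmax_closure b j : trig_closure setT (fun x => (argmax b j x)%:R).
Proof.
apply: trig_closure_forall => // i.
have E x : Z i x - Z j x = (x *m (v i - v j)^T) 0 0 by rewrite dot_trB.
case: (i < j)%N => /=.
  by under eq_fun do rewrite E; exact: trig_closure_lt.
by under eq_fun do rewrite E; exact: trig_closure_le.
Qed.

(** The normals [v i - rho i j *: v j] are those of the regression residuals on [Z j], hence
    uncorrelated with it. *)
Let frozen_closure b j e :
  trig_closure [set a : 'rV[R]_d | (v j *m Sigma *m a^T) 0 0 = 0]
    (fun x => (frozen b j e x)%:R).
Proof.
have A0 : [set a : 'rV[R]_d | (v j *m Sigma *m a^T) 0 0 = 0] 0.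
  by rewrite /= trmx0 mulmx0 mxE.
have Alin k (a c : 'rV[R]_d) : [set a : 'rV[R]_d | (v j *m Sigma *m a^T) 0 0 = 0] a ->
    [set a : 'rV[R]_d | (v j *m Sigma *m a^T) 0 0 = 0] c ->
    [set a : 'rV[R]_d | (v j *m Sigma *m a^T) 0 0 = 0] (k *: a + c).
  by rewrite /= dot_trD dot_trZ => -> ->; rewrite mulr0 addr0.
have [Ssym _ _] := hY.
have Av i : (v j *m Sigma *m (v i - rho i j *: v j)^T) 0 0 = 0.
  by rewrite dot_trB dot_trZ v1 mulr1 (quad_sym (v i) (v j))// subrr.
apply: trig_closure_forall => // i; case: (i < j)%N => /=.
  exact: trig_closure_lt.
exact: trig_closure_le.
Qed.

Let A0 j : [set k *: v j | k in setT] 0.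
Proof. by exists 0 => //; rewrite scale0r. Qed.

Let Alin j k (a c : 'rV[R]_d) : [set k *: v j | k in setT] a ->
  [set k *: v j | k in setT] c -> [set k *: v j | k in setT] (k *: a + c).
Proof.
by move=> [p _ <-] [q _ <-]; exists (k * p + q) => //; rewrite scalerDl scalerA.
Qed.

Let Av j : [set k *: v j | k in setT] (v j).
Proof. by exists 1 => //; rewrite scale1r. Qed.

Let gt_closure j (y : R) :
  trig_closure [set k *: v j | k in setT] (fun x => (y < Z j x)%R%:R).
Proof.
have Aj := @Alin j.
have -> : (fun x => (y < Z j x)%R%:R) = (fun x => 1 + -1 * (Z j x <= y)%R%:R) :> (_ -> R).
  by apply/funext => x; case: leP => _; rewrite mulN1r ?subr0 ?subrr.
apply: trig_add; first exact: trig_closure_cst.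
by apply: trig_scale; apply: trig_closure_le.
Qed.

Let oc_closure j (y e : R) :
  trig_closure [set k *: v j | k in setT] (fun x => (y < Z j x <= e)%R%:R).
Proof.
have Aj := @Alin j.
have -> : (fun x => (y < Z j x <= e)%R%:R) =
    (fun x => (y < Z j x)%R%:R * (Z j x <= e)%R%:R) :> (_ -> R).
  by apply/funext => x; rewrite -natrM mulnb.
by apply: trig_closureM => //; exact: trig_closure_le.
Qed.

Let indep_frozen b j e (p : pred 'rV[R]_d) :
  trig_closure [set k *: v j | k in setT] (fun x => (p x)%:R) ->
  pr (fun x => p x && frozen b j e x) = pr p * pr (frozen b j e).
Proof.
move=> Ap; apply: (probability_trig_closureI hY _ Ap (frozen_closure b j e)).
by move=> _ a [k _ <-] /= a0; rewrite -!scalemxAl mxE a0 mulr0.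
Qed.

Let prE (p : pred 'rV[R]_d) : trig_closure setT (fun x => (p x)%:R) ->
  pr p = \int[P]_w (p (rvec Y w))%:R.
Proof. by move=> /Rintegral_trig_closure_pred ->. Qed.

Let and_closure (p q : pred 'rV[R]_d) : trig_closure setT (fun x => (p x)%:R) ->
  trig_closure setT (fun x => (q x)%:R) -> trig_closure setT (fun x => (p x && q x)%:R).
Proof.
by move=> Tp Tq; under eq_fun do rewrite -mulnb natrM; exact: trig_closureM.
Qed.

Let le_pr (p q : pred 'rV[R]_d) : trig_closure setT (fun x => (p x)%:R) ->
  trig_closure setT (fun x => (q x)%:R) -> (forall x, p x -> q x) -> pr p <= pr q.
Proof.
move=> Tp Tq pq; rewrite !prE//; apply: le_Rintegral_trig_closure Tp Tq _.
by move=> x; rewrite ler_nat; case: (p x) (pq x) => // ->.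
Qed.

Let argmax_oc_closure b j y e :
  trig_closure setT (fun x => (argmax b j x && (y < Z j x <= e))%:R).
Proof. by apply: and_closure => //; exact: trig_closureW (oc_closure j y e). Qed.

Let argmax_gt_closure b j y :
  trig_closure setT (fun x => (argmax b j x && (y < Z j x))%:R).
Proof. by apply: and_closure => //; exact: trig_closureW (gt_closure j y). Qed.

(** Freezing at the upper end [e] of the slab enlarges the event inside the slab and, by the next
    lemma, shrinks it beyond. Slab and tail thus carry the same factor [pr (frozen b j e)], which
    cancels when they are compared. *)
Let pr_argmax_le b j y e :
  pr (fun x => argmax b j x && (y < Z j x <= e)) <=
  fine (normal_prob (m j) 1 `]y, e]) * pr (frozen b j e).
Proof.
have -> : fine (normal_prob (m j) 1 `]y, e]) = pr (fun x => y < Z j x <= e).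
  rewrite -(Z_law j (A := `]y, e]))//.
rewrite -indep_frozen//; apply: le_pr => //.
  apply: and_closure; first exact: trig_closureW (oc_closure j y e).
  exact: trig_closureW (frozen_closure b j e).
by move=> x /andP[Jx /andP[yx xe]]; rewrite yx xe/=; exact: argmax_frozen Jx.
Qed.

Let pr_argmax_ge b j e :
  fine (normal_prob (m j) 1 `]e, +oo[) * pr (frozen b j e) <=
  pr (fun x => argmax b j x && (e < Z j x)).
Proof.
have -> : fine (normal_prob (m j) 1 `]e, +oo[) = pr (fun x => e < Z j x).
  rewrite -(Z_law j (A := `]e, +oo[))//.
  by congr (fine (P _)); apply/funext => w /=; rewrite in_itv/= andbT.
rewrite -indep_frozen//; apply: le_pr => //.
  apply: and_closure; first exact: trig_closureW (gt_closure j e).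
  exact: trig_closureW (frozen_closure b j e).
by move=> x /andP[ex Jx]; rewrite ex andbT; apply: frozen_argmax Jx; exact: ltW.
Qed.

Let box b (x : 'rV[R]_d) := [forall j, Z j x <= b j].

Let box_closure b : trig_closure setT (fun x => (box b x)%:R).
Proof. by apply: trig_closure_forall => // j; exact: trig_closure_le. Qed.

(** The tie-breaking in [argmax] makes these events disjoint; this is what keeps the factor [n] out
    of the main term. *)
Let sum_argmax_gt_le1 b (y : 'I_n -> R) :
  \sum_j pr (fun x => argmax b j x && (y j < Z j x)) <= 1.
Proof.
have Ax j := argmax_gt_closure b j (y j).
under eq_bigr do rewrite prE//.
have [<- Tsum] := sum_Rintegral_trig_closure Y I Ax.
rewrite [leRHS](_ : 1 = \int[P]_w 1); last first.
  by rewrite Rintegral_cst// mul1r [X in fine X]probability_setT.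
apply: (@le_Rintegral_trig_closure _ _ _ _ _ Y setT setT _ (fun=> 1) Tsum
  (@trig_closure_cst _ _ setT I 1)) => x.
case: (pickP (fun j => argmax b j x)) => [j Jj|noJ]; last first.
  by rewrite big1// => j _; rewrite noJ.
rewrite (bigD1 j)//= big1 ?addr0; last first.
  move=> k kj; case: (boolP (argmax b k x)) => //= Jk.
  by rewrite (argmax_uniq Jk Jj) eqxx in kj.
by rewrite lern1; case: (_ && _).
Qed.

(** If some [Z i] exceeds [b i], so does the maximizing index [j], and the larger box confines [Z j]
    to a slab. *)
Let pr_box_le b e : 0 <= e ->
  pr (box (fun j => b j + e)) <=
  pr (box b) + \sum_j pr (fun x => argmax b j x && (b j < Z j x <= b j + e)).
Proof.
move=> e0; have Ax j := argmax_oc_closure b j (b j) (b j + e).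
rewrite !prE//; under eq_bigr do rewrite prE//.
have [<- Tsum] := sum_Rintegral_trig_closure Y I Ax.
rewrite -RintegralD//; [|exact: trig_closure_integrable (box_closure _)|
  exact: trig_closure_integrable Tsum].
apply: le_Rintegral_trig_closure (box_closure _) (trig_add (box_closure _) Tsum) _.
move=> x.
have sum0 : 0 <= \sum_j (argmax b j x && (b j < Z j x <= b j + e))%:R :> R.
  by apply: sumr_ge0 => j _.
case: (boolP (box (fun j => b j + e) x)) => [/forallP bx|_]; last by rewrite addr_ge0.
case: (boolP (box b x)) => [_|/forallPn[i]]; first by rewrite lerDl.
rewrite -ltNge add0r => bi; have [j Jj ij] := exists_argmax b x i.
by rewrite (bigD1 j)//= Jj bx andbT (_ : b j < Z j x) ?lerDl ?sumr_ge0//; lra.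
Qed.

(** Indices with [b j - m j <= K] are charged to the disjoint events beyond their slabs, of total
    probability at most 1; every other index costs at most [e * k], and [n * k <= 1/2]. *)
Let pr_box_step (K : R) b e : 0 <= K -> 0 < e ->
  n%:R * (normal_peak 1 * expR (- K ^+ 2 / 2)) <= 2^-1 ->
  pr (box (fun j => b j + e)) - pr (box b) <=
  e * ((K + 1 + e) * expR (K * e + e ^+ 2 / 2) + 2^-1).
Proof.
move=> K0 e0 nK; rewrite lerBlDl (le_trans (pr_box_le b (ltW e0)))// lerD2l.
set c := (K + 1 + e) * _; set k := _ * expR (- K ^+ 2 / 2) in nK *.
have c0 : 0 <= c by rewrite mulr_ge0 ?expR_ge0//; lra.
have k0 : 0 <= k by rewrite mulr_ge0 ?expR_ge0 ?normal_peak_ge0.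
have pr01 p : 0 <= pr p.
  exact: fine_ge0.
apply: (@le_trans _ _ (\sum_j (e * c * pr (fun x => argmax b j x && (b j + e < Z j x)) + e * k))).
  apply: ler_sum => j _.
  rewrite (le_trans (pr_argmax_le _ _ _ _))//.
  have [Nlow Nhigh] := normal_prob_ratio (m j) (b j) K0 e0.
  have p1 : pr (frozen b j (b j + e)) <= 1.
    rewrite prE; last exact: trig_closureW (frozen_closure _ _ _).
    rewrite [leRHS](_ : 1 = \int[P]_w 1); last first.
      by rewrite Rintegral_cst// mul1r [X in fine X]probability_setT.
    apply: (@le_Rintegral_trig_closure _ _ _ _ _ Y _ setT _ (fun=> 1)
      (frozen_closure _ _ _) (@trig_closure_cst _ _ setT I 1)) => x.
    by rewrite lern1; case: frozen.
  have [/Nlow N1|/Nhigh N1] := leP (b j - m j) K.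
    apply: (le_trans (ler_wpM2r (pr01 _) N1)); rewrite -/c -(mulrA (e * c)).
    have ec0 : 0 <= e * c by rewrite mulr_ge0// ltW.
    apply: (le_trans (ler_wpM2l ec0 (pr_argmax_ge b j (b j + e)))).
    by rewrite lerDl mulr_ge0// ltW.
  have ek0 : 0 <= e * k by rewrite mulr_ge0// ltW.
  apply: (le_trans (ler_wpM2r (pr01 _) N1)).
  apply: (@le_trans _ _ (e * k)); first by rewrite ler_piMr.
  have ec0 : 0 <= e * c by rewrite mulr_ge0// ltW.
  by rewrite lerDr (mulr_ge0 ec0)//; exact: pr01.
have ec0 : 0 <= e * c by rewrite mulr_ge0// ltW.
rewrite big_split/= -mulr_sumr sumr_const card_ord mulrDr.
apply: lerD; first by rewrite ler_piMr// sum_argmax_gt_le1.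
by rewrite -[leLHS]mulr_natl mulrCA ler_wpM2l// ltW.
Qed.

(** The factor [c e] tends to K + 1 as e tends to 0. Cutting [t] into N + 1 equal steps brings it
    below K + 3/2, and the faces above K add 1/2. *)
Lemma MVN_box_increment (K : R) b t : 0 <= K -> 0 <= t ->
  n%:R * (normal_peak 1 * expR (- K ^+ 2 / 2)) <= 2^-1 ->
  fine (P [set w | [forall j, (rvec Y w *m (v j)^T) 0 0 <= b j + t]]) -
  fine (P [set w | [forall j, (rvec Y w *m (v j)^T) 0 0 <= b j]]) <=
  t * (K + 2).
Proof.
move=> K0; rewrite le_eqVlt => /predU1P[<- _|t0 nK].
  by under [X in fine (P X)]eq_fun do under eq_forallb do rewrite addr0;
    rewrite subrr mul0r.
pose c (e : R) := (K + 1 + e) * expR (K * e + e ^+ 2 / 2).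
have cc : c e @[e --> 0] --> c 0.
  apply/differentiable_continuous/derivable1_diffP; exact: ex_derive.
have tn : t / n.+1%:R @[n --> \oo] --> 0.
  rewrite -(mulr0 t); apply: cvgM; first exact: cvg_cst.
  exact: cvg_harmonic.
have c0 : c 0 < K + 2^-1 + 1.
  by rewrite /c expr0n/= mulr0 mul0r !addr0 expR0; lra.
have [N cN] : exists N, c (t / N.+1%:R) < K + 2^-1 + 1.
  have /cvgr_lt /(_ _ c0) := cvg_comp _ _ tn cc.
  by case=> N _ /(_ N (leqnn N)) cN; exists N.
set e := t / N.+1%:R in cN; have e0 : 0 < e by rewrite divr_gt0.
have step k : pr (box (fun j => b j + k.+1%:R * e)) -
    pr (box (fun j => b j + k%:R * e)) <= e * (K + 2).
  have -> : (fun j => b j + k.+1%:R * e) = (fun j => b j + k%:R * e + e).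
    by apply/funext => j; rewrite -natr1; ring.
  apply: (le_trans (pr_box_step _ K0 e0 nK)); rewrite ler_wpM2l ?(ltW e0)//.
  by move: cN; rewrite /c; lra.
have := ler_sum (index_iota 0 N.+1) (P := xpredT) (fun k _ => step k).
have Ne : N.+1%:R * e = t by rewrite /e mulrC divfK.
rewrite telescope_sumr// sumr_const_nat subn0 -[leRHS]mulr_natl [leRHS]mulrA Ne.
by rewrite mul0r; under [X in _ - pr (box X)]eq_fun do rewrite addr0.
Qed.

End nazarov.

Lemma measurable_box (R : realType) (d : nat) (disp : measure_display)
    (T : measurableType disp) (P : probability T R) (X : 'I_d -> {RV P >-> R})
    (c : 'I_d -> R) :
  measurable [set w | forall j, rvec X w 0 j <= c j].
Proof.
have -> : [set w | forall j, rvec X w 0 j <= c j] =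
    \bigcap_(j in [set: 'I_d]) (X j @^-1` `]-oo, c j]).
  apply/seteqP; split => w /= H j; last by have := H j Logic.I; rewrite /= in_itv/= mxE.
  by move=> _; rewrite /= in_itv/=; have := H j; rewrite mxE.
apply: fin_bigcap_measurable => // j _.
by rewrite -[X in measurable X]setTI; apply: measurable_funP.
Qed.

Lemma le_fine_probability (R : realType) (disp : measure_display)
    (T : measurableType disp) (P : probability T R) (A B : set T) :
  measurable A -> measurable B -> A `<=` B -> fine (P A) <= fine (P B).
Proof.
move=> mA mB AB; apply: fine_le; [exact: fin_num_measure|exact: fin_num_measure|].
by apply: le_measure => //; rewrite inE.
Qed.

Lemma min_sd_le (R : realType) (d : nat) (Sigma : 'M[R]_d) (j : 'I_d) :
  min_sd Sigma <= Num.sqrt (Sigma j j).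
Proof.
by apply: ge_inf; [exists 0 => _ [i _ <-]; exact: sqrtr_ge0|exists j].
Qed.

Lemma min_sd_gt0 (R : realType) (d : nat) (Sigma : 'M[R]_d) : (0 < d)%N ->
  (forall j, 0 < Sigma j j) -> 0 < min_sd Sigma.
Proof.
case: d Sigma => // d Sigma _ S0.
have [j0 _ jmin] := @arg_minP _ _ _ ord0 xpredT (fun j => Num.sqrt (Sigma j j)) isT.
apply: (@lt_le_trans _ _ (Num.sqrt (Sigma j0 j0))); first by rewrite sqrtr_gt0.
apply: lb_le_inf; first by exists (Num.sqrt (Sigma ord0 ord0)), ord0.
by move=> _ [j _ <-]; exact: jmin.
Qed.

(** Each coordinate is divided by its standard deviation [s j]. The shift [t] becomes [t / s j],
    which is enlarged to the common value [t / sg]. *)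
Lemma nazarov_inequality (R : realType) (d : nat) (disp : measure_display)
    (T : measurableType disp) (P : probability T R) (Y : 'I_d -> {RV P >-> R})
    (mu : 'rV[R]_d) (Sigma : 'M[R]_d) (z : 'I_d -> R) (t : R) :
  (0 < d)%N -> is_MVN Y mu Sigma -> (forall j, 0 < Sigma j j) -> 0 <= t ->
  fine (P [set w | forall j, rvec Y w 0 j <= z j + t]) -
  fine (P [set w | forall j, rvec Y w 0 j <= z j]) <=
  t * ((Num.sqrt (2 * ln d%:R) + 2) / min_sd Sigma).
Proof.
move=> d0 hY S0 t0; set K := Num.sqrt _.
have sg0 := min_sd_gt0 d0 S0; set sg := min_sd Sigma in sg0 *.
pose s j := Num.sqrt (Sigma j j).
have s0 j : 0 < s j by rewrite sqrtr_gt0.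
pose v j : 'rV[R]_d := (s j)^-1 *: delta_mx 0 j.
have vE (x : 'rV[R]_d) j : (x *m (v j)^T) 0 0 = x 0 j / s j.
  rewrite dot_trZ trmx_delta mulrC; congr (_ / _).
  by rewrite -colE mxE.
have v1 j : (v j *m Sigma *m (v j)^T) 0 0 = 1.
  rewrite vE -scalemxAl mxE -rowE mxE mulrAC -invfM -expr2 sqr_sqrtr ?mulVf ?gt_eqF// ltW//.
have boxE c : [set w | [forall j, (rvec Y w *m (v j)^T) 0 0 <= c j]] =
    [set w | forall j, rvec Y w 0 j <= c j * s j].
  apply/seteqP; split => w /= H; last first.
    by apply/forallP => j; rewrite vE ler_pdivrMr.
  by move=> j; have /forallP/(_ j) := H; rewrite vE ler_pdivrMr.
have K0 : 0 <= K by exact: sqrtr_ge0.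
have dR : 1 <= d%:R :> R by rewrite ler1n.
(* [K] is chosen so that exp(- K^2 / 2) = 1 / d. *)
have nK : d%:R * (normal_peak 1 * expR (- K ^+ 2 / 2)) <= 2^-1.
  rewrite sqr_sqrtr; last by rewrite mulr_ge0// ln_ge0.
  rewrite (_ : - _ / 2 = - ln d%:R); last by field.
  rewrite expRN lnK ?posrE ?(lt_le_trans _ dR)//.
  by rewrite mulrCA divff ?mulr1 ?normal_peak1_le// gt_eqF// (lt_le_trans _ dR).
have ts0 : 0 <= t / sg by rewrite divr_ge0// ltW.
have := MVN_box_increment hY v1 (fun j => z j / s j) K0 ts0 nK.
rewrite (_ : t / sg * (K + 2) = t * ((K + 2) / sg)); last by ring.
apply: le_trans; apply: lerB.
- rewrite boxE; apply: le_fine_probability; [exact: measurable_box|exact: measurable_box|].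
  move=> w /= H j; apply: le_trans (H j) _.
  rewrite mulrDl divfK ?gt_eqF// lerD2l mulrAC ler_pdivlMr// ler_wpM2l//.
  exact: min_sd_le.
- rewrite boxE; apply: le_fine_probability; [exact: measurable_box|exact: measurable_box|].
  by move=> w /= H j; have := H j; rewrite divfK// gt_eqF.
Qed.

(** * Averages and difference quotients *)

Lemma is_derive_quadratic (R : realType) (f : R -> R) (df C : R) :
  (forall h, `|f h - f 0 - h * df| <= C * h ^+ 2) -> is_derive 0 (1 : R) f df.
Proof.
move=> fC.
have C0 : 0 <= C by have := fC 1; rewrite expr1n mulr1; apply: le_trans.
have C1 : 0 < C + 1 by lra.
have c : h^-1 *: ((f \o shift 0) (h *: (1 : R)) - f 0) @[h --> (0 : R)^'] --> df.
  apply/cvgrPdist_le => eps eps0; near=> h.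
  have h0 : h != 0 by near: h; exact: nbhs_dnbhs_neq.
  rewrite /= addr0 [h *: 1]mulr1 distrC.
  have -> : h^-1 *: (f h - f 0) - df = h^-1 * (f h - f 0 - h * df).
    by rewrite /GRing.scale/= [RHS]mulrBr mulKf.
  rewrite normrM normfV ler_pdivrMl ?normr_gt0// (le_trans (fC h))//.
  rewrite -real_normK ?num_real// expr2 mulrCA ler_wpM2l//.
  apply: (@le_trans _ _ ((C + 1) * `|h|)); first by rewrite ler_wpM2r// lerDl.
  rewrite -ler_pdivlMl//; near: h; apply: dnbhs0_le.
  by rewrite mulr_gt0 ?invr_gt0.
apply: DeriveDef; first by apply/cvg_ex; exists df.
exact: cvg_lim c.
Unshelve. all: by end_near. Qed.

Section averages.
Context {R : realType} {d : nat}.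
Implicit Types (g : 'rV[R]_d -> R) (x y : 'rV[R]_d) (b t : R) (i l : 'I_d).

(** Averages and difference quotients move along the axes only, and both preserve this property. Its
    constant only secures continuity and integrability; the quantitative bounds are tracked
    separately. *)
Definition coord_lipschitz (L : R) g :=
  forall i x t, `|g (x + t *: delta_mx 0 i) - g x| <= L * `|t|.

(* Averages replace indicators of orthants by differentiable functions; the
   derivative of an average is a difference quotient. *)
Definition average b i g x : R :=
  b^-1 * \int[lebesgue_measure]_(u in `[0, b]) g (x - u *: delta_mx 0 i).

Definition diffquot b i g x : R := (g x - g (x - b *: delta_mx 0 i)) / b.

Lemma is_derive_line (g : 'rV[R]_d -> R) (x v : 'rV[R]_d) (t dg : R) :
  is_derive (x + t *: v) v g dg <->
  is_derive t (1 : R) (fun s : R => g (x + s *: v)) dg.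
Proof.
have E : (fun h : R => h^-1 *: (((fun s : R => g (x + s *: v)) \o shift t) (h *: 1) -
      g (x + t *: v))) =
    (fun h : R => h^-1 *: ((g \o shift (x + t *: v)) (h *: v) - g (x + t *: v))).
  apply/funext => h /=; congr (_ *: (g _ - _)).
  have -> : h *: (1 : R) = h by rewrite /GRing.scale/= mulr1.
  by rewrite scalerDl addrCA.
split=> -[H1 H2].
  apply: DeriveDef; first by rewrite /derivable E.
  by rewrite -H2 /derive E.
apply: DeriveDef; first by rewrite /derivable -E.
by rewrite -H2 /derive E.
Qed.

Lemma coord_lipschitz_continuous L g x i :
  coord_lipschitz L g -> continuous (fun u : R => g (x + u *: delta_mx 0 i)).
Proof.
move=> gL u; apply/cvgrPdist_le => eps eps0.
have L1 : 0 < `|L| + 1 by rewrite ltr_wpDl.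
near=> v.
have -> : x + u *: delta_mx 0 i = (x + v *: delta_mx 0 i) + (u - v) *: delta_mx 0 i.
  by rewrite -addrA -scalerDl addrCA subrr addr0.
apply: (le_trans (gL _ _ _)).
apply: (@le_trans _ _ ((`|L| + 1) * `|u - v|)).
  by rewrite ler_wpM2r// (le_trans (ler_norm _))// lerDl.
rewrite -ler_pdivlMl//.
near: v; apply: cvgr_dist_le; first exact: cvg_id.
by rewrite mulr_gt0 ?invr_gt0.
Unshelve. all: by end_near. Qed.

Lemma coord_lipschitz_continuousN L g x i :
  coord_lipschitz L g -> continuous (fun u : R => g (x - u *: delta_mx 0 i)).
Proof.
move=> gL u; under eq_fun do rewrite -scaleNr.
have := @coord_lipschitz_continuous _ _ x i gL (- u).
move=> H.
apply: (@continuous_comp _ _ _ (fun u : R => - u) (fun u : R => g (x + u *: delta_mx 0 i)) u).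
  exact: opp_continuous.
exact: H.
Qed.

Lemma coord_lipschitz_integrable L g x i b :
  coord_lipschitz L g ->
  lebesgue_measure.-integrable `[0, b] (EFin \o (fun u => g (x - u *: delta_mx 0 i))).
Proof.
move=> gL; apply: continuous_compact_integrable; first exact: segment_compact.
by apply: continuous_subspaceT; exact: coord_lipschitz_continuousN gL.
Qed.

Lemma average_le L L' g g' x y i b (M : R) : 0 < b ->
  coord_lipschitz L g -> coord_lipschitz L' g' ->
  (forall u, 0 <= u <= b ->
    g (x - u *: delta_mx 0 i) <= g' (y - u *: delta_mx 0 i) + M) ->
  average b i g x <= average b i g' y + M.
Proof.
move=> b0 gL gL' gg'.
have ig := coord_lipschitz_integrable x i b gL.
have ig' := coord_lipschitz_integrable y i b gL'.
have iM : lebesgue_measure.-integrable `[0, b] (EFin \o (fun=> M)).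
  apply: continuous_compact_integrable; first exact: segment_compact.
  by apply: continuous_subspaceT => ?; exact: cvg_cst.
have -> : average b i g' y + M = b^-1 *
    \int[lebesgue_measure]_(u in `[0, b]) (g' (y - u *: delta_mx 0 i) + M).
  rewrite (RintegralD _ ig' iM)// mulrDr; congr (_ + _).
  rewrite Rintegral_cst//= lebesgue_measure_itv/= lte_fin b0/= subr0.
  by rewrite mulrC mulfK// gt_eqF.
rewrite ler_wpM2l ?invr_ge0 ?(ltW b0)//; apply: le_Rintegral => //.
by apply: (integrableD _ ig' iM).
Qed.

Lemma average_between L g x i b (lo hi : R) : 0 < b -> coord_lipschitz L g ->
  (forall u, 0 <= u <= b -> lo <= g (x - u *: delta_mx 0 i) <= hi) ->
  lo <= average b i g x <= hi.
Proof.
move=> b0 gL glh.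
have cL : coord_lipschitz 0 (fun=> 0) by move=> *; rewrite subrr normr0 mul0r.
have a0 : average b i (fun=> 0) x = 0.
  by rewrite /average Rintegral_cst// mul0r mulr0.
apply/andP; split; last first.
  rewrite -[hi]add0r -a0; apply: (average_le b0 gL cL) => u /glh.
  by rewrite add0r => /andP[].
rewrite -subr_ge0 -a0; apply: (average_le b0 cL gL) => u /glh.
by rewrite subr_ge0 => /andP[].
Qed.

Lemma average_modulus L g (Lam : 'rV[R]_d -> R) b i : 0 < b ->
  coord_lipschitz L g -> (forall x y, `|g x - g y| <= Lam (x - y)) ->
  forall x y, `|average b i g x - average b i g y| <= Lam (x - y).
Proof.
move=> b0 gL gLam x y.
have xyE (p q r : 'rV[R]_d) : (p - r) - (q - r) = p - q.
  by rewrite opprB addrA subrK.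
rewrite ler_distl lerBlDr; apply/andP; split.
  apply: (average_le b0 gL gL) => u _.
  rewrite -lerBlDl (le_trans (ler_norm _))// distrC.
  by rewrite (le_trans (gLam _ _))// xyE.
apply: (average_le b0 gL gL) => u _.
by rewrite -lerBlDl (le_trans (ler_norm _))// (le_trans (gLam _ _))// xyE.
Qed.

Lemma average_coord_lipschitz L g b i : 0 < b ->
  coord_lipschitz L g -> coord_lipschitz L (average b i g).
Proof.
move=> b0 gL l x t.
rewrite ler_distl lerBlDr; apply/andP; split.
  apply: (average_le b0 gL gL) => u _.
  by rewrite -lerBlDl (le_trans (ler_norm _))// distrC addrAC gL.
apply: (average_le b0 gL gL) => u _.
by rewrite -lerBlDl (le_trans (ler_norm _))// addrAC gL.
Qed.

Lemma diffquot_coord_lipschitz L g b i : 0 < b ->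
  coord_lipschitz L g -> coord_lipschitz (2 * L / b) (diffquot b i g).
Proof.
move=> b0 gL l x t; rewrite /diffquot -mulrBl normrM [`|b^-1|]gtr0_norm ?invr_gt0//.
rewrite mulrAC ler_wpM2r ?invr_ge0 ?(ltW b0)//.
rewrite (_ : _ - _ - _ = (g (x + t *: delta_mx 0 l) - g x) -
  (g (x - b *: delta_mx 0 i + t *: delta_mx 0 l) - g (x - b *: delta_mx 0 i))); last first.
  by rewrite (addrAC x); ring.
rewrite (le_trans (ler_normB _ _))//.
by rewrite -mulrA mulr_natl mulr2n lerD.
Qed.

Lemma diffquotC g b i c l x :
  diffquot b i (diffquot c l g) x = diffquot c l (diffquot b i g) x.
Proof.
rewrite /diffquot -!mulrBl -!mulrA [b^-1 * _]mulrC; congr (_ * _).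
by rewrite (addrAC x); ring.
Qed.

Lemma diffquot_average L g b i c l x : 0 < b -> coord_lipschitz L g ->
  diffquot c l (average b i g) x = average b i (diffquot c l g) x.
Proof.
move=> b0 gL; rewrite /diffquot /average -mulrBr -mulrA; congr (_ * _).
have i1 := coord_lipschitz_integrable x i b gL.
have i2 := coord_lipschitz_integrable (x - c *: delta_mx 0 l) i b gL.
rewrite -(RintegralB _ i1 i2)//.
rewrite mulrC -RintegralZl//; last by apply: (integrableB _ i1 i2).
by apply: eq_Rintegral => u _; rewrite mulrC addrAC.
Qed.

(** Along direction [i] the average is [b^-1] times the integral of [G] over [[h - b, h]], whose
    derivative is the difference of [G] at the endpoints. *)
Lemma is_derive_average L g b i x : 0 < b -> coord_lipschitz L g ->
  is_derive x (delta_mx 0 i) (average b i g) (diffquot b i g x).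
Proof.
move=> b0 gL.
pose G (t : R) := g (x + t *: delta_mx 0 i).
have cG : continuous G by exact: coord_lipschitz_continuous gL.
(* The lower limit [- b - 2] lies below every [h - u] with [|h| < 1] and [-1 < u < b + 1], a margin
   that gives two-sided derivatives at the ends of [[0, b]]. *)
pose Gam (t : R) := \int[lebesgue_measure]_(u in `[- b - 2, t]) G u.
have dGam t : - b - 2 < t -> is_derive t (1 : R) Gam (G t).
  move=> bt.
  have iG : lebesgue_measure.-integrable `[- b - 2, t + 1] (EFin \o G).
    apply: continuous_compact_integrable; first exact: segment_compact.
    exact: continuous_subspaceT.
  have tt : t < t + 1 by rewrite ltrDl.
  have [] := @continuous_FTC1_closed _ G (- b - 2) t (t + 1) tt iG bt (cG t).
  by move=> H1 H2; apply: DeriveDef => //; rewrite -derive1E.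
have avE h : `|h| < 1 ->
    average b i g (x + h *: delta_mx 0 i) = b^-1 * (Gam h - Gam (h - b)).
  move=> h1; congr (_ * _).
  have dF u : - 1 < u < b + 1 -> is_derive u (1 : R) (fun u => - Gam (h - u)) (G (h - u)).
    move=> ub.
    have := dGam (h - u); move: h1; rewrite ltr_norml => h1.
    have hb : - b - 2 < h - u by lra.
    move=> /(_ hb) H.
    have H2 : is_derive u (1 : R) (fun u : R => h - u) (-1).
      by apply: is_derive_eq; ring.
    have H3 := is_derive1_comp (f := Gam) (g := fun u : R => h - u) H H2.
    have := is_deriveN H3; rewrite mulrN1 opprK. exact.
  have cF u : - 1 < u < b + 1 -> {for u, continuous (fun u => - Gam (h - u))}.
    by move=> /dF[? _]; apply/differentiable_continuous/derivable1_diffP.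
  rewrite /Rintegral (_ : (\int[lebesgue_measure]_(u in `[0%R, b]) _ =
    (- Gam (h - b))%:E - (- Gam (h - 0)%R)%:E)%E); last first.
    rewrite -(@continuous_FTC2 _ (fun u => G (h - u)) (fun u => - Gam (h - u)))//.
    - apply: eq_integral => u _. by rewrite /G scalerBl addrA.
    - apply: continuous_subspaceT => u.
      apply: (@continuous_comp _ _ _ (fun u : R => h - u) G u); last exact: cG.
      by apply: cvgB; [exact: cvg_cst|exact: cvg_id].
    - split.
      + move=> u; rewrite in_itv/= => /andP[u0 ub]; have [|//] := dF u.
        by apply/andP; split; lra.
      + by apply: cvg_at_right_filter; apply: (cF 0); apply/andP; split; lra.
      + by apply: cvg_at_left_filter; apply: (cF b); apply/andP; split; lra.
    - move=> u; rewrite in_itv/= => /andP[u0 ub]; rewrite derive1E.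
      have ub' : -1 < u < b + 1 by apply/andP; split; lra.
      by have /@derive_val := dF u ub'.
  by rewrite subr0 /= opprK addrC.
have := @is_derive_line (average b i g) x (delta_mx 0 i) 0 (diffquot b i g x).
rewrite scale0r addr0 => ->.
have : is_derive (0 : R) (1 : R) (fun h : R => b^-1 * (Gam h - Gam (h - b))) (diffquot b i g x).
  have H1 : is_derive 0 (1 : R) Gam (G 0) by apply: dGam; lra.
  have H2 : is_derive (0 - b) (1 : R) Gam (G (0 - b)) by apply: dGam; lra.
  have H3 : is_derive 0 (1 : R) (fun u : R => u - b) 1.
    by apply: is_derive_eq; ring.
  have H4 := is_derive1_comp (f := Gam) (g := fun u : R => u - b) H2 H3.
  apply: is_derive_eq; rewrite mulr1 sub0r /G scale0r addr0 scaleNr.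
  by rewrite /GRing.scale/= mulrC.
apply: near_eq_is_derive.
by near=> h; rewrite avE//; near: h.
Unshelve. all: by end_near. Qed.

(** As [g'] is Lipschitz along the axes, the first-order remainder of [g] is at most [|L'| h^2]
    uniformly in the point, and a uniform bound survives averaging. *)
Lemma is_derive_under_average L L' g g' b i l x : 0 < b ->
  coord_lipschitz L g -> coord_lipschitz L' g' ->
  (forall y, is_derive y (delta_mx 0 l) g (g' y)) ->
  is_derive x (delta_mx 0 l) (average b i g) (average b i g' x).
Proof.
move=> b0 gL gL' gg'.
have mvt y (h : R) : `|g (y + h *: delta_mx 0 l) - g y - h * g' y| <= `|L'| * h ^+ 2.
  have dline t : is_derive t (1 : R) (fun s : R => g (y + s *: delta_mx 0 l))
      (g' (y + t *: delta_mx 0 l)) by apply/is_derive_line.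
  have cline : continuous (fun s : R => g (y + s *: delta_mx 0 l)).
    exact: coord_lipschitz_continuous gL.
  have bnd c : `|c| <= `|h| ->
      `|g' (y + c *: delta_mx 0 l) * h - h * g' y| <= `|L'| * h ^+ 2.
    move=> ch; rewrite [h * _]mulrC -mulrBl normrM -real_normK ?num_real//.
    rewrite expr2 mulrA ler_wpM2r// (le_trans (gL' _ _ _))//.
    by rewrite (le_trans (ler_wpM2r _ (ler_norm L')))// ler_wpM2l.
  have [h0|h0|->] := ltgtP h 0; last first.
  - by rewrite scale0r addr0 subrr mul0r subrr normr0 expr0n mulr0.
  - have [c ch E] := @MVT_segment _ _ _ 0 h (ltW h0) (fun t _ => dline t)
      (continuous_subspaceT cline).
    rewrite scale0r addr0 subr0 in E; rewrite E; apply: bnd.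
    by move: ch; rewrite in_itv/= => /andP[c0 ch]; rewrite !ger0_norm// ltW.
  - have [c ch E] := @MVT_segment _ _ _ h 0 (ltW h0) (fun t _ => dline t)
      (continuous_subspaceT cline).
    rewrite scale0r addr0 sub0r in E.
    rewrite -[g (y + _) - g y]opprB E mulrN opprK; apply: bnd.
    move: ch; rewrite in_itv/= => /andP[c0 ch]; rewrite ler0_norm// ltr0_norm//.
    by rewrite lerN2.
have quot (h : R) : `|average b i g (x + h *: delta_mx 0 l) - average b i g x -
    h * average b i g' x| <= `|L'| * h ^+ 2.
  have ig := coord_lipschitz_integrable x i b gL.
  have ig' := coord_lipschitz_integrable x i b gL'.
  have igh := coord_lipschitz_integrable (x + h *: delta_mx 0 l) i b gL.
  have C0 : 0 <= `|L'| * h ^+ 2 by rewrite mulr_ge0 ?sqr_ge0.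
  have -> : average b i g (x + h *: delta_mx 0 l) - average b i g x -
      h * average b i g' x =
      b^-1 * \int[lebesgue_measure]_(u in `[0, b])
       (g (x + h *: delta_mx 0 l - u *: delta_mx 0 i) -
        g (x - u *: delta_mx 0 i) - h * g' (x - u *: delta_mx 0 i)).
    have ihg' : lebesgue_measure.-integrable `[0, b]
        (EFin \o (fun u => h * g' (x - u *: delta_mx 0 i))).
      by apply: eq_integrable (integrableZl _ h ig').
    have igg : lebesgue_measure.-integrable `[0, b] (EFin \o (fun u =>
        g (x + h *: delta_mx 0 l - u *: delta_mx 0 i) - g (x - u *: delta_mx 0 i))).
      by apply: eq_integrable (integrableB _ igh ig).
    rewrite RintegralB// RintegralB// RintegralZl// /average !mulrBr.
    by rewrite [in RHS]mulrCA.
  have iF : lebesgue_measure.-integrable `[0, b] (EFin \o (fun u =>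
      g (x + h *: delta_mx 0 l - u *: delta_mx 0 i) -
      g (x - u *: delta_mx 0 i) - h * g' (x - u *: delta_mx 0 i))).
    by apply: eq_integrable (integrableB _ (integrableB _ igh ig) (integrableZl _ h ig')).
  rewrite normrM gtr0_norm ?invr_gt0// ler_pdivrMl// (le_trans (le_normr_Rintegral _ iF))//.
  apply: (@le_trans _ _ (\int[lebesgue_measure]_(u in `[0, b]) (`|L'| * h ^+ 2))).
    apply: le_Rintegral => //.
    - by apply: eq_integrable (integrable_abse iF).
    - apply: continuous_compact_integrable; first exact: segment_compact.
      by apply: continuous_subspaceT => ?; exact: cvg_cst.
    - by move=> u _; rewrite (addrAC x) mvt.
  rewrite Rintegral_cst//= lebesgue_measure_itv/= lte_fin b0/= subr0.
  by rewrite mulrC.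
have := @is_derive_line (average b i g) x (delta_mx 0 l) 0 (average b i g' x).
rewrite scale0r addr0 => ->; apply: is_derive_quadratic => h.
by rewrite scale0r addr0; exact: quot.
Qed.

End averages.

(** * Iterated averages and their partial derivatives *)

Section smoothing.
Context {R : realType} {d : nat} (bw : nat -> R).
Hypothesis bw_gt0 : forall t, 0 < bw t.
Implicit Types (g : 'rV[R]_d -> R) (s : seq 'I_d) (W : seq (nat * 'I_d)).

Definition iter_average W g : 'rV[R]_d -> R :=
  foldr (fun p f => average (bw p.1) p.2 f) g W.

(** The list is read from its end, as in [partial]. A new quotient in direction [i] takes the first
    width not yet used in that direction. *)
Fixpoint iter_diffquot s g : 'rV[R]_d -> R :=
  if s is i :: s' then diffquot (bw (count_mem i s')) i (iter_diffquot s' g)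
  else g.

(* The averages of an [n]-fold smoothing that remain once the partial
   derivative [s] has turned the others into difference quotients. *)
Definition remaining n s : seq (nat * 'I_d) :=
  [seq p <- [seq (t, i) | t <- iota 0 n, i <- enum 'I_d] |
    (count_mem p.2 s <= p.1)%N].

Lemma iter_average_coord_lipschitz W L g :
  coord_lipschitz L g -> coord_lipschitz L (iter_average W g).
Proof.
by move=> gL; elim: W => //= p W IH; exact: average_coord_lipschitz.
Qed.

Lemma iter_average_modulus W L g (Lam : 'rV[R]_d -> R) :
  coord_lipschitz L g -> (forall x y, `|g x - g y| <= Lam (x - y)) ->
  forall x y, `|iter_average W g x - iter_average W g y| <= Lam (x - y).
Proof.
move=> gL gLam; elim: W => //= p W IH.
exact: average_modulus (iter_average_coord_lipschitz W gL) IH.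
Qed.

Lemma iter_average_between W L g (lo hi : R) : coord_lipschitz L g ->
  (forall x, lo <= g x <= hi) -> forall x, lo <= iter_average W g x <= hi.
Proof.
move=> gL glh; elim: W => //= p W IH x.
by apply: (average_between _ (iter_average_coord_lipschitz W gL)) => // u _.
Qed.

Lemma iter_diffquot_coord_lipschitz s L g :
  coord_lipschitz L g -> exists L', coord_lipschitz L' (iter_diffquot s g).
Proof.
move=> gL; elim: s => [|i s [L' IH]] /=; first by exists L.
by eexists; exact: (diffquot_coord_lipschitz i (bw_gt0 _) IH).
Qed.

Lemma diffquot_iter_average W L g c i : coord_lipschitz L g ->
  diffquot c i (iter_average W g) = iter_average W (diffquot c i g).
Proof.
move=> gL; elim: W => //= p W <-; apply/funext => x.
by rewrite (diffquot_average _ _ _ _ _ (iter_average_coord_lipschitz W gL)).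
Qed.

Lemma is_derive_iter_average W1 W2 L g t i x : coord_lipschitz L g ->
  is_derive x (delta_mx 0 i) (iter_average (W1 ++ (t, i) :: W2) g)
    (iter_average (W1 ++ W2) (diffquot (bw t) i g) x).
Proof.
move=> gL; elim: W1 x => [|p W1 IH] x /=.
  rewrite -(diffquot_iter_average _ _ _ gL).
  by apply: (is_derive_average _ _ _ (iter_average_coord_lipschitz W2 gL)).
apply: (is_derive_under_average _ _ _ _ _ IH) => //.
  exact: (iter_average_coord_lipschitz _ gL).
exact: (iter_average_coord_lipschitz _ (diffquot_coord_lipschitz i (bw_gt0 t) gL)).
Qed.

Lemma remaining_uniq n s : uniq (remaining n s).
Proof.
apply: filter_uniq; apply: allpairs_uniq; [exact: iota_uniq|exact: enum_uniq|].
by move=> [? ?] [? ?].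
Qed.

Lemma mem_remaining n s t i :
  ((t, i) \in remaining n s) = (t < n)%N && (count_mem i s <= t)%N.
Proof.
rewrite mem_filter /= andbC; congr (_ && _).
apply/allpairsP/idP => [[[t' i'] /= [t'n _ [-> _]]]|tn].
  by move: t'n; rewrite mem_iota add0n.
by exists (t, i); rewrite /= mem_iota mem_enum.
Qed.

(** One more derivative in direction [i] consumes the average of least index left in that direction,
    which may stand anywhere in the list. *)
Lemma remaining_cons n s i : (count_mem i s < n)%N ->
  exists W1 W2, remaining n s = W1 ++ (count_mem i s, i) :: W2 /\
    remaining n (i :: s) = W1 ++ W2.
Proof.
move=> cn; have /splitPr Hs : (count_mem i s, i) \in remaining n s.
  by rewrite mem_remaining cn leqnn.
have u := remaining_uniq n s.
have E : remaining n (i :: s) = [seq p <- remaining n s | p != (count_mem i s, i)].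
  rewrite /remaining -filter_predI; apply: eq_filter => -[t l] /=.
  rewrite xpair_eqE; case: (eqVneq i l) => [<-|il]; last first.
    by rewrite add0n andbF.
  by rewrite andbT add1n ltn_neqAle eq_sym.
case: Hs u E => W1 W2 u E; exists W1, W2; split => //.
rewrite E filter_cat /= eqxx /=.
move: u; rewrite uniq_catC /= mem_cat negb_or => /andP[/andP[n2 n1] _].
have F W : (count_mem i s, i) \notin W -> [seq p <- W | p != (count_mem i s, i)] = W.
  move=> nW; apply/all_filterP/allP => p pW; apply: contraNneq nW => <-.
  exact: pW.
by rewrite !F.
Qed.

Lemma is_derive_smoothing n s L g i x : (size s < n)%N -> coord_lipschitz L g ->
  is_derive x (delta_mx 0 i)
    (iter_average (remaining n s) (iter_diffquot s g))
    (iter_average (remaining n (i :: s)) (iter_diffquot (i :: s) g) x).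
Proof.
move=> sn gL; have [L' sL] := iter_diffquot_coord_lipschitz s gL.
have [|W1 [W2 [-> ->]]] := @remaining_cons n s i.
  by rewrite (leq_ltn_trans _ sn)// count_size.
exact: is_derive_iter_average sL.
Qed.

Lemma partial_smoothing n s L g : (size s <= n)%N -> coord_lipschitz L g ->
  partial (iter_average (remaining n [::]) g) s =
  iter_average (remaining n s) (iter_diffquot s g).
Proof.
move=> sn gL; elim: s sn => //= i s IH sn; rewrite IH ?(ltnW sn)//.
apply/funext => x; have := is_derive_smoothing i x sn gL.
by move=> /@derive_val.
Qed.

Lemma has_partials_smoothing n L g : coord_lipschitz L g ->
  has_partials n (iter_average (remaining n [::]) g).
Proof.
move=> gL s i x sn; rewrite (partial_smoothing (ltnW sn) gL).
by case: (is_derive_smoothing i x sn gL).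
Qed.

End smoothing.

(** * The ramp and its difference quotients *)

Section enorm_theory.
Context {R : realType} {d : nat}.
Implicit Types (x y : 'rV[R]_d) (i : 'I_d).

Definition enorm_but i x : R := Num.sqrt (\sum_(l | l != i) x 0 l ^+ 2).

Lemma enorm_ge0 x : 0 <= enorm x.
Proof. exact: sqrtr_ge0. Qed.

Lemma enorm_sqr x : enorm x ^+ 2 = \sum_l x 0 l ^+ 2.
Proof. by rewrite sqr_sqrtr// sumr_ge0// => l _; rewrite sqr_ge0. Qed.

Lemma enorm_but_sqr i x : x 0 i ^+ 2 + enorm_but i x ^+ 2 = enorm x ^+ 2.
Proof.
rewrite enorm_sqr [RHS](bigD1 i)//= sqr_sqrtr// sumr_ge0// => l _.
by rewrite sqr_ge0.
Qed.

Lemma coord_le_enorm x l : `|x 0 l| <= enorm x.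
Proof.
rewrite -(@ler_pXn2r _ 2)// ?nnegrE ?enorm_ge0// real_normK ?num_real//.
by rewrite -(enorm_but_sqr l) lerDl sqr_ge0.
Qed.

Lemma coord_le_enorm_but i x l : l != i -> `|x 0 l| <= enorm_but i x.
Proof.
move=> li; rewrite -(@ler_pXn2r _ 2)// ?nnegrE ?sqrtr_ge0// real_normK ?num_real//.
rewrite sqr_sqrtr; last by rewrite sumr_ge0// => k _; rewrite sqr_ge0.
rewrite (bigD1 l)//= lerDl sumr_ge0// => k _; exact: sqr_ge0.
Qed.

Lemma enorm_delta (t : R) i : enorm (t *: delta_mx 0 i) = `|t|.
Proof.
rewrite /enorm (bigD1 i)//= big1 ?addr0; last first.
  by move=> l li; rewrite !mxE (negbTE li) andbF mulr0 expr0n.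
by rewrite !mxE !eqxx mulr1 sqrtr_sqr.
Qed.

(** The Cauchy-Schwarz inequality with the vector (2, 1), of norm [sqrt 5]. *)
Lemma weighted_enorm_le (x : 'rV[R]_d) i :
  2 * `|x 0 i| + enorm_but i x <= Num.sqrt 5 * enorm x.
Proof.
have p0 := normr_ge0 (x 0 i); have r0 : 0 <= enorm_but i x by exact: sqrtr_ge0.
rewrite -(@ler_pXn2r _ 2)// ?nnegrE ?addr_ge0 ?mulr_ge0 ?enorm_ge0//.
rewrite exprMn sqr_sqrtr// -(enorm_but_sqr i) -[x 0 i ^+ 2]real_normK ?num_real//.
by have := sqr_ge0 (`|x 0 i| - 2 * enorm_but i x); nra.
Qed.

(** The differences of [x] and [y] to their coordinatewise minimum have disjoint supports, so their
    squared norms add up to that of [x - y]. *)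
Lemma enorm_min_le x y :
  enorm (x - \row_l Num.min (x 0 l) (y 0 l)) +
  enorm (y - \row_l Num.min (x 0 l) (y 0 l)) <= Num.sqrt 2 * enorm (x - y).
Proof.
set w := \row_l _.
have p0 := enorm_ge0 (x - w); have q0 := enorm_ge0 (y - w).
rewrite -(@ler_pXn2r _ 2)// ?nnegrE ?addr_ge0 ?mulr_ge0 ?enorm_ge0//.
rewrite exprMn sqr_sqrtr//.
have -> : enorm (x - y) ^+ 2 = enorm (x - w) ^+ 2 + enorm (y - w) ^+ 2.
  rewrite !enorm_sqr -big_split/=; apply: eq_bigr => l _; rewrite !mxE.
  by have [|] := leP (x 0 l) (y 0 l) => _; ring.
by have := sqr_ge0 (enorm (x - w) - enorm (y - w)); nra.
Qed.

End enorm_theory.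

Section base_function.
Context {R : realType} {d : nat} (a c : R) (z : 'rV[R]_d).
Hypotheses (a_gt0 : 0 < a) (c_ge0 : 0 <= c).
Implicit Types (x y : 'rV[R]_d) (i : 'I_d) (p : pred 'I_d).

Definition excess p x : R := \big[Num.max/0]_(l < d | p l) (x 0 l - z 0 l).

(* Up to the factor [c], a piecewise linear version of the indicator of
   [x <= z], centred so as to halve its supremum norm. *)
Definition ramp x : R := c * (2^-1 - Num.min a (excess xpredT x) / a).

Lemma excess_ge0 p x : 0 <= excess p x.
Proof. exact: bigmax_ge_id. Qed.

Lemma ramp_between x : - (c / 2) <= ramp x <= c / 2.
Proof.
have m0 : 0 <= Num.min a (excess xpredT x) by rewrite le_min ltW// excess_ge0.
have m1 : Num.min a (excess xpredT x) / a <= 1.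
  by rewrite ler_pdivrMr// mul1r ge_min lexx.
have m2 : 0 <= Num.min a (excess xpredT x) / a by rewrite divr_ge0// ltW.
rewrite /ramp; move: (_ / a) m1 m2 => v v1 v0.
have cv := mulr_ge0 c_ge0 v0; have cv1 : c * v <= c by rewrite ler_piMr.
by rewrite mulrBr; apply/andP; split; lra.
Qed.

Lemma excess_le p x y r : 0 <= r -> (forall l, p l -> `|x 0 l - y 0 l| <= r) ->
  excess p x <= excess p y + r.
Proof.
move=> r0 xyr; apply: bigmax_le => [|l pl]; first by rewrite addr_ge0// excess_ge0.
have := xyr l pl; rewrite ler_norml => /andP[_ xy].
have : y 0 l - z 0 l <= excess p y by apply: le_bigmax_cond.
by lra.
Qed.

Lemma excess_homo p x y : (forall l, x 0 l <= y 0 l) -> excess p x <= excess p y.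
Proof. by move=> xy; apply: le_bigmax2 => l _; rewrite lerD2r. Qed.

Lemma ramp_decreasing x y : (forall l, x 0 l <= y 0 l) -> ramp y <= ramp x.
Proof.
move=> xy; rewrite /ramp ler_wpM2l// lerD2l lerN2.
rewrite ler_wpM2r ?invr_ge0 ?(ltW a_gt0)//.
by rewrite le_min !ge_min lexx/= excess_homo ?orbT.
Qed.

Lemma min_dist_le (u v r : R) : u <= v + r -> v <= u + r ->
  `|Num.min a u - Num.min a v| <= r.
Proof.
move=> uv vu; rewrite ler_distl lerBlDr.
by have [] := leP a u; have [] := leP a v => *; apply/andP; split; lra.
Qed.

Lemma ramp_lipschitz x y : `|ramp x - ramp y| <= c / a * enorm (x - y).
Proof.
have -> : ramp x - ramp y = c / a *
    (Num.min a (excess xpredT y) - Num.min a (excess xpredT x)).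
  by rewrite /ramp; ring.
rewrite normrM ger0_norm ?divr_ge0 ?(ltW a_gt0)// ler_wpM2l ?divr_ge0 ?(ltW a_gt0)//.
apply: min_dist_le; apply: excess_le; rewrite ?enorm_ge0// => l _.
  by rewrite distrC; have := coord_le_enorm (x - y) l; rewrite !mxE.
by have := coord_le_enorm (x - y) l; rewrite !mxE.
Qed.

Lemma ramp_coord_lipschitz : coord_lipschitz (c / a) ramp.
Proof.
by move=> i x t; rewrite (le_trans (ramp_lipschitz _ _))// addrAC subrr add0r enorm_delta.
Qed.

Lemma excess_le_forall x (t : R) : 0 <= t ->
  [forall l, x 0 l <= z 0 l + t] = (excess xpredT x <= t).
Proof.
move=> t0; apply/forallP/idP => [xt|xt l].
  by apply: bigmax_le => // l _; rewrite lerBlDl.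
rewrite -lerBlDl (le_trans _ xt)//.
exact: (le_bigmax_cond 0 (fun l => x 0 l - z 0 l) (P := xpredT)).
Qed.

(* Comparisons with step functions reduce expectations of [ramp] to
   probabilities of orthants. *)
Lemma ramp_le_step n x :
  ramp x <= c * (n.+1%:R^-1 * \sum_(k < n.+1)
    [forall l, x 0 l <= z 0 l + k.+1%:R / n.+1%:R * a]%:R - 2^-1).
Proof.
have n0 : 0 < n.+1%:R :> R by [].
pose w : R := n.+1%:R * (excess xpredT x / a).
have w0 : 0 <= w by rewrite mulr_ge0// divr_ge0 ?excess_ge0 ?ltW.
have E (k : 'I_n.+1) : [forall l, x 0 l <= z 0 l + k.+1%:R / n.+1%:R * a] =
    (w <= k.+1%:R).
  rewrite excess_le_forall; last by rewrite mulr_ge0 ?divr_ge0// ltW.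
  by rewrite /w (mulrC n.+1%:R) -ler_pdivlMr// ler_pdivrMr.
rewrite (eq_bigr (fun k : 'I_n.+1 => (w <= k.+1%:R)%R%:R)); last first.
  by move=> k _; rewrite E.
(* In units of [a / n.+1] the excess is [w], and the sum counts the levels 1, ..., N that are not
   below [w]. *)
have H N : N%:R - w <= \sum_(k < N) (w <= k.+1%:R)%R%:R.
  elim: N => [|N IH]; first by rewrite big_ord0 sub0r oppr_le0.
  rewrite big_ord_recr/=; have [wN|wN] := leP w (N.+1%:R).
    by rewrite -natr1/=; lra.
  by rewrite addr0 (@le_trans _ _ 0) ?sumr_ge0// subr_le0 ltW.
rewrite /ramp ler_wpM2l//.
have : 1 - w / n.+1%:R <= n.+1%:R^-1 * \sum_(k < n.+1) (w <= k.+1%:R)%R%:R.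
  by rewrite ler_pdivlMl// mulrBr mulr1 mulrCA divff ?gt_eqF// mulr1.
have S0 : 0 <= n.+1%:R^-1 * \sum_(k < n.+1) (w <= k.+1%:R)%R%:R :> R.
  by rewrite mulr_ge0 ?invr_ge0// sumr_ge0.
have -> : w / n.+1%:R = excess xpredT x / a.
  by rewrite /w mulrAC divff ?gt_eqF// mul1r.
move=> Hw; have [am|ma] := leP a (excess xpredT x); last first.
  by rewrite (_ : 2^-1 - _ = 1 - excess xpredT x / a - 2^-1) ?lerD2r//; lra.
by rewrite divff ?gt_eqF// (_ : 2^-1 - 1 = 0 - 2^-1) ?lerD2r//; lra.
Qed.

Lemma ramp_ge_step n x :
  c * (n.+1%:R^-1 * \sum_(k < n.+1)
    [forall l, x 0 l <= z 0 l + k%:R / n.+1%:R * a]%:R - 2^-1) <= ramp x.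
Proof.
have n0 : 0 < n.+1%:R :> R by [].
pose w : R := n.+1%:R * (excess xpredT x / a).
have w0 : 0 <= w by rewrite mulr_ge0// divr_ge0 ?excess_ge0 ?ltW.
have E (k : 'I_n.+1) : [forall l, x 0 l <= z 0 l + k%:R / n.+1%:R * a] =
    (w <= k%:R).
  rewrite excess_le_forall; last by rewrite mulr_ge0 ?divr_ge0// ltW.
  by rewrite /w (mulrC n.+1%:R) -ler_pdivlMr// ler_pdivrMr.
rewrite (eq_bigr (fun k : 'I_n.+1 => (w <= k%:R)%R%:R)); last first.
  by move=> k _; rewrite E.
(* The levels are now 0, ..., N - 1: this shift by one turns the upper estimate into a lower one. *)
have H N : \sum_(k < N) (w <= k%:R)%R%:R <= Num.max 0 (N%:R - w).
  elim: N => [|N IH]; first by rewrite big_ord0 le_max lexx.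
  rewrite big_ord_recr/= le_max; have [wN|wN] := leP w N%:R.
    rewrite -natr1/=; apply/orP; right.
    by move: IH; rewrite max_r ?subr_ge0//; lra.
  have wN' : N%:R - w <= 0 by rewrite subr_le0 ltW.
  by move: IH; rewrite addr0 (max_l wN') => ->.
rewrite /ramp ler_wpM2l//.
have wE : w / n.+1%:R = excess xpredT x / a by rewrite /w mulrAC divff ?gt_eqF// mul1r.
have : n.+1%:R^-1 * \sum_(k < n.+1) (w <= k%:R)%R%:R <= Num.max 0 (1 - w / n.+1%:R).
  rewrite ler_pdivrMl// (le_trans (H _))// maxr_pMr ?(ltW n0)//.
  by rewrite mulr0 mulrBr mulr1 mulrCA divff ?gt_eqF// mulr1.
rewrite wE.
have [am|ma] := leP a (excess xpredT x).
  rewrite divff ?gt_eqF// max_l.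
    by rewrite (_ : 2^-1 - 1 = 0 - 2^-1) ?lerD2r//; lra.
  by rewrite subr_le0 ler_pdivlMr// mul1r.
rewrite max_r.
  by rewrite (_ : 2^-1 - _ = 1 - excess xpredT x / a - 2^-1) ?lerD2r//; lra.
by rewrite subr_ge0 ler_pdivrMr// mul1r ltW.
Qed.

Lemma ramp_coord i x : ramp x = - (c / 2) + c / a *
  (Num.max (a - (x 0 i - z 0 i)) 0 -
   Num.max (Num.min a (excess (predC1 i) x) - (x 0 i - z 0 i)) 0).
Proof.
rewrite /ramp /excess (bigmaxD1 i)//= -/(excess (predC1 i) x).
have m0 := excess_ge0 (predC1 i) x; move: (excess _ x) m0 (x 0 i - z 0 i) => r r0 u.
have -> : Num.min a (Num.max u r) = a - (Num.max (a - u) 0 - Num.max (Num.min a r - u) 0).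
  by have [] := leP u r; have [] := leP a r; have [] := leP a u;
    have [] := leP (a - u) 0; have [] := leP (r - u) 0; lra.
by field; rewrite gt_eqF.
Qed.

Lemma excess_but_update i x t : excess (predC1 i) (x + t *: delta_mx 0 i) =
  excess (predC1 i) x.
Proof.
apply: eq_bigr => l li; rewrite !mxE (negbTE (li : l != i)) andbF mulr0 addr0.
by [].
Qed.

Lemma excess_but_lipschitz i x y :
  `|Num.min a (excess (predC1 i) x) - Num.min a (excess (predC1 i) y)| <=
  enorm_but i (x - y).
Proof.
apply: min_dist_le; apply: excess_le; rewrite ?sqrtr_ge0// => l li.
  by have := coord_le_enorm_but (x - y) li; rewrite !mxE.
by rewrite distrC; have := coord_le_enorm_but (x - y) li; rewrite !mxE.
Qed.

End base_function.

(** * Second and third differences of the positive part *)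

Ltac minmax_free t :=
  lazymatch t with
  | context [@Order.max] => fail
  | context [@Order.min] => fail
  | _ => idtac
  end.

(** Innermost minima and maxima are split first, so that every case condition is linear;
    contradictory branches are closed at once to limit the number of cases. *)
Ltac minmax_cases :=
  repeat (match goal with
    | |- context [@Order.max _ _ ?x ?y] =>
        minmax_free x; minmax_free y; have [] := leP x y
    | |- context [@Order.min _ _ ?x ?y] =>
        minmax_free x; minmax_free y; have [] := leP x y
  end; move=> *; try (exfalso; lra)); try lra.

Section piecewise_linear.
Context {R : realType}.
Implicit Types (b t u v : R) (f g : R -> R).

Definition lipschitz1 f := forall t u, `|f t - f u| <= `|t - u|.

Lemma lipschitz1_min f g : lipschitz1 f -> lipschitz1 g ->
  lipschitz1 (fun t => Num.min (f t) (g t)).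
Proof.
move=> f1 g1 t u; have := f1 t u; have := g1 t u.
rewrite !ler_distl => /andP[? ?] /andP[? ?].
by have [] := leP (f t) (g t); have [] := leP (f u) (g u) => *; apply/andP; split; lra.
Qed.

Lemma lipschitz1_max f g : lipschitz1 f -> lipschitz1 g ->
  lipschitz1 (fun t => Num.max (f t) (g t)).
Proof.
move=> f1 g1 t u; have := f1 t u; have := g1 t u.
rewrite !ler_distl => /andP[? ?] /andP[? ?].
by have [] := leP (f t) (g t); have [] := leP (f u) (g u) => *; apply/andP; split; lra.
Qed.

Lemma lipschitz1_add b : lipschitz1 (fun t => t + b).
Proof. by move=> t u; rewrite (_ : _ - _ = t - u)//; ring. Qed.

Lemma lipschitz1_sub b : lipschitz1 (fun t => b - t).
Proof. by move=> t u; rewrite (_ : _ - _ = u - t) 1?distrC//; ring. Qed.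

Lemma lipschitz1_cst b : lipschitz1 (fun=> b).
Proof. by move=> t u; rewrite subrr normr0. Qed.

Definition pos t : R := Num.max t 0.

(** The shift is by [+ b] because [x 0 i] enters the functions it is applied to with a minus sign:
    stepping back in [x 0 i] increases their argument. *)
Definition backward_diff b f t := f t - f (t + b).

(** The second difference is a trapezoid of height [b2] over [[- (b1 + b2), 0]] with slopes 1, 0 and
    -1, so the Lipschitz constant does not grow. *)
Lemma lipschitz1_diff2 b1 b2 : 0 <= b2 <= b1 ->
  lipschitz1 (backward_diff b2 (backward_diff b1 pos)).
Proof.
move=> /andP[b20 b12].
rewrite (_ : backward_diff _ _ = (fun t =>
    Num.max 0 (Num.min b2 (Num.min (0 - t) (t + (b1 + b2)))))).
  apply: lipschitz1_max; first exact: lipschitz1_cst.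
  apply: lipschitz1_min; first exact: lipschitz1_cst.
  by apply: lipschitz1_min; [exact: lipschitz1_sub|exact: lipschitz1_add].
apply/funext => t; rewrite /backward_diff /pos (_ : t + b2 + b1 = t + (b1 + b2)); last by ring.
by minmax_cases.
Qed.

(** With widths 2b, b the trapezoid has nonzero slope on (-3b, -2b) and (-b, 0) only. Its shift by b
    has nonzero slope on (-4b, -3b) and (-2b, -b), disjoint from these, so the slopes of the
    difference stay within [-1, 1]. This is why the first width is doubled when m = 4. *)
Lemma lipschitz1_diff3 b : 0 <= b -> lipschitz1
  (backward_diff b (backward_diff b (backward_diff (2 * b) pos))).
Proof.
move=> b0.
rewrite (_ : backward_diff _ _ = (fun t => Num.max
    (Num.min 0 (Num.max (t + 3 * b) (- (3 * b) - t) + - b))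
    (b - Num.max (t + b) (- b - t)))).
  apply: lipschitz1_max.
    apply: lipschitz1_min; first exact: lipschitz1_cst.
    move=> t u; rewrite (_ : _ - _ = Num.max (t + 3 * b) (- (3 * b) - t) -
      Num.max (u + 3 * b) (- (3 * b) - u)); last by ring.
    exact: (lipschitz1_max (lipschitz1_add (3 * b)) (lipschitz1_sub (- (3 * b)))).
  move=> t u; rewrite (_ : _ - _ = Num.max (u + b) (- b - u) -
    Num.max (t + b) (- b - t)); last by ring.
  rewrite distrC.
  exact: (lipschitz1_max (lipschitz1_add b) (lipschitz1_sub (- b))).
apply/funext => t; rewrite /backward_diff /pos.
rewrite (_ : t + b + 2 * b = t + 3 * b); last by ring.
rewrite (_ : t + b + b + 2 * b = t + 4 * b); last by ring.
rewrite (_ : t + b + b = t + 2 * b); last by ring.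
by minmax_cases.
Qed.

End piecewise_linear.

Section diffquot_bounds.
Context {R : realType} {d : nat}.
Implicit Types (f g : 'rV[R]_d -> R) (x y : 'rV[R]_d) (b k o : R) (i j : 'I_d).

Definition enorm_lipschitz k f := forall x y, `|f x - f y| <= k * enorm (x - y).

Definition oscillation_le o f := forall x y, `|f x - f y| <= o.

Definition antitone f := forall x y, (forall l, x 0 l <= y 0 l) -> f y <= f x.

Lemma diffquot_enorm_lipschitz k f b i : 0 < b -> enorm_lipschitz k f ->
  enorm_lipschitz (2 / b * k) (diffquot b i f).
Proof.
move=> b0 fk x y; rewrite /diffquot -mulrBl normrM [`|b^-1|]gtr0_norm ?invr_gt0//.
rewrite (_ : 2 / b * k * _ = 2 * (k * enorm (x - y)) / b); last by ring.
rewrite ler_wpM2r ?invr_ge0 ?(ltW b0)//.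
have -> : f x - f (x - b *: delta_mx 0 i) - (f y - f (y - b *: delta_mx 0 i)) =
    (f x - f y) - (f (x - b *: delta_mx 0 i) - f (y - b *: delta_mx 0 i)) by ring.
rewrite (le_trans (ler_normB _ _))// mulr_natl mulr2n lerD//.
by rewrite (le_trans (fk _ _))// opprB addrA subrK.
Qed.

Lemma diffquot_le o f b i x : 0 < b -> oscillation_le o f ->
  `|diffquot b i f x| <= o / b.
Proof.
move=> b0 fo; rewrite normrM [`|b^-1|]gtr0_norm ?invr_gt0//.
by rewrite ler_wpM2r ?invr_ge0 ?(ltW b0).
Qed.

Lemma diffquot_oscillation o f b i : 0 < b -> oscillation_le o f ->
  oscillation_le (2 / b * o) (diffquot b i f).
Proof.
move=> b0 fo x y; rewrite (le_trans (ler_normB _ _))// (_ : 2 / b * o = o / b + o / b).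
  by rewrite lerD// diffquot_le.
by field; rewrite gt_eqF.
Qed.

Lemma shift_le x b i : 0 <= b -> forall l, (x - b *: delta_mx 0 i) 0 l <= x 0 l.
Proof.
move=> b0 l; rewrite !mxE gerBl eqxx/=.
by case: (l == i); rewrite ?mulr1 ?mulr0.
Qed.

(** The quotients of an antitone function all lie in [[- o / b, 0]], which saves a factor 2 against
    [diffquot_oscillation]. *)
Lemma diffquot_oscillation_antitone o f b i : 0 < b -> antitone f ->
  oscillation_le o f -> oscillation_le (o / b) (diffquot b i f).
Proof.
move=> b0 fa fo x y.
have np u : diffquot b i f u <= 0.
  rewrite /diffquot mulr_le0_ge0 ?invr_ge0 ?(ltW b0)// subr_le0.
  by apply: fa; exact: shift_le (ltW b0).
have := diffquot_le i x b0 fo; have := diffquot_le i y b0 fo.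
have := np x; have := np y; rewrite !ler_norml => ny nx /andP[? ?] /andP[? ?].
by apply/andP; split; lra.
Qed.

(* Comparing [x] and [y] through their coordinatewise minimum makes the four
   increments one-signed; this gains a factor [sqrt 2] over the crude bound. *)
Lemma diffquot2_antitone_lipschitz k f b1 b2 i j : 0 < b1 -> 0 < b2 -> 0 <= k ->
  antitone f -> enorm_lipschitz k f ->
  enorm_lipschitz (2 * Num.sqrt 2 * k / (b1 * b2))
    (diffquot b2 j (diffquot b1 i f)).
Proof.
move=> b10 b20 k0 fa fk.
set D := diffquot _ _ _.
have mono x y : (forall l, x 0 l <= y 0 l) ->
    `|D x - D y| <= 2 * k / (b1 * b2) * enorm (x - y).
  move=> xy.
  have inc v : 0 <= f (x - v) - f (y - v) <= k * enorm (x - y).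
    apply/andP; split.
      by rewrite subr_ge0; apply: fa => l; rewrite !mxE lerD2r.
    rewrite (le_trans (ler_norm _))// (le_trans (fk _ _))//.
    by rewrite opprB addrA subrK.
  have -> : D x - D y = (b1 * b2)^-1 *
      ((f (x - 0) - f (y - 0)) - (f (x - b1 *: delta_mx 0 i) - f (y - b1 *: delta_mx 0 i))
       - (f (x - b2 *: delta_mx 0 j) - f (y - b2 *: delta_mx 0 j))
       + (f (x - (b2 *: delta_mx 0 j + b1 *: delta_mx 0 i)) -
          f (y - (b2 *: delta_mx 0 j + b1 *: delta_mx 0 i)))).
    by rewrite /D /diffquot !subr0 !opprD !addrA; field; rewrite !gt_eqF.
  rewrite normrM gtr0_norm ?invr_gt0 ?mulr_gt0//.
  rewrite [2 * k / _]mulrC -mulrA ler_wpM2l ?invr_ge0 ?mulr_ge0 ?(ltW b10) ?(ltW b20)//.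
  move: (inc 0) (inc (b1 *: delta_mx 0 i)) (inc (b2 *: delta_mx 0 j))
    (inc (b2 *: delta_mx 0 j + b1 *: delta_mx 0 i)).
  move=> /andP[? ?] /andP[? ?] /andP[? ?] /andP[? ?].
  by rewrite ler_norml; apply/andP; split; lra.
move=> x y; set w : 'rV[R]_d := \row_l Num.min (x 0 l) (y 0 l).
have wx l : w 0 l <= x 0 l by rewrite mxE ge_min lexx.
have wy l : w 0 l <= y 0 l by rewrite mxE ge_min lexx orbT.
have K0 : 0 <= 2 * k / (b1 * b2) by rewrite divr_ge0 ?mulr_ge0// ltW.
have neg u v : enorm (u - v) = enorm (v - u) :> R.
  by rewrite /enorm; congr Num.sqrt; apply: eq_bigr => l _; rewrite !mxE; ring.
have Dx : `|D x - D w| <= 2 * k / (b1 * b2) * enorm (w - x).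
  by rewrite distrC; exact: mono.
apply: (le_trans (ler_distD (D w) _ _)).
apply: (le_trans (lerD Dx (mono _ _ wy))).
rewrite -mulrDr [enorm (w - x)]neg [enorm (w - y)]neg.
rewrite (le_trans (ler_wpM2l K0 (enorm_min_le x y)))//.
by rewrite le_eqVlt; apply/orP; left; apply/eqP; field; rewrite !gt_eqF.
Qed.

End diffquot_bounds.

Section ramp_derivatives.
Context {R : realType} {d : nat} (a c : R) (z : 'rV[R]_d).
Hypotheses (a_gt0 : 0 < a) (c_ge0 : 0 <= c).
Implicit Types (f : 'rV[R]_d -> R) (i : 'I_d) (G : R -> R) (k b : R).

(* As functions of the [i]-th coordinate, [ramp] and its iterated difference
   quotients in direction [i] have this shape (see [ramp_coord]). *)
Definition ridge i k G f := exists C, forall x, f x = C + k *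
  (G (a - (x 0 i - z 0 i)) -
   G (Num.min a (excess z (predC1 i) x) - (x 0 i - z 0 i))).

Lemma ridge_ramp i : ridge i (c / a) pos (ramp a c z).
Proof. by exists (- (c / 2)) => x; apply: ramp_coord. Qed.

Lemma ridge_diffquot i k G f b : 0 < b -> ridge i k G f ->
  ridge i (k / b) (backward_diff b G) (diffquot b i f).
Proof.
move=> b0 [C fE]; exists 0 => x; rewrite /diffquot !fE -scaleNr excess_but_update.
have -> : (x + - b *: delta_mx 0 i) 0 i = x 0 i - b.
  by rewrite !mxE !eqxx mulr1.
rewrite /backward_diff.
have E u : u - (x 0 i - b - z 0 i) = u - (x 0 i - z 0 i) + b by ring.
by rewrite !E; field; rewrite gt_eqF.
Qed.

(** The coordinate [i] enters both terms of the ridge and the other coordinates only the second,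
    whence the weights 2 and 1 of [weighted_enorm_le]. *)
Lemma ridge_lipschitz i k G f : 0 <= k -> lipschitz1 G -> ridge i k G f ->
  enorm_lipschitz (k * Num.sqrt 5) f.
Proof.
move=> k0 G1 [C fE] x y; rewrite !fE.
set u := x 0 i - z 0 i; set v := y 0 i - z 0 i.
set r := Num.min a _; set s := Num.min a _.
rewrite (_ : _ - _ = k * ((G (a - u) - G (a - v)) - (G (r - u) - G (s - v)))); last by ring.
rewrite normrM ger0_norm// -mulrA ler_wpM2l//.
apply: le_trans (weighted_enorm_le (x - y) i).
have uv : `|u - v| = `|(x - y) 0 i| by rewrite !mxE; congr `|_|; rewrite /u /v; ring.
have H1 : `|G (a - u) - G (a - v)| <= `|u - v|.
  by apply: (le_trans (G1 _ _)); rewrite distrC (_ : a - v - (a - u) = u - v)//; ring.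
have H2 : `|G (r - u) - G (s - v)| <= `|r - s| + `|u - v|.
  apply: (le_trans (G1 _ _)); rewrite (_ : r - u - (s - v) = (r - s) - (u - v)); last by ring.
  exact: ler_normB.
have H3 : `|r - s| <= enorm_but i (x - y) by exact: excess_but_lipschitz.
by apply: (le_trans (ler_normB _ _)); rewrite -uv; lra.
Qed.

Lemma ramp_oscillation : oscillation_le c (ramp a c z).
Proof.
move=> x y; have /andP[? ?] := ramp_between z a_gt0 c_ge0 x.
by have /andP[? ?] := ramp_between z a_gt0 c_ge0 y; rewrite ler_norml; apply/andP; split; lra.
Qed.

Section iterated.
Variables (bw : nat -> R) (be : R).
Hypotheses (be_gt0 : 0 < be) (be_le : forall t, be <= bw t).

Let bw_gt0 t : 0 < bw t.
Proof. exact: lt_le_trans (be_le t). Qed.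

Let geom_ge0 k n : 0 <= k -> 0 <= k * (2 / be) ^+ n.
Proof. by move=> k0; rewrite mulr_ge0// exprn_ge0// divr_ge0// ltW. Qed.

Let cb_ge0 : 0 <= c / bw 0.
Proof. by rewrite divr_ge0// ltW. Qed.

Let ca_ge0 : 0 <= c / a.
Proof. by rewrite divr_ge0// ltW. Qed.

Let F s := iter_diffquot bw s (ramp a c z).

Lemma oscillation_leW o o' f : o <= o' -> oscillation_le o f -> oscillation_le o' f.
Proof. by move=> oo fo x y; apply: le_trans (fo x y) oo. Qed.

Lemma enorm_lipschitzW k k' f : k <= k' -> enorm_lipschitz k f -> enorm_lipschitz k' f.
Proof.
by move=> kk fk x y; apply: le_trans (fk x y) _; rewrite ler_wpM2r// enorm_ge0.
Qed.

(** The last entry [i] is the quotient applied to the ramp itself, with width [bw 0]; monotonicity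
    saves its factor 2. Each later quotient costs [2 / be]. *)
Lemma iter_diffquot_oscillation i s :
  oscillation_le (c / bw 0 * (2 / be) ^+ size s) (F (rcons s i)).
Proof.
elim: s => [|j s IH] /=.
  rewrite expr0 mulr1; apply: diffquot_oscillation_antitone => //.
    exact: ramp_decreasing.
  exact: ramp_oscillation.
apply: oscillation_leW (diffquot_oscillation _ _ IH) => //.
rewrite exprS [leRHS]mulrCA ler_wpM2r ?geom_ge0//.
by rewrite ler_wpM2l// lef_pV2 ?posrE.
Qed.

Lemma iter_diffquot_le0 x : `|F [::] x| <= c / 2.
Proof. by rewrite ler_norml; exact: ramp_between. Qed.

Lemma iter_diffquot_le1 i x : `|F [:: i] x| <= c / bw 0.
Proof. by apply: diffquot_le => //; exact: ramp_oscillation. Qed.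

(** The outermost quotient is bounded and not compared at two points, hence costs [1 / be] instead
    of [2 / be]. *)
Lemma iter_diffquot_le j i s x :
  `|F (j :: rcons s i) x| <= c / bw 0 * (2 / be) ^+ size s / be.
Proof.
apply: (le_trans (diffquot_le _ _ _ (iter_diffquot_oscillation i s))) => //.
rewrite ler_wpM2l ?geom_ge0//.
by rewrite lef_pV2 ?posrE.
Qed.

Lemma iter_diffquot_enorm_lipschitz s :
  enorm_lipschitz (c / a * (2 / be) ^+ size s) (F s).
Proof.
elim: s => [|i s IH] /=.
  by rewrite expr0 mulr1; exact: ramp_lipschitz.
apply: enorm_lipschitzW (diffquot_enorm_lipschitz _ _ IH) => //.
rewrite exprS [leRHS]mulrCA ler_wpM2r ?geom_ge0//.
by rewrite ler_wpM2l// lef_pV2 ?posrE.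
Qed.

End iterated.
End ramp_derivatives.

(** * The constant M' and the choice of the widths *)

(** The classical monotonicity of (1 + 1/n)^(n+1). Consecutive bases have the ratio 1 + 1/(n (n +
    2)), and Bernoulli's inequality bounds its power from below by 1 + 1/n. *)
Lemma succ_ratio_decreasing (R : realType) (m : nat) :
  (1 + m.+2%:R^-1) ^+ m.+3 <= (1 + m.+1%:R^-1) ^+ m.+2 :> R.
Proof.
have m1 : 0 < m.+1%:R :> R by [].
have m2 : m.+2%:R = m.+1%:R + 1 :> R by rewrite natr1.
have m3 : m.+3%:R = m.+1%:R + 2 :> R by rewrite -natrD addn2.
move: m1 m2 m3; move: (m.+1%:R : R) => r r0 m2 m3.
have q0 : 0 < 1 + r^-1 by rewrite ltr_wpDr// ltW// invr_gt0.
pose h := (r * (r + 2))^-1.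
have E : 1 + r^-1 = (1 + m.+2%:R^-1) * (1 + h).
  by rewrite m2 /h; field; rewrite !gt_eqF//; lra.
have h0 : -1 <= h by rewrite (@le_trans _ _ 0)// invr_ge0 mulr_ge0//; lra.
have := bernoulli_inequality m.+3 h0; rewrite m3 => H.
have {}H : 1 + r^-1 <= (1 + h) ^+ m.+3.
  by apply: le_trans H; rewrite /h lerD2l le_eqVlt; apply/orP; left; apply/eqP; field; lra.
rewrite -(ler_pM2r q0) -exprSr E exprMn -E.
by rewrite ler_wpM2l// exprn_ge0// addr_ge0// invr_ge0 m2; lra.
Qed.

(** The limit is e^2 < 8, and 13 is the first index at which the square is below 8. *)
Lemma succ_ratio_le8 (R : realType) (m : nat) :
  ((1 + (m + 13)%:R^-1) ^+ (m + 14)) ^+ 2 <= 8 :> R.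
Proof.
elim: m => [|m IH]; first by rewrite !add0n; lra.
apply: le_trans IH.
have -> : (m.+1 + 13 = (m + 12).+2)%N by lia.
have -> : (m.+1 + 14 = (m + 12).+3)%N by lia.
have -> : (m + 13 = (m + 12).+1)%N by lia.
have -> : (m + 14 = (m + 12).+2)%N by lia.
by rewrite lerXn2r ?nnegrE ?exprn_ge0 ?addr_ge0 ?invr_ge0// succ_ratio_decreasing.
Qed.

(** Squaring removes the half-integral exponent from M'. From m to m + 1 the left side grows by the
    factor ((1 + 1/m)^(m+1) m)^2, the right side by 8 m^2; the range from 5 to 12 and the start at
    13 are computed. *)
Lemma expn_le_fact (R : realType) (m : nat) : (5 <= m)%N ->
  (m%:R ^+ m) ^+ 2 <= 8 ^+ m * (m.-1)`!%:R ^+ 2 :> R.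
Proof.
move=> m5; have [m13|m13] := ltnP m 13.
  have : m \in iota 5 8 by rewrite mem_iota m5.
  rewrite !inE => /orP[|/orP[|/orP[|/orP[|/orP[|/orP[|/orP[|]]]]]]] /eqP ->;
    by rewrite /predn !factS fact0 !natrM; lra.
rewrite -(subnK m13); elim: (m - 13)%N => [|n IH].
  by rewrite add0n /predn !factS fact0 !natrM; lra.
set r : R := (n + 13)%:R; have r0 : 0 < r by rewrite ltr0n addn_gt0 orbT.
have := succ_ratio_le8 R n; rewrite -/r.
have -> : (n + 14 = (n + 13).+1)%N by lia.
have rS : ((n.+1 + 13)%:R : R) = (1 + r^-1) * r.
  by rewrite mulrDl mul1r mulVf ?gt_eqF// addSn -natr1 addrC.
rewrite rS addSn /= exprMn => x8.
have fE : ((n + 13)`!%:R : R) = r * ((n + 13).-1)`!%:R.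
  by rewrite -natrM -[in LHS](prednK (_ : 0 < n + 13)%N) ?addn_gt0 ?orbT// factS prednK// addn_gt0 orbT.
rewrite fE [in leRHS]exprS (exprS r) !exprMn.
have := ler_pM _ _ x8 IH; rewrite -/r => /(_ (sqr_ge0 _) (sqr_ge0 _)) H.
have r2 : 0 <= r ^+ 2 by exact: sqr_ge0.
have := ler_wpM2r r2 H; rewrite !mulrA.
by congr (_ <= _); ring.
Qed.

Lemma Mprime_le4 (R : realType) (m : nat) : (1 <= m <= 4)%N ->
  Mprime R m = 2 ^+ m / 4 * (m.-1)`!%:R.
Proof.
move=> /andP[m1 m4]; rewrite /Mprime m4; congr (_ * _).
by rewrite powRB ?pnatr_eq0 ?implybT// !powR_mulrn//; congr (_ / _); lra.
Qed.

Lemma Mprime_ge5 (R : realType) (m : nat) : (5 <= m)%N ->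
  0 <= Mprime R m /\ 16 * Mprime R m ^+ 2 = 8 ^+ m * (m.-1)`!%:R ^+ 2.
Proof.
move=> m5; rewrite /Mprime leqNgt m5 /=; split; first by rewrite mulr_ge0 ?powR_ge0.
rewrite exprMn mulrA; congr (_ * _).
rewrite -[_ ^+ 2](powR_mulrn 2 (powR_ge0 _ _)) -powRrM.
rewrite (_ : _ * 2%:R = (3 * m)%:R - 4); last by rewrite natrM; field.
rewrite powRB ?pnatr_eq0 ?implybT// !powR_mulrn// exprM.
by rewrite (_ : 2 ^+ 3 = 8); [field|lra].
Qed.

Lemma expn_le_Mprime (R : realType) (m : nat) : (1 <= m)%N -> m != 3 -> m != 4 ->
  m%:R ^+ m <= 4 * Mprime R m.
Proof.
move=> m1 m3 m4; have [m5|m5] := ltnP m 5.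
  rewrite Mprime_le4; last by rewrite m1 -ltnS.
  by case: m m1 m3 m4 m5 => [//|[|[|[//|[//|m]]]]] // _ _ _ _;
    rewrite /= !(factS, fact0); lra.
have [M0 ME] := Mprime_ge5 R m5.
rewrite -(@ler_pXn2r _ 2)// ?nnegrE ?exprn_ge0 ?mulr_ge0//.
by rewrite exprMn (_ : 4 ^+ 2 = 16) ?ME ?expn_le_fact//; lra.
Qed.

(** Needed at order 0, where the ramp has supremum norm at most c / 2. *)
Lemma Mprime_ge (R : realType) (m : nat) : (1 <= m)%N -> 2^-1 <= Mprime R m.
Proof.
move=> m1; have [m5|m5] := ltnP m 5.
  rewrite Mprime_le4; last by rewrite m1 -ltnS.
  by case: m m1 m5 => [//|[|[|[|[|m]]]]] // _ _;
    rewrite /= !(factS, fact0); lra.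
have m3 : m != 3 by rewrite gtn_eqF// (leq_trans _ m5).
have m4 : m != 4 by rewrite gtn_eqF.
have := expn_le_Mprime R m1 m3 m4.
have : (2 : R) <= m%:R ^+ m.
  rewrite (@le_trans _ _ (m%:R : R))// ?ler_nat ?(leq_trans _ m5)//.
  by rewrite ler_eXnr// ler1n.
by lra.
Qed.

Section parameters.
Context {R : realType}.

(** The [m - 1] averages in each direction provide the derivatives of order below m, and the
    Lipschitz property of the ramp provides order m. The dimension is quantified inside: widths and
    bounds are the same in all dimensions. *)
Definition good_smoothing (m : nat) (q a : R) (bw : nat -> R) :=
  [/\ 0 < a, (forall t, 0 < bw t), a / 2 + \sum_(t < m.-1) bw t = 2 / q &
      forall d c (z : 'rV[R]_d), 0 <= c ->
      (forall s x, (size s < m)%N ->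
        `|iter_diffquot bw s (ramp a c z) x| <= c * (Mprime R m * q ^+ size s)) /\
      (forall s, size s = m.-1 ->
        enorm_lipschitz (c * (Mprime R m * q ^+ m))
          (iter_diffquot bw s (ramp a c z)))].

(** The half-width [a / 2] and the [m - 1] averages take equal shares [2 / (m q)] of the budget. The
    quotient of order j then has the bound c m^j q^j / 4 if 2 <= j, and c m q / 2 if j = 1. *)
Lemma good_smoothing_generic (m : nat) (q : R) : (1 <= m)%N -> 0 < q ->
  m%:R ^+ m <= 4 * Mprime R m ->
  good_smoothing m q (4 / (m%:R * q)) (fun=> 2 / (m%:R * q)).
Proof.
move=> m1 q0 mM; set M := Mprime R m.
have r0 : 0 < m%:R :> R by rewrite ltr0n.
have r1 : 1 <= m%:R :> R by rewrite ler1n.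
have rq : 0 < m%:R * q by rewrite mulr_gt0.
have a0 : 0 < 4 / (m%:R * q) by rewrite divr_gt0.
have be0 : 0 < 2 / (m%:R * q) by rewrite divr_gt0.
have mj j : (j <= m)%N -> m%:R ^+ j <= 4 * M.
  by move=> jm; rewrite (le_trans _ mM)// ler_weXn2l.
have beE : 2 / (2 / (m%:R * q)) = m%:R * q by field; rewrite !gt_eqF.
split=> //.
  rewrite sumr_const card_ord -[X in _ + X]mulr_natl -subn1 natrB//.
  by field; rewrite !gt_eqF.
move=> d c z c0; split=> [s x sm|s sm].
  case/lastP: s sm => [_|s i].
    rewrite expr0 mulr1 (le_trans (iter_diffquot_le0 _ a0 c0 _ _))//.
    by rewrite ler_wpM2l// Mprime_ge.
  rewrite size_rcons; case: s => [|j s] /= sm.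
    rewrite expr1; apply: (le_trans (iter_diffquot_le1 z a0 c0 be0 (fun=> lexx _) i x)).
    rewrite (_ : c / _ = c * (m%:R / 2 * q)); last by field; rewrite !gt_eqF.
    rewrite ler_wpM2l// ler_wpM2r ?(ltW q0)//.
    rewrite ler_pdivrMr// -(ler_pM2l r0) (@le_trans _ _ (4 * M))//.
      by rewrite -expr2 mj.
    have r2 : 2 <= m%:R :> R by rewrite ler_nat.
    have M0 : 0 < M by apply: lt_le_trans (Mprime_ge R m1).
    by rewrite mulrCA [leLHS]mulrC ler_wpM2l ?(ltW M0)//; lra.
  apply: (le_trans (iter_diffquot_le z a0 c0 be0 (fun=> lexx _) j i s x)).
  rewrite beE.
  rewrite (_ : _ / _ = c * (m%:R ^+ (size s).+2 / 4 * q ^+ (size s).+2)).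
    rewrite ler_wpM2l// ler_wpM2r ?exprn_ge0 ?(ltW q0)//.
    by rewrite ler_pdivrMr// mulrC mj// ltnW.
  by rewrite exprMn !exprS; field; rewrite !gt_eqF.
apply: enorm_lipschitzW (iter_diffquot_enorm_lipschitz z a0 c0 be0 (fun=> lexx _) s).
rewrite beE sm; set k := m.-1; have mk : m = k.+1 by rewrite prednK.
rewrite (_ : c / _ * _ = c * (m%:R ^+ m / 4 * q ^+ m)).
  rewrite ler_wpM2l// ler_wpM2r ?exprn_ge0 ?(ltW q0)//.
  by rewrite ler_pdivrMr// mulrC.
rewrite [in X in _ = c * (_ ^+ X / _ * _)]mk [in X in _ = c * (_ * _ ^+ X)]mk.
by rewrite exprMn !exprS; field; rewrite !gt_eqF.
Qed.

Lemma sqrt2_le : Num.sqrt 2 <= 17 / 12 :> R.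
Proof.
rewrite -(@ler_pXn2r _ 2) ?nnegrE ?sqrtr_ge0 ?sqr_sqrtr//; lra.
Qed.

Lemma sqrt5_le : Num.sqrt 5 <= 9 / 4 :> R.
Proof.
rewrite -(@ler_pXn2r _ 2) ?nnegrE ?sqrtr_ge0 ?sqr_sqrtr//; lra.
Qed.

(** Only the third order is tight against M' = 4. A repeated direction uses the widths [bw 0] and
    [bw 1], two different directions use [bw 0] twice; taking [bw 0] slightly larger brings both
    cases below 4. *)
Lemma good_smoothing3 (q : R) : 0 < q ->
  good_smoothing 3 q (4 / (3 * q))
    (fun t => if t == 0%N then 11 / (15 * q) else 3 / (5 * q)).
Proof.
move=> q0; have qn0 : q != 0 by rewrite gt_eqF.
set bw := fun t : nat => _.
have a0 : 0 < 4 / (3 * q) by rewrite divr_gt0// mulr_gt0.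
have be0 : 0 < 3 / (5 * q) by rewrite divr_gt0// mulr_gt0.
have b00 : 0 < 11 / (15 * q) by rewrite divr_gt0// mulr_gt0.
have bb : 3 / (5 * q) <= 11 / (15 * q).
  rewrite -subr_ge0 (_ : _ - _ = 2 / (15 * q)); last by field.
  by rewrite divr_ge0// mulr_ge0// ltW.
have be t : 3 / (5 * q) <= bw t by rewrite /bw; case: ifP.
have bw0 t : 0 < bw t by exact: lt_le_trans (be t).
have ME : Mprime R 3 = 4 by rewrite Mprime_le4//= !(factS, fact0); lra.
split=> //.
  by rewrite /= !big_ord_recr big_ord0 /= /bw /=; field.
move=> d c z c0; rewrite ME; split=> [s x|s].
  case: s => [_|i [_|j [_|//]]].
  - rewrite expr0 mulr1; apply: (le_trans (iter_diffquot_le0 _ a0 c0 _ _)).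
    by rewrite ler_wpM2l//; lra.
  - apply: (le_trans (iter_diffquot_le1 z a0 c0 be0 be i x)).
    rewrite (_ : c / _ = c * (15 / 11 * q)); last by rewrite /bw/=; field.
    by rewrite ler_wpM2l// expr1 ler_wpM2r ?(ltW q0)//; lra.
  - apply: (le_trans (iter_diffquot_le z a0 c0 be0 be i j [::] x)).
    rewrite (_ : _ / _ = c * (25 / 11 * q ^+ 2)); last by rewrite /bw/=; field.
    by rewrite ler_wpM2l// ler_wpM2r ?sqr_ge0//; lra.
case: s => [//|i [//|j [|//]]] _ /=.
(* For a repeated direction, the second difference along the axis is a trapezoid: the constant is
   75/44 sqrt 5. *)
rewrite /iter_diffquot /=; have [ij|ij] := eqVneq j i.
  have rj := ridge_ramp c z a0 i.
  have r1 := ridge_diffquot b00 rj.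
  have r2 := ridge_diffquot be0 r1.
  have k0 : 0 <= c / (4 / (3 * q)) / (11 / (15 * q)) / (3 / (5 * q)).
    apply: divr_ge0 (ltW be0); apply: divr_ge0 (ltW b00).
    exact: divr_ge0 (ltW a0).
  have bb' : 0 <= 3 / (5 * q) <= 11 / (15 * q) by rewrite bb ltW.
  have L := ridge_lipschitz k0 (lipschitz1_diff2 bb') r2.
  rewrite ij /bw /=.
  apply: enorm_lipschitzW L.
  rewrite (_ : c / _ / _ / _ * _ = c * (75 / 44 * Num.sqrt 5 * q ^+ 3)); last by field.
  rewrite ler_wpM2l// ler_wpM2r ?exprn_ge0 ?(ltW q0)//.
  by have := sqrt5_le; lra.
(* For two directions, the one-signed increments of the ramp gain a factor [sqrt 2]: the constant is
   675/242 sqrt 2. *)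
have k0 : 0 <= c / (4 / (3 * q)) by exact: divr_ge0 (ltW a0).
have L := diffquot2_antitone_lipschitz j i b00 b00 k0 (ramp_decreasing z a0 c0) (ramp_lipschitz z a0 c0).
rewrite /bw /=.
apply: enorm_lipschitzW L.
rewrite (_ : _ / _ = c * (2 * Num.sqrt 2 * (3 * 225 / 484) * q ^+ 3)); last by field.
rewrite ler_wpM2l// ler_wpM2r ?exprn_ge0 ?(ltW q0)//.
by have := sqrt2_le; lra.
Qed.

End parameters.

Section parameters4.
Context {R : realType}.

(** Widths 2b, b, b with b = 3/(8q). Three equal directions are covered by the third difference,
    exactly two by the trapezoid and one crude quotient of width 2b, three different ones by crude
    quotients alone, all of width 2b. *)
Lemma good_smoothing4 (q : R) : 0 < q ->
  good_smoothing 4 q (1 / q)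
    (fun t => if t == 0%N then 3 / (4 * q) else 3 / (8 * q)).
Proof.
move=> q0; have qn0 : q != 0 by rewrite gt_eqF.
set b1 := 3 / (8 * q).
have b10 : 0 < b1 by rewrite divr_gt0// mulr_gt0.
have bE : 3 / (4 * q) = 2 * b1 by rewrite /b1; field.
rewrite bE; set bw := fun t : nat => _.
have a0 : 0 < 1 / q by rewrite divr_gt0.
have b00 : 0 < 2 * b1 by rewrite mulr_gt0.
have be t : b1 <= bw t by rewrite /bw; case: ifP => _; lra.
have bw0 t : 0 < bw t by exact: lt_le_trans (be t).
have ME : Mprime R 4 = 24 by rewrite Mprime_le4//= !(factS, fact0); lra.
have s5 := @sqrt5_le R.
have s50 : 0 <= Num.sqrt 5 :> R by exact: sqrtr_ge0.
have q40 : 0 <= q ^+ 4 by rewrite exprn_ge0// ltW.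
split=> //.
  by rewrite /= !big_ord_recr big_ord0 /= /bw /= /b1; field.
move=> d c z c0; rewrite ME; split=> [s x|s].
  case: s => [_|i [_|j [_|k [_|//]]]].
  - rewrite expr0 mulr1; apply: (le_trans (iter_diffquot_le0 _ a0 c0 _ _)).
    by rewrite ler_wpM2l//; lra.
  - apply: (le_trans (iter_diffquot_le1 z a0 c0 b10 be i x)).
    rewrite (_ : c / _ = c * (4 / 3 * q)); last by rewrite /bw/= /b1; field.
    by rewrite ler_wpM2l// expr1 ler_wpM2r ?(ltW q0)//; lra.
  - apply: (le_trans (iter_diffquot_le z a0 c0 b10 be i j [::] x)).
    rewrite (_ : _ / _ = c * (32 / 9 * q ^+ 2)); last by rewrite /bw/= /b1; field.
    by rewrite ler_wpM2l// ler_wpM2r ?sqr_ge0//; lra.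
  - apply: (le_trans (iter_diffquot_le z a0 c0 b10 be i k [:: j] x)).
    rewrite (_ : _ / _ = c * (512 / 27 * q ^+ 3)); last by rewrite /bw/= /b1; field.
    by rewrite ler_wpM2l// ler_wpM2r ?exprn_ge0 ?(ltW q0)//; lra.
case: s => [//|l [//|j [//|i [|//]]]] _ /=.
set f := ramp _ _ _.
have pair k : ridge (1 / q) z k (c / (1 / q) / (2 * b1) / b1)
    (backward_diff b1 (backward_diff (2 * b1) pos))
    (diffquot b1 k (diffquot (2 * b1) k f)).
  by apply: ridge_diffquot => //; apply: ridge_diffquot => //; exact: ridge_ramp.
have pair_other k k' : enorm_lipschitz (c * (24 * q ^+ 4))
    (diffquot (2 * b1) k' (diffquot b1 k (diffquot (2 * b1) k f))).
  have k0 : 0 <= c / (1 / q) / (2 * b1) / b1.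
    apply: divr_ge0 (ltW b10); apply: divr_ge0 (ltW b00).
    exact: divr_ge0 (ltW a0).
  have b12 : 0 <= b1 <= 2 * b1 by apply/andP; split; lra.
  have L := ridge_lipschitz k0 (lipschitz1_diff2 b12) (pair k).
  apply: enorm_lipschitzW (diffquot_enorm_lipschitz k' b00 L).
  rewrite (_ : _ * (_ * _) = c * (256 / 27 * Num.sqrt 5 * q ^+ 4)); last by rewrite /b1; field.
  by rewrite ler_wpM2l// ler_wpM2r//; lra.
have dC (b b' : R) (k k' : 'I_d) (g : 'rV[R]_d -> R) :
    diffquot b k (diffquot b' k' g) = diffquot b' k' (diffquot b k g).
  by apply/funext => x; rewrite diffquotC.
(* Commuting the quotients brings a pair of equal directions next to the ramp, where [pair_other]
   applies. *)
have [->|jl] := eqVneq j l.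
  have [->|il] := eqVneq i l; rewrite ?eqxx /bw /= /=; last first.
    by rewrite (dC (2 * b1) (2 * b1) l i) (dC b1 (2 * b1) l i); exact: pair_other.
  have k0 : 0 <= c / (1 / q) / (2 * b1) / b1 / b1.
    apply: divr_ge0 (ltW b10); apply: divr_ge0 (ltW b10).
    apply: divr_ge0 (ltW b00); exact: divr_ge0 (ltW a0).
  have L := ridge_lipschitz k0 (lipschitz1_diff3 (ltW b10)) (ridge_diffquot b10 (pair l)).
  apply: enorm_lipschitzW L.
  rewrite (_ : _ * Num.sqrt 5 = c * (256 / 27 * Num.sqrt 5 * q ^+ 4)); last by rewrite /b1; field.
  by rewrite ler_wpM2l// ler_wpM2r//; lra.
have [->|il] := eqVneq i l; rewrite /=.
  rewrite [l == j]eq_sym (negbTE jl) /bw /=.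
  by rewrite (dC b1 (2 * b1) l j); exact: pair_other.
have [->|ij] := eqVneq i j; rewrite /bw/=; first exact: pair_other.
have L := diffquot_enorm_lipschitz l b00 (diffquot_enorm_lipschitz j b00
  (diffquot_enorm_lipschitz i b00 (ramp_lipschitz z a0 c0))).
apply: enorm_lipschitzW L.
rewrite (_ : _ * (_ * _) = c * (512 / 27 * q ^+ 4)); last by rewrite /b1; field.
by rewrite ler_wpM2l// ler_wpM2r//; lra.
Qed.

End parameters4.

(** * The smoothing inequality *)

(* The integral is a difference of suprema over simple functions, so it is
   monotone even on functions that are not measurable. *)
Lemma le_integralT (R : realType) (disp : measure_display)
    (T : measurableType disp) (mu : {measure set T -> \bar R})
    (f g : T -> \bar R) :
  (forall w, f w <= g w)%E ->
  (\int[mu]_w f w <= \int[mu]_w g w)%E.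
Proof.
move=> fg; rewrite /integral /= !patch_setT; apply: leeB.
  apply: le_ereal_sup => _ [h hf <-]; exists h => // w.
  by apply: le_trans (hf w) _; apply: (@funepos_le _ _ setT f g); rewrite ?inE.
apply: le_ereal_sup => _ [h hf <-]; exists h => // w.
by apply: le_trans (hf w) _; apply: (@funeneg_le _ _ setT f g); rewrite ?inE.
Qed.

(** * Expectations of test functions *)

Section expectations.
Context {R : realType} {disp : measure_display} {T : measurableType disp}
  (P : probability T R).
Implicit Types (f g : T -> R).

Lemma expectation_bounded f C : (forall w, `|f w| <= C) ->
  ('E_P[f]%E \is a fin_num) /\ `|fine ('E_P[f])| <= C.
Proof.
move=> fC.
have icst (k : R) : (\int[P]_w k%:E = k%:E)%E.
  by rewrite integral_cst// [X in (_ * X)%E]probability_setT mule1.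
have lo : ((- C)%:E <= 'E_P[f])%E.
  rewrite unlock -icst; apply: le_integralT => w.
  by rewrite lee_fin; have := fC w; rewrite ler_norml => /andP[].
have hi : ('E_P[f] <= C%:E)%E.
  rewrite unlock -icst; apply: le_integralT => w.
  by rewrite lee_fin; have := fC w; rewrite ler_norml => /andP[].
have fin : 'E_P[f]%E \is a fin_num.
  by rewrite fin_numE; case: ('E_P[f])%E lo hi.
split=> //; rewrite ler_norml -!lee_fin fineK// lo; exact: hi.
Qed.

Lemma le_fine_expectation f g C : (forall w, `|f w| <= C) ->
  (forall w, `|g w| <= C) -> (forall w, f w <= g w) ->
  fine ('E_P[f]) <= fine ('E_P[g]).
Proof.
move=> fC gC fg; apply: fine_le.
- by have [] := expectation_bounded fC.
- by have [] := expectation_bounded gC.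
- by rewrite unlock; apply: le_integralT => w; rewrite lee_fin.
Qed.

Lemma expectation_step (c : R) n (A : 'I_n.+1 -> T -> bool) :
  (forall k, measurable [set w | A k w]) ->
  fine ('E_P[fun w => c * (n.+1%:R^-1 * \sum_k (A k w)%:R - 2^-1)]) =
  c * (n.+1%:R^-1 * \sum_k fine (P [set w | A k w]) - 2^-1).
Proof.
move=> mA.
have mAk k : measurable_fun setT (fun w => (A k w)%:R : R).
  rewrite (_ : (fun w => _) = \1_[set w | A k w]); first exact: measurable_indic.
  by apply/funext => w; rewrite indicE mem_setE.
have iA k : P.-integrable setT (EFin \o (fun w => (A k w)%:R : R)).
  apply: (@bounded_integrable _ _ _ _ _ 1) => // w.
  by case: (A k w); rewrite ?normr1 ?normr0.
have pA k : fine (P [set w | A k w]) = \int[P]_w (A k w)%:R.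
  congr fine; transitivity (\int[P]_w (\1_[set w | A k w] w)%:E)%E.
    by rewrite integral_indic// setIT.
  by apply: eq_integral => w _; rewrite indicE mem_setE.
have [IS iS] : \int[P]_w (\sum_k (A k w)%:R) = \sum_k \int[P]_w (A k w)%:R /\
    P.-integrable setT (EFin \o (fun w => \sum_k (A k w)%:R : R)).
  elim: (index_enum _) => [|k s [IH iS]].
    rewrite big_nil; under eq_Rintegral do rewrite big_nil.
    rewrite Rintegral_cst// mul0r; split=> //.
    by under eq_fun do rewrite big_nil; exact: finite_measure_integrable_cst.
  under eq_Rintegral do rewrite big_cons.
  rewrite big_cons RintegralD// IH; split=> //.
  under eq_fun do rewrite big_cons.
  by apply: eq_integrable (integrableD measurableT (iA k) iS).
have i2 : P.-integrable setT (EFin \o (fun=> 2^-1 : R)).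
  exact: finite_measure_integrable_cst.
have iNS : P.-integrable setT (EFin \o (fun w => n.+1%:R^-1 * \sum_k (A k w)%:R : R)).
  by apply: eq_integrable (integrableZl measurableT _ iS).
have iNSB : P.-integrable setT
    (EFin \o (fun w => n.+1%:R^-1 * \sum_k (A k w)%:R - 2^-1 : R)).
  by apply: eq_integrable (integrableB measurableT iNS i2).
under eq_bigr do rewrite pA.
rewrite unlock -[LHS]/(\int[P]_w _) RintegralZl// RintegralB// RintegralZl// IS.
by rewrite Rintegral_cst// [X in fine X]probability_setT mulr1.
Qed.

End expectations.

Lemma Hclass_le1 (R : realType) (d m : nat) (h : 'rV[R]_d -> R) : (1 <= m)%N ->
  Hclass m h -> forall x, `|h x| <= 1.
Proof.
move=> m1 [_ _ /(_ 0%N m1) h1 _] x; rewrite -lee_fin (le_trans _ h1)//.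
rewrite /snorm (bigmaxD1 [tuple])//= le_max; apply/orP; left.
by apply: ereal_sup_ubound; exists x.
Qed.

Lemma dist_m_ge (R : realType) (d m : nat)
    (disp : measure_display) (T : measurableType disp) (P : probability T R)
    (disp' : measure_display) (T' : measurableType disp') (Q : probability T' R)
    (X : 'I_d -> {RV P >-> R}) (Y : 'I_d -> {RV Q >-> R}) (h : 'rV[R]_d -> R) :
  (1 <= m)%N -> Hclass m h ->
  `|fine ('E_P[fun w => h (rvec X w)]) - fine ('E_Q[fun w => h (rvec Y w)])| <=
  dist_m m X Y.
Proof.
move=> m1 Hh; apply: ub_le_sup; last by exists h.
exists 2 => _ [g Hg <-]; have g1 := Hclass_le1 m1 Hg.
rewrite (le_trans (ler_normB _ _))// -[2]/(1 + 1) lerD//.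
  by have [] := expectation_bounded P (f := fun w => g (rvec X w)) (fun w => g1 _).
by have [] := expectation_bounded Q (f := fun w => g (rvec Y w)) (fun w => g1 _).
Qed.

Section smoothing_class.
Context {R : realType} {d m : nat} (q a : R) (bw : nat -> R).
Hypotheses (m1 : (1 <= m)%N) (good : good_smoothing m q a bw).
Variables (c : R) (z : 'rV[R]_d).
Hypotheses (c_ge0 : 0 <= c)
  (c_le : forall j, (j <= m)%N -> c * (Mprime R m * q ^+ j) <= 1).

Definition smoothing : 'rV[R]_d -> R :=
  iter_average bw (remaining m.-1 [::]) (ramp a c z).

Let a_gt0 : 0 < a. Proof. by case: good. Qed.
Let bw_gt0 t : 0 < bw t. Proof. by case: good. Qed.

Lemma smoothing_Hclass : Hclass m smoothing.
Proof.
have [_ _ _ /(_ d c z c_ge0) [bsup blip]] := good.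
have Lr := ramp_coord_lipschitz z a_gt0 c_ge0.
have plip s : size s = m.-1 -> forall x y,
    `|partial smoothing s x - partial smoothing s y| <= 1 * enorm (x - y).
  move=> sm; rewrite (partial_smoothing bw_gt0 _ Lr) ?sm//.
  have [L sL] := iter_diffquot_coord_lipschitz bw_gt0 s Lr.
  apply: (iter_average_modulus bw_gt0 _ (Lam := fun v => 1 * enorm v) sL) => x y.
  by apply: enorm_lipschitzW (blip s sm) x y; exact: c_le.
split.
- exact: (@has_partials_smoothing _ _ _ bw_gt0 m.-1 _ _ Lr).
- by move=> s; exists 1; apply: plip; exact: size_tuple.
- move=> j jm; apply: bigmax_le => // s _; apply: ge_ereal_sup => _ [x _ <-].
  have sm : (size s <= m.-1)%N by rewrite size_tuple -ltnS prednK.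
  rewrite lee_fin (partial_smoothing bw_gt0 sm Lr).
  have [L sL] := iter_diffquot_coord_lipschitz bw_gt0 s Lr.
  rewrite ler_norml; apply: (iter_average_between bw_gt0 _ sL) => y.
  rewrite -ler_norml (le_trans (bsup s y _)) ?size_tuple//.
  by apply: c_le; exact: ltnW.
- apply: bigmax_le => // s _; apply: ge_ereal_sup => _ [[x y] _ <-] /=.
  rewrite lee_fin.
  have [->|e0] := eqVneq (enorm (x - y)) 0; first by rewrite invr0 mulr0.
  rewrite ler_pdivrMr ?lt_neqAle 1?eq_sym ?e0 ?enorm_ge0//.
  by apply: plip; exact: size_tuple.
Qed.

End smoothing_class.

Section sandwich.
Context {R : realType} {d : nat} (bw : nat -> R).
Hypothesis bw_gt0 : forall t, 0 < bw t.
Implicit Types (g : 'rV[R]_d -> R) (W : seq (nat * 'I_d)).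

(** Each average moves the point back along its axis by at most its width, which can only raise an
    antitone function; the widths add up direction by direction. *)
Lemma iter_average_antitone W L g x : coord_lipschitz L g -> antitone g ->
  g x <= iter_average bw W g x <=
    g (x - \row_l \sum_(p <- W | p.2 == l) bw p.1).
Proof.
move=> gL ga; elim: W x => [|p W IH] x /=.
  by rewrite (_ : \row_l _ = 0) ?subr0 ?lexx//; apply/rowP => l; rewrite !mxE big_nil.
apply: (average_between _ (iter_average_coord_lipschitz bw_gt0 W gL)) => // u /andP[u0 ub].
have /andP[lo hi] := IH (x - u *: delta_mx 0 p.2); apply/andP; split.
  by apply: le_trans lo; apply: ga => l; exact: shift_le.
apply: le_trans hi _; apply: ga => l; rewrite !mxE eqxx big_cons eq_sym /=.
by case: eqP => _; rewrite ?mulr1 ?mulr0; lra.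
Qed.

Lemma sum_remaining n (l : 'I_d) :
  \sum_(p <- remaining n [::] | p.2 == l) bw p.1 = \sum_(t < n) bw t.
Proof.
rewrite big_mkcond big_filter /= big_allpairs /= -[in RHS](big_mkord xpredT) /index_iota subn0.
apply: eq_bigr => t _; rewrite big_enum /= -big_mkcond big_pred1_eq //.
Qed.

End sandwich.

Lemma le_natSinv (R : realType) (x y e : R) :
  (forall n, x <= y + e * n.+1%:R^-1) -> x <= y.
Proof.
move=> H; apply/ler_addgt0Pr => eps eps0.
have [e0|e0] := leP e 0.
  apply: le_trans (H 0%N) _; rewrite lerD2l (le_trans _ (ltW eps0))//.
  by rewrite mulr_le0_ge0.
pose n := Num.truncn (e / eps).
apply: le_trans (H n) _; rewrite lerD2l ler_pdivrMr// -ler_pdivrMl// mulrC.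
by rewrite ltW// truncnS_gt.
Qed.

Section smoothing_expectation.
Context {R : realType} {d m : nat} (q a : R) (bw : nat -> R).
Hypotheses (m1 : (1 <= m)%N) (good : good_smoothing m q a bw).
Variable (c : R).
Hypotheses (c_ge0 : 0 <= c)
  (c_le : forall j, (j <= m)%N -> c * (Mprime R m * q ^+ j) <= 1).
Context {disp : measure_display} {T : measurableType disp}
  (P : probability T R) (X : 'I_d -> {RV P >-> R}).
Implicit Type z : 'rV[R]_d.

Definition orthant_prob z (t : R) : R :=
  fine (P [set w | forall j, rvec X w 0 j <= z 0 j + t]).

Let width := \sum_(t < m.-1) bw t.
Let a_gt0 : 0 < a. Proof. by case: good. Qed.
Let bw_gt0 t : 0 < bw t. Proof. by case: good. Qed.
Let smooth z := smoothing (m := m) a bw c z.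

Lemma smoothing_between z x :
  ramp a c z x <= smooth z x <= ramp a c z (x - const_mx width).
Proof.
have := iter_average_antitone bw_gt0 (remaining m.-1 [::]) x
  (ramp_coord_lipschitz z a_gt0 c_ge0) (ramp_decreasing z a_gt0 c_ge0).
by rewrite (_ : \row_l _ = const_mx width)//; apply/rowP => l; rewrite !mxE sum_remaining.
Qed.

Let step n (s : 'I_n.+1 -> R) (z x : 'rV[R]_d) : R :=
  c * (n.+1%:R^-1 * \sum_k [forall l, x 0 l <= z 0 l + s k]%:R - 2^-1).

Let expectation_steps n s z :
  fine ('E_P[fun w => @step n s z (rvec X w)]) =
  c * (n.+1%:R^-1 * \sum_k orthant_prob z (s k) - 2^-1).
Proof.
have E (t : R) : [set w | [forall l, rvec X w 0 l <= z 0 l + t]] =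
    [set w | forall j, rvec X w 0 j <= z 0 j + t].
  by apply/seteqP; split => w /= /forallP.
rewrite expectation_step; last by move=> k; rewrite E; exact: measurable_box.
by under eq_bigr do rewrite E.
Qed.

Let step_le n s z x : `|@step n s z x| <= c.
Proof.
rewrite /step normrM ger0_norm// -[leRHS]mulr1 ler_wpM2l//.
have n0 : 0 < n.+1%:R :> R by [].
have S1 : \sum_(k < n.+1) [forall l, x 0 l <= z 0 l + s k]%:R <= n.+1%:R :> R.
  rewrite -[leRHS]mulr1 mulr_natl -[in leRHS](card_ord n.+1) -sumr_const.
  by apply: ler_sum => k _; rewrite lern1 leq_b1.
have : n.+1%:R^-1 * \sum_(k < n.+1) [forall l, x 0 l <= z 0 l + s k]%:R <= 1 :> R.
  by rewrite ler_pdivrMl// mulr1.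
have : 0 <= n.+1%:R^-1 * \sum_(k < n.+1) [forall l, x 0 l <= z 0 l + s k]%:R :> R.
  by rewrite mulr_ge0 ?invr_ge0// sumr_ge0.
by move: (_ * _) => v v0 v1; rewrite ler_norml; lra.
Qed.

Let smooth_le z x : `|smooth z x| <= 1.
Proof. exact: (Hclass_le1 m1 (smoothing_Hclass m1 good z c_ge0 c_le)). Qed.

Lemma expectation_smoothing_ge n z :
  c * (n.+1%:R^-1 * \sum_(k < n.+1) orthant_prob z (k%:R / n.+1%:R * a) - 2^-1) <=
  fine ('E_P[fun w => smooth z (rvec X w)]).
Proof.
rewrite -expectation_steps; apply: (@le_fine_expectation _ _ _ _ _ _ (Num.max c 1)).
- by move=> w; rewrite le_max step_le.
- by move=> w; rewrite le_max smooth_le orbT.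
- move=> w; have /andP[lo _] := smoothing_between z (rvec X w).
  by apply: le_trans lo; exact: ramp_ge_step.
Qed.

Lemma expectation_smoothing_le n z :
  fine ('E_P[fun w => smooth z (rvec X w)]) <=
  c * (n.+1%:R^-1 * \sum_(k < n.+1) orthant_prob z (width + k.+1%:R / n.+1%:R * a) - 2^-1).
Proof.
rewrite -(expectation_steps (fun k : 'I_n.+1 => width + k.+1%:R / n.+1%:R * a)).
apply: (@le_fine_expectation _ _ _ _ _ _ (Num.max c 1)).
- by move=> w; rewrite le_max smooth_le orbT.
- by move=> w; rewrite le_max step_le.
- move=> w; have /andP[_ hi] := smoothing_between z (rvec X w).
  apply: le_trans hi _; apply: le_trans (ramp_le_step z a_gt0 c_ge0 n _) _.
  rewrite ler_wpM2l// lerD2r ler_wpM2l ?invr_ge0//; apply: ler_sum => k _.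
  rewrite le_eqVlt; apply/orP; left; apply/eqP; congr (nat_of_bool _)%:R.
  by apply: eq_forallb => l; rewrite !mxE lerBlDr -addrA [_ / _ * a + _]addrC.
Qed.

End smoothing_expectation.

Section kolmogorov_bound.
Context {R : realType} {d m : nat} {disp : measure_display}
  {T : measurableType disp} {P : probability T R} {disp' : measure_display}
  {T' : measurableType disp'} {Q : probability T' R}.
Variables (X : 'I_d -> {RV P >-> R}) (Y : 'I_d -> {RV Q >-> R})
  (mu : 'rV[R]_d) (Sigma : 'M[R]_d).
Hypotheses (hd : (1 <= d)%N) (hm : (1 <= m)%N) (hY : is_MVN Y mu Sigma)
  (hSigma : forall j, 0 < Sigma j j).

Let A := (Num.sqrt (2 * ln d%:R) + 2) / min_sd Sigma.

Lemma orthant_prob_increment z s t : s <= t ->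
  orthant_prob Y z t - orthant_prob Y z s <= (t - s) * A.
Proof.
move=> st; have := nazarov_inequality (fun j => z 0 j + s) hd hY hSigma
  (t := t - s); rewrite subr_ge0 => /(_ st).
suff -> : [set w | forall j, rvec Y w 0 j <= z 0 j + s + (t - s)] =
    [set w | forall j, rvec Y w 0 j <= z 0 j + t] by [].
by apply/funext => w /=; under eq_forall do rewrite -addrA subrKC.
Qed.

Let orthant_prob_shift (disp0 : measure_display) (T0 : measurableType disp0)
    (P0 : probability T0 R) (Z : 'I_d -> {RV P0 >-> R}) z t :
  orthant_prob Z (z - const_mx t) t = orthant_prob Z z 0.
Proof.
suff : [set w | forall j, rvec Z w 0 j <= (z - const_mx t) 0 j + t] =
    [set w | forall j, rvec Z w 0 j <= z 0 j + 0] by rewrite /orthant_prob => ->.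
by apply/seteqP; split => w /= H j; have := H j; rewrite !mxE subrK addr0.
Qed.

(** The average over the levels of the ramp: here the ramp costs only [a / 2], up to an error of
    order 1/n that [le_natSinv] removes. *)
Let mean_steps (u a : R) n :
  n.+1%:R^-1 * \sum_(k < n.+1) (u + A * (k%:R / n.+1%:R * a)) =
  u + A * (a / 2 - a / 2 / n.+1%:R).
Proof.
have n0 : n.+1%:R != 0 :> R by [].
have S N : \sum_(k < N) k%:R = N%:R * (N%:R - 1) / 2 :> R.
  elim: N => [|N IH]; first by rewrite big_ord0 !mul0r.
  by rewrite big_ord_recr /= IH -natr1; field.
rewrite big_split /= sumr_const card_ord -mulr_natl -big_distrr -!big_distrl /= S.
by field.
Qed.

Lemma smoothing_inequality q a bw c z : good_smoothing m q a bw -> 0 < c ->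
  (forall j, (j <= m)%N -> c * (Mprime R m * q ^+ j) <= 1) ->
  `|orthant_prob X z 0 - orthant_prob Y z 0| <= c^-1 * dist_m m X Y + A * (2 / q).
Proof.
move=> good c0 cle; have c0' := ltW c0; have [a0 bw0 widthE _] := good.
have cdm z' := dist_m_ge X Y hm (smoothing_Hclass hm good z' c0' cle).
set w := \sum_(t < m.-1) bw t in widthE.
have w0 : 0 <= w by apply: sumr_ge0 => t _; exact: ltW.
have cV (u v D : R) : c * (u - 2^-1) <= c * (v - 2^-1) + D -> u <= v + c^-1 * D.
  move=> H; rewrite -(lerD2r (- 2^-1)) -(ler_pM2l c0) (le_trans H)//.
  by rewrite le_eqVlt; apply/orP; left; apply/eqP; field; rewrite gt_eqF.
have N0 n : 0 <= n.+1%:R^-1 :> R by rewrite invr_ge0.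
rewrite ler_norml; apply/andP; split; last first.
  apply: (@le_natSinv _ _ _ (A * (a / 2))) => n.
  (* A single step is used for [X]: its only level is 0, so [P(X <= z)] itself appears. The fine
     steps are reserved for [Y], whose increments are controlled. *)
  have lo := expectation_smoothing_ge hm good c0' cle X 0%N z.
  have hi := expectation_smoothing_le hm good c0' cle Y n z.
  have := cdm z; rewrite ler_distl => /andP[_ dm].
  have := cV _ _ _ (le_trans lo (le_trans dm (lerD hi (lexx _)))).
  rewrite big_ord1 !mul0r invr1 mul1r => H.
  have : n.+1%:R^-1 * \sum_(k < n.+1) orthant_prob Y z (w + k.+1%:R / n.+1%:R * a) <=
      orthant_prob Y z 0 + A * (w + a / n.+1%:R) + A * (a / 2 - a / 2 / n.+1%:R).
    rewrite -mean_steps ler_wpM2l//; apply: ler_sum => k _.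
    have -> : w + k.+1%:R / n.+1%:R * a = w + a / n.+1%:R + k%:R / n.+1%:R * a.
      by rewrite -natr1; field.
    have t0 : 0 <= w + a / n.+1%:R + k%:R / n.+1%:R * a.
      by rewrite !addr_ge0 ?mulr_ge0 ?N0 ?(ltW a0).
    have := orthant_prob_increment z t0.
    by rewrite subr0 lerBlDl mulrDl !(mulrC A) addrA.
  move=> H2; have := le_trans H (lerD H2 (lexx _)); rewrite -widthE -subr_ge0 => H'.
  by rewrite -subr_ge0 (le_trans H')// le_eqVlt; apply/orP; left; apply/eqP; field;
    rewrite nat1r pnatr_eq0 gt_eqF ?gt_eqF.
rewrite lerNl opprB.
apply: (@le_natSinv _ _ _ (A * (a / 2))) => n.
(* The test function is moved back by its whole width [w + a], so that the single upper level for
   [X] lands on [z]. *)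
pose z' := z - const_mx (w + a).
have zX : orthant_prob X z' (w + a) = orthant_prob X z 0 by apply: orthant_prob_shift.
have zY : orthant_prob Y z' (w + a) = orthant_prob Y z 0 by apply: orthant_prob_shift.
have lo := expectation_smoothing_ge hm good c0' cle Y n z'.
have hi := expectation_smoothing_le hm good c0' cle X 0%N z'.
have := cdm z'; rewrite ler_distlC => /andP[_ dm].
have := cV _ _ _ (le_trans lo (le_trans dm (lerD hi (lexx _)))).
rewrite big_ord1 divr1 !mul1r invr1 mul1r zX => H.
have : orthant_prob Y z 0 - A * (w + a) + A * (a / 2 - a / 2 / n.+1%:R) <=
    n.+1%:R^-1 * \sum_(k < n.+1) orthant_prob Y z' (k%:R / n.+1%:R * a).
  rewrite -mean_steps ler_wpM2l//; apply: ler_sum => k _.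
  have tk : k%:R / n.+1%:R * a <= w + a.
    have kn : k%:R / n.+1%:R <= 1 :> R.
      by rewrite ler_pdivrMr// mul1r ler_nat ltnW.
    by rewrite (le_trans (ler_piMl (ltW a0) kn))// lerDr.
  have := orthant_prob_increment z' tk.
  rewrite zY mulrBl !(mulrC A).
  by rewrite lerBlDr -lerBlDl opprB addrA addrAC.
move=> H2; have := le_trans H2 H; rewrite -widthE -subr_ge0 => H'.
by rewrite -subr_ge0 (le_trans H')// le_eqVlt; apply/orP; left; apply/eqP; field;
    rewrite nat1r pnatr_eq0 gt_eqF ?gt_eqF.
Qed.

Lemma dist_K_le alpha : 0 < alpha -> dist_K X Y <=
  A * alpha + Mprime R m * Num.max 1 ((2 / alpha) ^+ m) * dist_m m X Y.
Proof.
move=> al0; have q0 : 0 < 2 / alpha by rewrite divr_gt0.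
have M0 : 0 < Mprime R m by apply: lt_le_trans (Mprime_ge R hm).
set B := Mprime R m * _.
have B0 : 0 < B by rewrite mulr_gt0// lt_max ltr01.
have cle j : (j <= m)%N -> B^-1 * (Mprime R m * (2 / alpha) ^+ j) <= 1.
  move=> jm; rewrite ler_pdivrMl// mulr1 ler_wpM2l ?(ltW M0)// le_max.
  have [q1|q1] := leP (2 / alpha) 1; first by rewrite exprn_ile1 ?(ltW q0).
  by rewrite ler_weXn2l ?(ltW q1) ?orbT.
have [a [bw good]] : exists a bw, good_smoothing m (2 / alpha) a bw.
  have [m3|m3] := eqVneq m 3%N.
    by rewrite m3; do 2 eexists; exact: good_smoothing3.
  have [m4|m4] := eqVneq m 4%N.
    by rewrite m4; do 2 eexists; exact: good_smoothing4.
  by do 2 eexists; apply: good_smoothing_generic => //; exact: expn_le_Mprime.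
apply: ge_sup; first by eexists; exists 0.
move=> _ [z _ <-].
have E (disp0 : measure_display) (T0 : measurableType disp0)
    (P0 : probability T0 R) (Z : 'I_d -> {RV P0 >-> R}) :
  fine (P0 [set w | forall j, rvec Z w 0 j <= z 0 j]) = orthant_prob Z z 0.
  rewrite /orthant_prob; congr (fine (P0 _)).
  by apply/seteqP; split => w /= H j; have := H j; rewrite addr0.
have B0' : 0 < B^-1 by rewrite invr_gt0.
rewrite !E (le_trans (smoothing_inequality z good B0' cle))// invrK addrC.
by rewrite invf_div [2 * _]mulrCA divff ?mulr1 ?pnatr_eq0.
Qed.

End kolmogorov_bound.

Lemma dist_m_ge0 (R : realType) (d m : nat)
    (disp : measure_display) (T : measurableType disp) (P : probability T R)
    (disp' : measure_display) (T' : measurableType disp') (Q : probability T' R)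
    (X : 'I_d -> {RV P >-> R}) (Y : 'I_d -> {RV Q >-> R}) :
  0 <= dist_m m X Y.
Proof.
rewrite /dist_m; set S := [set _ | _ in _].
(* [sup] is 0 by default on a set without supremum. *)
have [[[x Sx] Sub]|/sup_out ->//] := pselect (has_sup S).
by apply: le_trans (ub_le_sup Sub Sx); case: Sx => h _ <-.
Qed.

Theorem proposition2p6 (R : realType) (d m : nat)
    (hd : (1 <= d)%N) (hm : (1 <= m)%N)
    (disp : measure_display) (T : measurableType disp) (P : probability T R)
    (X : 'I_d -> {RV P >-> R})
    (disp' : measure_display) (T' : measurableType disp')
    (Q : probability T' R)
    (Y : 'I_d -> {RV Q >-> R})
    (mu : 'rV[R]_d) (Sigma : 'M[R]_d)
    (hY : is_MVN Y mu Sigma)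
    (hSigma : forall j, 0 < Sigma j j) :
  let sigma := min_sd Sigma in
  let M' := Mprime R m in
  let N' := Nprime R m in
  let K := Num.sqrt (2 * ln d%:R) : R in
  let main_term :=
    2 * ((K + 2) / sigma) `^ (m%:R / (m%:R + 1))
      * (N' * dist_m m X Y) `^ (1 / (m%:R + 1)) in
  [/\ dist_K X Y <= main_term + M' * dist_m m X Y,
      dist_m m X Y <= (2 + K) / (sigma * N') -> dist_K X Y <= main_term
    & (2 <= m)%N -> dist_m m X Y <= (4 + 2 * K) / (sigma * M') ->
      dist_K X Y <= main_term].
Proof.
move=> sigma M' N' K main_term.
have sg0 : 0 < sigma by exact: min_sd_gt0.
have K0 : 0 <= K by exact: sqrtr_ge0.
set A := (K + 2) / sigma in main_term *.
have A0 : 0 < A by rewrite divr_gt0// ltr_wpDl.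
have M0 : 0 < M' by apply: lt_le_trans (Mprime_ge R hm).
have N0 : 0 < N' by rewrite mulr_gt0// exprn_gt0.
have le_alpha := dist_K_le X hd hm hY hSigma.
rewrite -/K -/sigma -/A -/M' in le_alpha.
have : 0 <= dist_m m X Y by exact: dist_m_ge0.
set D := dist_m m X Y in main_term le_alpha *.
have main0 : 0 <= main_term by rewrite !mulr_ge0 ?powR_ge0.
(* For D = 0 the optimal alpha degenerates to 0; the arbitrarily small values [e / A] give
   [dist_K X Y <= 0] instead. *)
rewrite le_eqVlt => /orP[/eqP D0|D0].
  have dK0 : dist_K X Y <= 0.
    apply/ler_addgt0Pr => e e0; have := le_alpha (e / A) (divr_gt0 e0 A0).
    by rewrite -D0 mulr0 addr0 add0r mulrCA divff ?mulr1// gt_eqF.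
  have dK : dist_K X Y <= main_term by exact: le_trans dK0 main0.
  by split=> //; rewrite -D0 mulr0 addr0.
set E := N' * D in main_term main0 *.
have E0 : 0 < E by rewrite mulr_gt0.
have m0 : 0 < m%:R + 1 :> R by rewrite ltr_wpDl.
pose half := A `^ (m%:R / (m%:R + 1)) * E `^ (1 / (m%:R + 1)).
have mainE : main_term = half + half by rewrite /main_term /half; ring.
pose alpha := half / A.
have h0 : 0 < half by rewrite mulr_gt0// powR_gt0.
have al0 : 0 < alpha by rewrite divr_gt0.
have Aal : A * alpha = half by rewrite /alpha mulrCA divff ?mulr1// gt_eqF.
have halfX : half ^+ m.+1 = A ^+ m * E.
  have root (x y : R) : (x `^ (y / (m%:R + 1))) ^+ m.+1 = x `^ y.
    by rewrite -powR_mulrn ?powR_ge0// -powRrM -natr1 divfK ?gt_eqF.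
  by rewrite /half exprMn !root powRr1 ?(ltW E0)// powR_mulrn ?ltW.
have alX : A * alpha ^+ m.+1 = E.
  rewrite expr_div_n halfX exprS; field.
  by rewrite expf_neq0 gt_eqF.
have ME : M' * (2 / alpha) ^+ m * D = half.
  rewrite expr_div_n -Aal.
  have -> : M' * (2 ^+ m / alpha ^+ m) * D = E / alpha ^+ m.
    by rewrite /E /N' /Nprime -/M'; ring.
  by rewrite -alX exprS; field; rewrite expf_neq0 ?gt_eqF.
have := le_alpha alpha al0; rewrite Aal => leK.
have leM : alpha <= 2 -> dist_K X Y <= main_term.
  move=> al2; move: leK; rewrite max_r ?ME ?mainE//.
  by rewrite exprn_ege1// ler_pdivlMr// mul1r.
(* Since alpha^(m+1) = E / A, this is the condition [alpha <= 2], under which the power is the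
   larger entry of the maximum. *)
have leE : E <= 2 ^+ m.+1 * A -> dist_K X Y <= main_term.
  move=> EA; apply: leM; rewrite -(@ler_pXn2r _ m.+1) ?nnegrE ?(ltW al0)//.
  by rewrite -(ler_pM2l A0) alX mulrC.
split=> [|DN|_ DM].
(* From [max 1 x <= 1 + x]; the 1 accounts for the extra term [M' * D]. *)
- rewrite (le_trans leK)// mainE -addrA lerD2l -[in leRHS]ME -!mulrDl.
  rewrite ler_wpM2r ?(ltW D0)// -[X in _ <= _ + X]mulr1 -mulrDr ler_wpM2l ?(ltW M0)//.
  have q0 : 0 <= (2 / alpha) ^+ m by apply: exprn_ge0; rewrite divr_ge0 ?ltW.
  by rewrite ge_max lerDr lerDl q0 ler01.
- apply: leE; apply: (@le_trans _ _ A).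
    rewrite /E -ler_pdivlMl// (_ : N'^-1 * A = (2 + K) / (sigma * N'))//.
    by rewrite /A; field; rewrite !gt_eqF.
  by rewrite ler_peMl ?(ltW A0)// exprn_ege1// ler1n.
(* Multiplied by [N'], the hypothesis is exactly [E <= 2 ^+ m.+1 * A]. *)
- apply: leE; rewrite /E /N' /Nprime -/M' exprSr -!mulrA.
  rewrite ler_wpM2l ?exprn_ge0// -ler_pdivlMl//.
  rewrite (_ : M'^-1 * (2 * A) = (4 + 2 * K) / (sigma * M'))//.
  by rewrite /A; field; rewrite !gt_eqF.
Qed.
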